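(* There exist procedures of complexity $\mathcal O(|\mathcal X|^3)$ which, given $\bar A\in\{0,1\}^{n\times n}$, compute a solution to $\mathcal P_1^d$, a solution to $\mathcal P_1$, and a solution to $\mathcal P_2$, respectively, where $|\mathcal X|=n$ is the number of state vertices of $\mathcal D(\bar A)$.
   Context: $\|\cdot\|_0$ is the number of non-zero entries. $(\bar A,\bar B)$ is structurally controllable if there is a controllable real pair $(A_0,B_0)$ (system $\dot x=A_0x+B_0u$) having the same locations of zero and non-zero entries as $(\bar A,\bar B)$; $(\bar A,\bar C)$ is structurally observable if $(\bar A^T,\bar C^T)$ is structurally controllable. For a binary matrix $\bar M$, $[\bar M]$ is the set of real matrices $M$ of the same size with $M_{ij}=0$ whenever $\bar M_{ij}=0$; $\sigma(X)$ is the set of eigenvalues of $X$. $(\bar A,\bar B,\bar K,\bar C)$ has structurally fixed modes if $\bigcap_{K\in[\bar K]}\sigma(A+BKC)\neq\emptyset$ for all $A\in[\bar A],B\in[\bar B],C\in[\bar C]$; otherwise it has no structurally fixed modes. $\mathcal D(\bar A)$ is the digraph on $\mathcal X=\{x_1,\dots,x_n\}$ with edge $(x_i,x_j)$ iff $\bar A_{ji}=1$. All design matrices $\bar B,\bar C,\bar K$ are in $\{0,1\}^{n\times n}$. Problem $\mathcal P_1$: find $(\bar B,\bar C)$ such that $\bar B$ minimizes $\|\bar B\|_0$ subject to $(\bar A,\bar B)$ structurally controllable, and $\bar C$ minimizes $\|\bar C\|_0$ subject to $(\bar A,\bar C)$ structurally observable. Problem $\mathcal P_1^d$: the same two minimizations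 with the additional constraints that each column of $\bar B$ has at most one non-zero entry and each row of $\bar C$ has at most one non-zero entry. Problem $\mathcal P_2$: find $(\bar B,\bar K,\bar C)$ minimizing $\|\bar B\|_0+\|\bar C\|_0+\|\bar K\|_0$ subject to $(\bar A,\bar B,\bar K,\bar C)$ having no structurally fixed modes. *)

(* Defs.v *)
From HB Require Import structures.
From mathcomp Require Import all_boot all_order all_algebra.
From mathcomp Require Import complex.
From mathcomp Require Import boolp classical_sets reals topology normedtype derive.

Set Implicit Arguments.
Unset Strict Implicit.
Unset Printing Implicit Defensive.

Import Order.TTheory GRing.Theory Num.Theory.
Import numFieldNormedType.Exports.

Local Open Scope classical_set_scope.
Local Open Scope ring_scope.

(* Binary matrices are Boolean matrices: true encodes 1, false encodes 0. *)

Definition nnz (m n : nat) (M : 'M[bool]_(m, n)) : nat :=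
  #|[set ij : 'I_m * 'I_n | M ij.1 ij.2]%SET|.

(* The trajectory is required to exist on the whole time axis; since the
   system is linear and time-invariant, this is the same as asking for a
   trajectory on [0, T] only. *)
Definition controllable (R : realType) (n p : nat)
    (A : 'M[R]_n) (B : 'M[R]_(n, p)) : Prop :=
  forall x0 x1 : 'cV[R]_n,
  exists (T : R) (u : R -> 'cV[R]_p) (x : R -> 'cV[R]_n),
    [/\ 0 < T,
        forall j, continuous (fun t : R => u t j 0),
        forall (t : R) i, is_derive t (1 : R) (fun s : R => x s i 0) ((A *m x t + B *m u t) i 0),
        x 0 = x0
      & x T = x1].

Definition same_pattern (R : realType) (m n : nat)
    (M : 'M[R]_(m, n)) (Mbar : 'M[bool]_(m, n)) : Prop :=
  forall i j, (M i j != 0) = Mbar i j.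

Definition structurally_controllable (R : realType) (n p : nat)
    (Abar : 'M[bool]_n) (Bbar : 'M[bool]_(n, p)) : Prop :=
  exists (A0 : 'M[R]_n) (B0 : 'M[R]_(n, p)),
    [/\ same_pattern A0 Abar, same_pattern B0 Bbar & controllable A0 B0].

Definition structurally_observable (R : realType) (n p : nat)
    (Abar : 'M[bool]_n) (Cbar : 'M[bool]_(p, n)) : Prop :=
  structurally_controllable R Abar^T Cbar^T.

Definition structural_class (R : realType) (m n : nat)
    (Mbar : 'M[bool]_(m, n)) : set 'M[R]_(m, n) :=
  [set M | forall i j, ~~ Mbar i j -> M i j = 0].

Definition spectrum (R : realType) (n : nat) (X : 'M[R]_n) : set R[i] :=
  [set z | eigenvalue (map_mx (real_complex R) X) z].

Definition has_structurally_fixed_modes (R : realType) (n p q : nat)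
    (Abar : 'M[bool]_n) (Bbar : 'M[bool]_(n, p))
    (Kbar : 'M[bool]_(p, q)) (Cbar : 'M[bool]_(q, n)) : Prop :=
  forall (A : 'M[R]_n) (B : 'M[R]_(n, p)) (C : 'M[R]_(q, n)),
    structural_class Abar A -> structural_class Bbar B -> structural_class Cbar C ->
    \bigcap_(K in structural_class Kbar) spectrum (A + B *m K *m C) !=set0.

Definition solves_P1 (R : realType) (n : nat) (Abar Bbar Cbar : 'M[bool]_n) : Prop :=
  [/\ structurally_controllable R Abar Bbar,
      forall B' : 'M[bool]_n,
        structurally_controllable R Abar B' -> (nnz Bbar <= nnz B')%N,
      structurally_observable R Abar Cbar
    & forall C' : 'M[bool]_n,
        structurally_observable R Abar C' -> (nnz Cbar <= nnz C')%N].

Definition dedicated_inputs (n : nat) (Bbar : 'M[bool]_n) : Prop :=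
  forall j, (#|[set i | Bbar i j]%SET| <= 1)%N.

Definition dedicated_outputs (n : nat) (Cbar : 'M[bool]_n) : Prop :=
  forall i, (#|[set j | Cbar i j]%SET| <= 1)%N.

Definition solves_P1d (R : realType) (n : nat) (Abar Bbar Cbar : 'M[bool]_n) : Prop :=
  [/\ structurally_controllable R Abar Bbar /\ dedicated_inputs Bbar,
      forall B' : 'M[bool]_n,
        structurally_controllable R Abar B' -> dedicated_inputs B' ->
        (nnz Bbar <= nnz B')%N,
      structurally_observable R Abar Cbar /\ dedicated_outputs Cbar
    & forall C' : 'M[bool]_n,
        structurally_observable R Abar C' -> dedicated_outputs C' ->
        (nnz Cbar <= nnz C')%N].

Definition solves_P2 (R : realType) (n : nat)
    (Abar Bbar Kbar Cbar : 'M[bool]_n) : Prop :=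
  ~ has_structurally_fixed_modes R Abar Bbar Kbar Cbar /\
  forall B' K' C' : 'M[bool]_n,
    ~ has_structurally_fixed_modes R Abar B' K' C' ->
    (nnz Bbar + nnz Cbar + nnz Kbar <= nnz B' + nnz C' + nnz K')%N.

(* Procedures are structured programs for a unit-cost random access machine
   over the natural numbers: registers with fixed names, an indirectly
   addressed memory, addition, truncated subtraction and zero tests.  There is
   no multiplication or bitwise operation, so that unit cost cannot be abused
   through arithmetic on huge numbers.  A program is a finite syntactic object
   which does not depend on the size of its input. *)

Local Open Scope nat_scope.

Inductive expr : Type :=
| Cst of nat
| Reg of nat
| Mem of expr
| Add of expr & expr
| Sub of expr & expr.

Inductive cmd : Type :=
| Skip
| SetReg of nat & expr            (* reg[r] := e *)
| SetMem of expr & expr           (* mem[e1] := e2 *)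
| Seq of cmd & cmd
| If of expr & cmd & cmd          (* an expression is true when nonzero *)
| While of expr & cmd.

Record state : Type := State { regs : nat -> nat; mem : nat -> nat }.

Definition upd (f : nat -> nat) (a v : nat) : nat -> nat :=
  fun b => if b == a then v else f b.

Fixpoint eval (s : state) (e : expr) : nat :=
  match e with
  | Cst k => k
  | Reg r => regs s r
  | Mem e1 => mem s (eval s e1)
  | Add e1 e2 => eval s e1 + eval s e2
  | Sub e1 e2 => eval s e1 - eval s e2
  end.

Fixpoint ecost (e : expr) : nat :=
  match e with
  | Cst _ | Reg _ => 1
  | Mem e1 => (ecost e1).+1
  | Add e1 e2 | Sub e1 e2 => (ecost e1 + ecost e2).+1
  end.

(* exec p s t s': started in s, the program p halts in s' after t steps. *)
Inductive exec : cmd -> state -> nat -> state -> Prop :=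
| ExecSkip s : exec Skip s 1 s
| ExecSetReg s r e :
    exec (SetReg r e) s (ecost e).+1 (State (upd (regs s) r (eval s e)) (mem s))
| ExecSetMem s e1 e2 :
    exec (SetMem e1 e2) s (ecost e1 + ecost e2).+1
         (State (regs s) (upd (mem s) (eval s e1) (eval s e2)))
| ExecSeq p1 p2 s1 s2 s3 t1 t2 :
    exec p1 s1 t1 s2 -> exec p2 s2 t2 s3 -> exec (Seq p1 p2) s1 (t1 + t2) s3
| ExecIfTrue e p1 p2 s s' t :
    eval s e != 0 -> exec p1 s t s' -> exec (If e p1 p2) s ((ecost e).+1 + t) s'
| ExecIfFalse e p1 p2 s s' t :
    eval s e = 0 -> exec p2 s t s' -> exec (If e p1 p2) s ((ecost e).+1 + t) s'
| ExecWhileTrue e p s1 s2 s3 t1 t2 :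
    eval s1 e != 0 -> exec p s1 t1 s2 -> exec (While e p) s2 t2 s3 ->
    exec (While e p) s1 ((ecost e).+1 + t1 + t2) s3
| ExecWhileFalse e p s :
    eval s e = 0 -> exec (While e p) s (ecost e).+1 s.

Lemma exec_deterministic p s t1 s1 t2 s2 :
  exec p s t1 s1 -> exec p s t2 s2 -> t1 = t2 /\ s1 = s2.
Proof.
move=> E1; elim: E1 t2 s2 => {p s t1 s1} => [s|s r e|s e1 e2
  |p1 p2 s1 s2 s3 t1 t2 _ IH1 _ IH2|e p1 p2 s s1 t1 e0 _ IH1
  |e p1 p2 s s1 t1 e0 _ IH1|e p s1 s2 s3 t1 t2 e0 _ IH1 _ IH2|e p s e0] t' s' E;
inversion E; subst => //;
  try (by match goal with H : eval _ _ = 0, H' : is_true (eval _ _ != 0) |- _ =>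
         rewrite H in H' end).
- have [? ?] : t1 = t0 /\ s2 = s4 by exact: IH1.
  by subst; have [-> ->] : t2 = t3 /\ s3 = s' by exact: IH2.
- by have [-> ->] : t1 = t /\ s1 = s' by exact: IH1.
- by have [-> ->] : t1 = t /\ s1 = s' by exact: IH1.
- have [? ?] : t1 = t0 /\ s2 = s4 by exact: IH1.
  by subst; have [-> ->] : t2 = t3 /\ s3 = s' by exact: IH2.
Qed.

(* The n x n matrix M is stored in row-major order from address a on. *)
Definition stores (n : nat) (a : nat) (M : 'M[bool]_n) (s : state) : Prop :=
  forall i j : 'I_n, mem s (a + (i * n + j)) = M i j.

(* Register 0 holds n, the memory holds Abar in row-major order from address 0
   on, and everything else is 0. *)
Definition input_state (n : nat) (Abar : 'M[bool]_n) : state :=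
  State (upd (fun=> 0) 0 n)
        (fun a => [exists i : 'I_n, exists j : 'I_n, (a == i * n + j) && Abar i j]).

Definition computes_in_cubic_time (p : cmd)
    (post : forall n : nat, 'M[bool]_n -> state -> Prop) : Prop :=
  exists c N : nat, forall (n : nat) (Abar : 'M[bool]_n),
  exists (t : nat) (s : state),
    [/\ exec p (input_state Abar) t s,
        post n Abar s
      & N <= n -> t <= c * n ^ 3].

(* The output matrices are stored in consecutive blocks of n * n cells. *)

Definition outputs_P1d (R : realType) (n : nat) (Abar : 'M[bool]_n) (s : state) : Prop :=
  exists Bbar Cbar : 'M[bool]_n,
    [/\ stores 0 Bbar s, stores (n * n) Cbar s & solves_P1d R Abar Bbar Cbar].

Definition outputs_P1 (R : realType) (n : nat) (Abar : 'M[bool]_n) (s : state) : Prop :=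
  exists Bbar Cbar : 'M[bool]_n,
    [/\ stores 0 Bbar s, stores (n * n) Cbar s & solves_P1 R Abar Bbar Cbar].

Definition outputs_P2 (R : realType) (n : nat) (Abar : 'M[bool]_n) (s : state) : Prop :=
  exists Bbar Kbar Cbar : 'M[bool]_n,
    [/\ stores 0 Bbar s, stores (n * n) Kbar s, stores (n * n + n * n) Cbar s
      & solves_P2 R Abar Bbar Kbar Cbar].

(* Main.v *)
(* Structural controllability of (A, B) with row support U of B means that the rows outside U
   can be matched injectively along edges and that U reaches all states.  Hence the least
   number of inputs is the number of columns left free by a maximum matching of the bipartite
   graph whose columns are the states and the source components: unmatched states S and
   representatives Sx of unmatched source components.  One maximum matching of the states
   gives S and, starting the transposed search from it, the sets T, Tx for the outputs; a diagonal
   pattern is therefore optimal with or without the dedication constraint.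

   For the third problem, S and T, of equal size, are paired by the feedback: greedily chosen
   pairs (v, w) such that v reaches w are chained into a single cycle through a hub, the other
   pairs are arbitrary, and Sx, Tx are attached to the hub input and output.  Generically the
   closed loop is then controllable from the hub input and observable from the hub output, and
   such a system shares no eigenvalue with its perturbation by a hub-to-hub feedback.  Any
   feedback needs max(|S|, 1) entries because some closed loop is nonsingular.

   Sufficiency is proved generically: weights making the system satisfy the Hautus test are
   chosen one cycle of the matching at a time, and the exact zero pattern is restored by a small
   perturbation, since the Gram determinant is a polynomial in the entries.

   The procedures are Warshall's closure, breadth-first augmentations and the greedy pairing:
   their loops run O(n) times and are nested at most three deep. *)

Require Import Defs.
From mathcomp Require Import all_boot all_order perm all_algebra.
From mathcomp Require Import complex zify ring.
From mathcomp Require Import boolp functions reals topology normedtype derive sequences exp.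
From mathcomp Require Import fintype finset.

Set Implicit Arguments.
Unset Strict Implicit.
Unset Printing Implicit Defensive.

Import Order.TTheory GRing.Theory Num.Theory.
Import numFieldNormedType.Exports.

(** * Generic controllability over an algebraically closed field *)

(** Controllability is defined by trajectories, so the Hautus test has to be tied to trajectories in
    both directions. Steering inputs are written down as polynomials, without matrix exponentials;
    conversely an eigenvector that the inputs do not see gives a quantity that cannot leave zero.

    The obstacle to generic sufficiency is that all eigenvalues have to be handled at once. A cycle
    of common weight [d] carries an eigenvector that does not vanish on it only if the eigenvalue
    has modulus [d], whereas the part already treated forces that eigenvalue to be a root of a
    polynomial fixed before [d] is chosen. A suitable [d] excludes both together; meanwhile the
    untreated states count as inputs.

    A state matched to a source component lies in that component and has no state column, so one
    input serves both purposes. The matching therefore has to be maximum on the state columns and on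
    all columns simultaneously. It is, because state columns are treated first and augmentations
    never uncover a column. *)

Section LinearAlgebra.
Local Open Scope ring_scope.

Lemma mxBE (V : zmodType) m n (A B : 'M[V]_(m, n)) i j : (A - B) i j = A i j - B i j.
Proof. by rewrite !mxE. Qed.

Lemma mxDE (V : nmodType) m n (A B : 'M[V]_(m, n)) i j : (A + B) i j = A i j + B i j.
Proof. by rewrite mxE. Qed.

Lemma mxZE (F : pzRingType) m n a (A : 'M[F]_(m, n)) i j : (a *: A) i j = a * A i j.
Proof. by rewrite mxE. Qed.

Lemma char_poly_mx_sum (F : comNzRingType) n (A : 'M[F]_n) :
  \sum_(i < n.+1) (char_poly A)`_i *: A ^+ i = 0.
Proof.
case: n A => [|n] A; first by rewrite [LHS]flatmx0 [RHS]flatmx0.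
have := Cayley_Hamilton A; rewrite /horner_mx /= /horner_morph horner_coef.
rewrite size_map_poly_id0 ?size_char_poly; last first.
  by rewrite (monicP (char_poly_monic A)) rmorph1 oner_neq0.
move=> H; rewrite -[RHS]H; apply: eq_bigr => i _.
by rewrite coef_map /= -[RHS]/(_ *m _) mul_scalar_mx.
Qed.

Lemma char_poly_coefn (F : comNzRingType) n (A : 'M[F]_n) : (char_poly A)`_n = 1.
Proof. by have /monicP := char_poly_monic A; rewrite lead_coefE size_char_poly. Qed.

(** The linear factors of the characteristic polynomial are applied to [v] one after the other. By
    Cayley-Hamilton their product kills [v], so at some stage a nonzero vector is sent to zero, and
    [P] holds for it. [P] plays the part of an invariant subspace, for which no basis has to be
    given. *)
Lemma eigenvector_in (F : closedFieldType) n (A : 'M[F]_n) (P : 'rV[F]_n -> Prop) v :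
  (forall w z, P w -> P (w *m A - z *: w)) -> P v -> v != 0 ->
  exists w z, [/\ P w, w != 0 & w *m A = z *: w].
Proof.
case: n A P v => [|n] A P v HP Pv v0; first by move: v0; rewrite [v]thinmx0 eqxx.
have [rs def_p] := closed_field_poly_normal (char_poly A).
have := Cayley_Hamilton A; rewrite def_p (monicP (char_poly_monic A)) scale1r.
move=> /(congr1 (mulmx v)); rewrite mulmx0; elim: rs v Pv v0 {def_p} => [|z rs IH] v Pv v0.
  by rewrite big_nil rmorph1 mulmx1 => vE; move: v0; rewrite vE eqxx.
rewrite big_cons rmorphM /= -[_ * _]/(_ *m _) mulmxA rmorphB /= horner_mx_X horner_mx_C.
rewrite mulmxBr mul_mx_scalar.
have [vA|w0] := eqVneq (v *m A) (z *: v); first by exists v, z; split.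
by apply: IH; [exact: HP|rewrite subr_eq0].
Qed.

(* By the recursion [u A = z u - f] the entries of [u A^m] at [s] are polynomials in [z]
   with the entries of [f A^j] as coefficients, and Cayley-Hamilton relates them. *)
Lemma resolvent_roots (F : closedFieldType) n (A : 'M[F]_n) (Z : {set 'I_n}) (f : 'rV_n) :
  f != 0 ->
  (forall z (v : 'rV_n), (forall s, s \in Z -> v 0 s = 0) -> v *m A = z *: v -> v = 0) ->
  exists2 p : {poly F}, p != 0 &
    forall z (u : 'rV_n), (forall s, s \in Z -> u 0 s = 0) -> u *m A = z *: u - f -> root p z.
Proof.
move=> f0 pbh.
have [s sZ [k fk]] : exists2 s, s \in Z & exists k, (f *m A ^+ k) 0 s != 0.
  apply: contrapT => nex.
  have vanish s k : s \in Z -> (f *m A ^+ k) 0 s = 0.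
    by move=> sZ; apply/eqP; apply: contraT => fk; case: nex; exists s => //; exists k.
  pose P (v : 'rV[F]_n) := forall s k, s \in Z -> (v *m A ^+ k) 0 s = 0.
  have [|w [z [Pw w0 wE]]] := @eigenvector_in _ _ A P f _ vanish f0.
    move=> w z Pw t k tZ; rewrite mulmxBl -scalemxAl -mulmxA -[A *m _]exprS.
    by rewrite mxBE mxZE !(Pw _ _ tZ) mulr0 subr0.
  move/eqP: w0; apply; apply: pbh wE => t tZ.
  by have := Pw t 0 tZ; rewrite expr0 mulmx1.
pose c j := (f *m A ^+ j) 0 s.
have [k0 ck0 k0min] := @ex_minnP (fun j => c j != 0) (ex_intro _ k fk).
pose h m : {poly F} := \poly_(j < m) c (m - j.+1)%N.
have hS m : h m.+1 = 'X * h m + (c m)%:P.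
  apply/polyP => -[|j]; rewrite !(coefD, coefXM, coefC, coef_poly) /= ?subn1 ?add0r //.
  by rewrite ltnS addr0 subSS.
pose H := \sum_(i < n.+1) (char_poly A)`_i *: h (i + k0.+1)%N.
exists H.
  (* The coefficient of degree [n] of [H] is [c k0]: the monic top term contributes it, and the
     other terms contribute only values of [c] below [k0], which vanish by minimality. *)
  apply: contraNneq ck0 => /(congr1 (fun q : {poly F} => q`_n)).
  rewrite coef0 /H coef_sum big_ord_recr /= char_poly_coefn scale1r coef_poly.
  rewrite addnS ltnS leq_addr subSS addnC addnK => HE.
  rewrite big1 in HE; first by rewrite -HE add0r eqxx.
  move=> i _; rewrite coefZ coef_poly; case: ifP => [lt|_]; last by rewrite mulr0.
      apply/eqP.
  have ltin := ltn_ord i; rewrite mulf_eq0; apply/orP; right.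
  apply: contraT => /k0min; lia.
move=> z u uZ uE.
have aE m : (u *m A ^+ m) 0 s = - (h m).[z].
  elim: m => [|m IH]; first by rewrite expr0 mulmx1 uZ // /h poly_def big_ord0 horner0 oppr0.
  rewrite hS !hornerE exprS mulmxA uE mulmxBl -scalemxAl.
  by rewrite mxBE mxZE IH mulrN opprD.
rewrite rootE /H horner_sum -oppr_eq0 -sumrN.
have -> : \sum_(i < n.+1) - ((char_poly A)`_i *: h (i + k0.+1)%N).[z] =
  (u *m A ^+ k0.+1 *m \sum_(i < n.+1) (char_poly A)`_i *: A ^+ i) 0 s.
  rewrite mulmx_sumr summxE; apply: eq_bigr => i _.
  by rewrite hornerZ -scalemxAr mxE -mulmxA -[_ *m A ^+ i]exprD addnC aE mulrN.
by rewrite char_poly_mx_sum mulmx0 mxE.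
Qed.

Lemma natr_avoid (F : numDomainType) (rs : seq F) :
  exists2 d : nat, (0 < d)%N & d%:R \notin rs.
Proof.
pose s := [seq (i.+1)%:R | i <- iota 0 (size rs).+1] : seq F.
have us : uniq s by rewrite map_inj_uniq ?iota_uniq // => i j /eqP; rewrite eqr_nat => /eqP [].
have : ~~ all (mem rs) s.
  apply/negP => /allP sub; have := uniq_leq_size us sub.
  by rewrite size_map size_iota ltnn.
by move=> /allPn [_ /mapP [i _ ->] H]; exists i.+1.
Qed.

End LinearAlgebra.

(** * Weights that pass the Hautus test *)

Section GenericControllability.
Local Open Scope ring_scope.

(** The Popov-Belevitch-Hautus test with dedicated inputs at the states of [S], on left
    eigenvectors. The entry [(j, i)] of a system matrix is the edge from [i] to [j]. *)
Definition pbh (F : fieldType) n (A : 'M[F]_n) (S : {set 'I_n}) :=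
  forall z (v : 'rV[F]_n), (forall s, s \in S -> v 0 s = 0) -> v *m A = z *: v -> v = 0.

(** Closed sets replace paths here because eigenvector arguments produce and consume them directly;
    [reachingP] gives the path form. *)
Definition reaching n (G : 'M[bool]_n) (S : {set 'I_n}) :=
  forall W : {set 'I_n}, S \subset W ->
  (forall i j, i \in W -> G j i -> j \in W) -> W = [set: 'I_n]%SET.

(** Natural weights are read in the reals and in the complex numbers alike, so a test passed over
    [R[i]] concerns a real matrix. *)
Definition natmx (F : pzRingType) n (N : 'M[nat]_n) : 'M[F]_n := map_mx (fun k => k%:R) N.

Lemma porbit_step (T : finType) (s : {perm T}) x : porbit s (s x) = porbit s x.
Proof. by have := porbit_perm s 1 x; rewrite expg1. Qed.

(** The new cycle gets the weight [d], and one edge from [W] enters it at [j] unless [j] lies in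
    [S]. An eigenvector with [v 0 j = 0] vanishes on the cycle, and the old system excludes the rest
    of it. Otherwise the cycle forces [|z| = d], while the equation on [W], with the entering edge
    as inhomogeneity, makes [z] a root of a polynomial independent of [d]. *)
Lemma pbh_add_cycle (F : numClosedFieldType) n (G : 'M[bool]_n) (S W : {set 'I_n})
    (sigma : {perm 'I_n}) (N : 'M[nat]_n) (j : 'I_n) :
  (forall x, x \notin S -> G x (sigma x)) ->
  (forall x, (sigma x \in W) = (x \in W)) ->
  (forall x y, N x y != 0%N -> [/\ G x y, x \in W & y \in W]) ->
  pbh (natmx F N) (S :|: ~: W) ->
  j \notin W -> (j \in S \/ exists2 i, i \in W & G j i) ->
  exists N' : 'M[nat]_n,
    let W' := W :|: porbit sigma j in
    (forall x y, N' x y != 0%N -> [/\ G x y, x \in W' & y \in W']) /\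
    pbh (natmx F N') (S :|: ~: W').
Proof.
move=> Gsigma sigmaW suppN pbhN jW jlink.
set C := porbit sigma j.
have sigmaC x : (sigma x \in C) = (x \in C).
  by rewrite -!eq_porbit_mem porbit_step.
have jC : j \in C by exact: porbit_id.
have CW x : x \in C -> x \notin W.
  case/porbitP => k ->; elim: k => [|k IH]; first by rewrite expg0 perm1.
  by rewrite expgSr permM sigmaW.
have N0 x y : x \notin W -> N x y = 0%N.
  by move=> xW; apply/eqP; apply: contraNT xW => /suppN [].
have N0' x y : y \notin W -> N x y = 0%N.
  by move=> xW; apply/eqP; apply: contraNT xW => /suppN [].
pose Z := S :|: ~: W.
have [l [lW lG lS]] : exists l : pred 'I_n,
    [/\ forall y, l y -> y \in W, forall y, l y -> G j y &
     j \in S \/ exists y, l y].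
  case: jlink => [jS|[i iW Gji]]; first by exists pred0; split => //; left.
  exists (pred1 i); split; try by move=> y /eqP ->.
  by right; exists i => /=.
pose f : 'rV[F]_n := \row_y (l y)%:R.
have [p p0 rootp] : exists2 p : {poly F}, p != 0 & f != 0 ->
    forall z (u : 'rV_n), (forall s, s \in Z -> u 0 s = 0) ->
    u *m natmx F N = z *: u - f -> root p z.
  have [f0|f0] := eqVneq f 0; first by exists 1; rewrite ?oner_eq0.
  by have [p p0 Hp] := resolvent_roots f0 pbhN; exists p.
have [rs def_p] := closed_field_poly_normal p.
have [d d0 drs] := natr_avoid [seq `|r| | r <- rs].
pose N' : 'M[nat]_n := \matrix_(x, y)
  (N x y + (x \in C) * (x \notin S) * (y == sigma x) * d + (x == j) * l y)%N.
exists N'; split.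
  move=> x y; rewrite mxE !inE.
  have [->|/suppN [-> -> ->]//] := altP (N x y =P 0%N).
  have [/andP [xC /andP [xS /eqP ->]]|] := boolP [&& x \in C, x \notin S & y == sigma x].
    by rewrite Gsigma // sigmaC xC !orbT.
  rewrite !negb_and => E.
  have -> : ((x \in C) * (x \notin S) * (y == sigma x))%N = 0%N.
    by move: E; case: (x \in C); case: (x \notin S); case: (y == _).
  rewrite mul0n !add0n mulnb eqb0 negbK => /andP [/eqP -> ly].
  by split; [exact: lG|rewrite jC orbT|rewrite lW].
move=> z v vZ vE.
have vS x : x \in S -> v 0 x = 0 by move=> xS; apply: vZ; rewrite inE xS.
have vW' x : x \notin W -> x \notin C -> v 0 x = 0.
  by move=> xW xC; apply: vZ; rewrite !inE negb_or xW xC orbT.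
have colE y : z * v 0 y = (v *m natmx F N) 0 y +
    \sum_(x in C) v 0 x * ((x \notin S) * (y == sigma x) * d)%:R + v 0 j * (l y)%:R.
  rewrite -mxZE -vE !mxE [X in _ = _ + X + _]big_mkcond /=.
  rewrite [v 0 j * _](_ : _ = \sum_x v 0 x * ((x == j) * l y)%:R); last first.
    by rewrite (bigD1 j) //= eqxx mul1n big1 ?addr0 // => x /negbTE ->; rewrite mulr0.
  rewrite -!big_split /=; apply: eq_bigr => x _; rewrite !mxE !natrD !mulrDr.
  by case: (x \in C); rewrite ?mul1n ?mul0n ?mulr0.
(* Rows of [S] carry no cycle weight, but [v] vanishes there, so the relation holds around the whole
   cycle. *)
have cycE x : x \in C -> z * v 0 (sigma x) = v 0 x * d%:R.
  move=> xC; have yW : sigma x \notin W by rewrite CW // sigmaC.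
  rewrite colE (_ : l (sigma x) = false) ?mulr0 ?addr0; last first.
    by apply: contraNF yW; exact: lW.
  rewrite mxE big1 ?add0r => [|t _]; last by rewrite mxE N0' ?mulr0.
  rewrite (bigD1 x) //= big1 ?addr0 => [|t /andP [_ tx]]; last first.
    by rewrite (inj_eq perm_inj) eq_sym (negbTE tx) muln0 mul0n mulr0.
  rewrite eqxx muln1; have [xS|_] := boolP (x \in S); last by rewrite mul1n.
  by rewrite vS // !mul0r.
pose u : 'rV[F]_n := \row_y (if y \in W then v 0 y else 0).
have uN : u *m natmx F N = v *m natmx F N.
  apply/rowP => y; rewrite !mxE; apply: eq_bigr => x _; rewrite !mxE.
  by case: ifPn => // xW; rewrite N0 // mul0r mulr0.
have uE : u *m natmx F N = z *: u - v 0 j *: f.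
  apply/rowP => y; rewrite mxBE !mxZE [u 0 y]mxE [f 0 y]mxE.
  have [yW|yW] := boolP (y \in W); last first.
    rewrite mulr0 sub0r (_ : l y = false) ?mulr0 ?oppr0; last first.
      by apply: contraNF yW; exact: lW.
    by rewrite mxE big1 // => x _; rewrite !mxE N0' ?mulr0.
  rewrite colE uN big1 ?addr0 ?addrK // => x xC.
  rewrite (_ : (y == sigma x) = false) ?muln0 ?mulr0 //.
  by apply: contraTF yW => /eqP ->; rewrite CW // sigmaC.
have uZ s : s \in Z -> u 0 s = 0.
  by rewrite !inE mxE => /orP [/vS ->|/negbTE ->]; rewrite ?if_same.
have dF0 : d%:R != 0 :> F by rewrite pnatr_eq0 -lt0n.
have [vj0|vj0] := eqVneq (v 0 j) 0.
  rewrite vj0 scale0r subr0 in uE.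
  have u0 := pbhN _ _ uZ uE.
  apply/rowP => x; rewrite mxE; have [xW|xW] := boolP (x \in W).
    by have := congr1 (fun M : 'rV_n => M 0 x) u0; rewrite !mxE xW.
  have [xC|xC] := boolP (x \in C); last exact: vW'.
  have : j \in porbit sigma x by rewrite porbit_sym.
  case/porbitP => k jE; move: vj0; rewrite {}jE.
  elim: k x xC {xW} => [|k IH] x xC; first by rewrite expg0 perm1.
  rewrite expgS permM => /IH; rewrite sigmaC => /(_ xC) H.
  have := cycE x xC; rewrite H mulr0 => /esym /eqP; rewrite mulf_eq0 (negbTE dF0) orbF.
  by move/eqP.
have f0 : f != 0.
  have [jS|[y ly]] := lS; first by rewrite vS ?eqxx in vj0.
  apply/eqP => /(congr1 (fun M : 'rV_n => M 0 y)); rewrite !mxE ly => /eqP.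
  by rewrite oner_eq0.
have rz : root p z.
  apply: (rootp f0 z ((v 0 j)^-1 *: u)).
    by move=> s sZ; rewrite mxZE uZ ?mulr0.
  by rewrite -scalemxAl uE scalerBr !scalerA mulVf // scale1r mulrC.
have zd : `|z| = d%:R.
  (* Summing moduli over the cycle absorbs the permutation: [|z| T = d T] with [T > 0]. *)
  pose T := \sum_(x in C) `|v 0 x|.
  have T0 : T != 0.
    rewrite gt_eqF // /T (bigD1 j) //= ltr_wpDr ?normr_gt0 // sumr_ge0 // => x _; exact: normr_ge0.
  apply: (mulIf T0); rewrite {1}/T (reindex_inj (@perm_inj _ sigma)) /= !mulr_sumr.
  rewrite (eq_bigl (mem C)) => [|x]; last exact: sigmaC.
  apply: eq_bigr => x xC; rewrite -normrM cycE // normrM mulrC normr_nat //.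
case/negP: drs; rewrite -zd; apply/map_f.
by move: rz; rewrite def_p rootZ ?lead_coef_eq0 // root_prod_XsubC.
Qed.

(** [W] is a union of cycles of [sigma], and the states outside it count as inputs; for empty [W]
    zero weights suffice. While [W] is proper, reachability yields a state outside it that is in [S]
    or fed from [W], and its cycle is added. *)
Theorem generic_pbh (F : numClosedFieldType) n (G : 'M[bool]_n) (S : {set 'I_n})
    (sigma : {perm 'I_n}) :
  (forall x, x \notin S -> G x (sigma x)) -> reaching G S ->
  exists N : 'M[nat]_n, (forall x y, N x y != 0%N -> G x y) /\ pbh (natmx F N) S.
Proof.
move=> Gsigma reach.
suff H k : forall W : {set 'I_n}, (#|~: W| <= k)%N ->
    (forall x, (sigma x \in W) = (x \in W)) ->
    (exists N : 'M[nat]_n, (forall x y, N x y != 0%N -> [/\ G x y, x \in W & y \in W]) /\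
      pbh (natmx F N) (S :|: ~: W)) ->
    exists N : 'M[nat]_n, (forall x y, N x y != 0%N -> G x y) /\ pbh (natmx F N) S.
  apply: (H _ set0 (leqnn _)); first by move=> x; rewrite !inE.
  exists (const_mx 0%N); split => [x y|z v v0 _]; first by rewrite mxE.
  by apply/rowP => x; rewrite mxE v0 // !inE orbT.
elim: k => [|k IH] W cardW sigmaW [N [suppN pbhN]].
  have WT : W = [set: 'I_n]%SET.
    by apply/eqP; rewrite -[W]setCK -setC0 (inj_eq (can_inj (@setCK _))) -cards_eq0 -leqn0.
  exists N; split => [x y /suppN []//|]; move: pbhN; rewrite WT setCT setU0; exact.
have [WT|WT] := eqVneq W [set: 'I_n]%SET.
  exists N; split => [x y /suppN []//|]; move: pbhN; rewrite WT setCT setU0; exact.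
have [j jW jlink] : exists2 j, j \notin W & (j \in S \/ exists2 i, i \in W & G j i).
  apply: contrapT => nex; case/eqP: WT; apply: reach.
    apply/subsetP => j jS; apply: contraT => jW; case: nex; exists j => //; by left.
  move=> i j iW Gji; apply: contraT => jW; case: nex; exists j => //; right; by exists i.
have [N' [suppN' pbhN']] := pbh_add_cycle Gsigma sigmaW suppN pbhN jW jlink.
apply: (IH (W :|: porbit sigma j)); last by exists N'.
  rewrite -ltnS; apply: leq_trans cardW; apply: proper_card.
  rewrite properE setCS subsetUl /=; apply/subsetPn; exists j; rewrite !inE ?jW //.
  by rewrite porbit_id orbT.
by move=> x; rewrite !inE sigmaW -!eq_porbit_mem porbit_step.
Qed.

End GenericControllability.

(** * Kalman's criterion, the Hautus test and the Gram determinant *)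

Section Kalman.
Local Open Scope ring_scope.

(** All powers are allowed, which makes the annihilated vectors visibly an invariant subspace;
    [krylov_lt] reduces to powers below [n]. *)
Definition kalman (F : fieldType) n p (A : 'M[F]_n) (B : 'M[F]_(n, p)) :=
  forall v : 'rV[F]_n, (forall k, v *m A ^+ k *m B = 0) -> v = 0.

Lemma krylov_lt (F : comNzRingType) n p (A : 'M[F]_n) (B : 'M[F]_(n, p)) (v : 'rV[F]_n) :
  (forall k, (k < n)%N -> v *m A ^+ k *m B = 0) -> forall k, v *m A ^+ k *m B = 0.
Proof.
move=> vlt k; elim/ltn_ind: k => k IH; have [/vlt//|nk] := ltnP k n.
have := congr1 (fun M => v *m (A ^+ (k - n) *m M) *m B) (char_poly_mx_sum A).
rewrite !mulmx0 mul0mx big_ord_recr /= char_poly_coefn scale1r mulmxDr -[_ *m A ^+ n]exprD.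
rewrite subnK // mulmxDr mulmxDl mulmx_sumr mulmx_sumr mulmx_suml.
rewrite big1 ?add0r // => i _.
rewrite -scalemxAr -[_ *m A ^+ i]exprD -scalemxAr -scalemxAl IH ?scaler0 //.
by have := ltn_ord i; lia.
Qed.

(* Over the reals this matrix is invertible exactly for controllable pairs; unlike
   the rank of the Kalman matrix, its determinant is a polynomial in the entries. *)
Definition gram (F : comNzRingType) n p (A : 'M[F]_n) (B : 'M[F]_(n, p)) : 'M[F]_n :=
  \sum_(k < n) (A ^+ k *m B) *m (A ^+ k *m B)^T.

Lemma map_mx_expr (F F' : comNzRingType) (f : {rmorphism F -> F'}) n (A : 'M[F]_n) k :
  map_mx f (A ^+ k) = map_mx f A ^+ k.
Proof.
by elim: k => [|k IH]; rewrite ?expr0 ?map_mx1 // !exprS -IH map_mxM.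
Qed.

Lemma map_gram (F F' : comNzRingType) (f : {rmorphism F -> F'}) n p (A : 'M[F]_n)
    (B : 'M[F]_(n, p)) :
  map_mx f (gram A B) = gram (map_mx f A) (map_mx f B).
Proof.
rewrite /gram raddf_sum; apply: eq_bigr => k _ /=.
by rewrite map_mxM -map_trmx map_mxM map_mx_expr.
Qed.

(** If [v] is in the kernel, [v G v^T = 0] is a vanishing sum of squares; this is where an ordered
    field is used. *)
Lemma kalman_gram (F : realFieldType) n p (A : 'M[F]_n) (B : 'M[F]_(n, p)) :
  kalman A B -> \det (gram A B) != 0.
Proof.
move=> kal; apply/negP => /det0P [v v0 vG]; case/eqP: v0; apply: kal.
apply: krylov_lt => k kn.
pose w (i : 'I_n) := v *m (A ^+ i *m B).
have sum0 : \sum_(i < n) (w i *m (w i)^T) 0 0 = 0.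
  transitivity ((v *m gram A B *m v^T) 0 0).
    rewrite /gram mulmx_sumr mulmx_suml summxE; apply: eq_bigr => i _.
    by rewrite /w trmx_mul !mulmxA.
  by rewrite vG mul0mx mxE.
have wge0 (i : 'I_n) : 0 <= (w i *m (w i)^T) 0 0.
  by rewrite mxE sumr_ge0 // => l _; rewrite [_^T _ _]mxE -expr2 sqr_ge0.
have /eqP := sum0; rewrite psumr_eq0 // => /allP /(_ (Ordinal kn) (mem_index_enum _)) /=.
rewrite mxE psumr_eq0 => [/allP H|l _]; last by rewrite [_^T _ _]mxE -expr2 sqr_ge0.
apply/rowP => l; have := H l (mem_index_enum _).
by rewrite /= [_^T _ _]mxE -expr2 sqrf_eq0 /w mulmxA [in RHS]mxE => /eqP.
Qed.

(** Invertibility of the Gram matrix survives a field morphism, so the conclusion holds over the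
    complex numbers, where a sum of squares may vanish. *)
Lemma gram_kalman (F F' : fieldType) (f : {rmorphism F -> F'}) n p (A : 'M[F]_n)
    (B : 'M[F]_(n, p)) :
  \det (gram A B) != 0 -> kalman (map_mx f A) (map_mx f B).
Proof.
move=> G0 v vAB; have : v *m map_mx f (gram A B) = 0.
  rewrite map_gram /gram mulmx_sumr big1 // => k _.
  by rewrite !mulmxA vAB mul0mx.
move=> /eqP; rewrite mulmx_free_eq0 ?mxrank_map; first by move/eqP.
by rewrite row_free_unit map_unitmx unitmxE unitfE.
Qed.

Definition toC (R : rcfType) m n (M : 'M[R]_(m, n)) : 'M[R[i]]_(m, n) :=
  map_mx (real_complex R) M.

Lemma kalman_pbh (F : fieldType) n p (A : 'M[F]_n) (B : 'M[F]_(n, p)) :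
  kalman A B -> forall z (v : 'rV[F]_n), v *m B = 0 -> v *m A = z *: v -> v = 0.
Proof.
move=> kal z v vB vA; apply: kal => k.
suff -> : v *m A ^+ k = z ^+ k *: v by rewrite -scalemxAl vB scaler0.
elim: k => [|k IH]; first by rewrite !expr0 mulmx1 scale1r.
by rewrite exprS mulmxA vA -scalemxAl IH scalerA exprS.
Qed.

(** The complex row vectors that annihilate all [A^k B] form an invariant subspace; if nonzero, it
    would contain an eigenvector, against the Hautus test. *)
Lemma pbh_kalman (R : rcfType) n p (A : 'M[R]_n) (B : 'M[R]_(n, p)) :
  (forall z (v : 'rV[R[i]]_n), v *m toC B = 0 -> v *m toC A = z *: v -> v = 0) ->
  kalman A B.
Proof.
move=> pbhAB v vAB; apply/eqP; apply: contraT => v0.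
pose P (w : 'rV[R[i]]_n) := forall k, w *m toC A ^+ k *m toC B = 0.
have [w z Pw k|k||w [z [Pw w0 wA]]] := @eigenvector_in _ _ (toC A) P (toC v).
- by rewrite !mulmxBl -!scalemxAl -(mulmxA w) -[toC A *m _]exprS !Pw scaler0 subr0.
- by rewrite /toC -map_mx_expr -!map_mxM vAB map_mx0.
- by rewrite /toC map_mx_eq0.
- case/eqP: w0; apply: pbhAB wA.
  by have := Pw 0; rewrite expr0 mulmx1.
Qed.

Lemma poly_nonroot (F : numDomainType) (p : {poly F}) : p != 0 -> exists t, p.[t] != 0.
Proof.
move=> p0; pose s := [seq i%:R | i <- iota 0 (size p)] : seq F.
have us : uniq s by rewrite map_inj_uniq ?iota_uniq // => i j /eqP; rewrite eqr_nat => /eqP.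
have : ~~ all (root p) s.
  by apply/negP => /(max_poly_roots p0) /(_ us); rewrite size_map size_iota ltnn.
by case/allPn => t _ tp; exists t.
Qed.

(** All entries allowed by [G] are shifted by a common [t]. The Gram determinant and the product of
    the shifted entries are nonzero polynomials in [t], and some value avoids the roots of both. *)
Lemma exact_pattern (R : realType) n p (A : 'M[R]_n) (B : 'M[R]_(n, p)) (G : 'M[bool]_n) :
  (forall i j, A i j != 0 -> G i j) -> \det (gram A B) != 0 ->
  exists A' : 'M[R]_n, same_pattern A' G /\ \det (gram A' B) != 0.
Proof.
move=> AG detAB.
pose At : 'M[{poly R}]_n := map_mx polyC A + 'X *: map_mx (fun b : bool => b%:R) G.
have AtE t : map_mx (horner_eval t) At = A + t *: map_mx (fun b : bool => b%:R) G.
  by apply/matrixP => i j; rewrite !mxE /horner_eval !hornerE; case: (G i j); rewrite !hornerE.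
have BtE t : map_mx (horner_eval t) (map_mx polyC B) = B.
  by apply/matrixP => i j; rewrite !mxE /horner_eval hornerC.
pose d := \det (gram At (map_mx polyC B)).
have dE t : d.[t] = \det (gram (map_mx (horner_eval t) At) B).
  by rewrite -[in RHS](BtE t) -map_gram det_map_mx.
pose q : {poly R} := \prod_(ij : 'I_n * 'I_n) (if G ij.1 ij.2 then (A ij.1 ij.2)%:P + 'X else 1).
have : d * q != 0.
  rewrite mulf_neq0 //.
    apply: contraNneq detAB => d0; have := dE 0.
    by rewrite d0 horner0 AtE scale0r addr0 => <-.
  apply/prodf_neq0 => -[i j] _ /=; case: ifP => _; last exact: oner_neq0.
  by rewrite addrC -size_poly_eq0 size_XaddC.
case/poly_nonroot => t; rewrite hornerM mulf_eq0 negb_or dE => /andP [dt qt].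
exists (map_mx (horner_eval t) At); split => // i j.
rewrite AtE mxDE mxZE mxE; have [Gij|Gij] := boolP (G i j).
  rewrite mulr1; apply: contraNneq qt => At0.
  by rewrite horner_prod (bigD1 (i, j)) //= Gij !hornerE At0 mul0r.
by rewrite mulr0 addr0; apply/negbTE; apply: contraNN Gij; exact: AG.
Qed.

Definition diag_set (F : pzRingType) n (S : {set 'I_n}) : 'M[F]_n :=
  \matrix_(i, j) ((i == j) && (i \in S))%:R.

Lemma mul_diag_set (F : fieldType) n (S : {set 'I_n}) (v : 'rV[F]_n) :
  v *m diag_set F S = \row_j (v 0 j * (j \in S)%:R).
Proof.
apply/rowP => j; rewrite !mxE (bigD1 j) //= big1 => [|i ij]; first by rewrite mxE eqxx addr0.
by rewrite mxE (negbTE ij) mulr0.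
Qed.

End Kalman.

(** * Steering along polynomial trajectories *)

Section PolynomialTrajectories.
Local Open Scope ring_scope.
Variable R : realType.

Lemma derivn_multiple_root (a : R) m j (g : {poly R}) : (j <= m)%N ->
  ((('X - a%:P) ^+ m * g)^`(j)).[a] = (j == m)%:R * m`!%:R * g.[a].
Proof.
elim: m j g => [|m IH] [|j] g //.
- by move=> _; rewrite expr0 mul1r derivn0 fact0 !mul1r.
- by move=> _; rewrite derivn0 hornerM exprS hornerM hornerXsubC subrr !mul0r.
rewrite ltnS => jm; rewrite derivSn.
have -> : (('X - a%:P) ^+ m.+1 * g)^`() =
    ('X - a%:P) ^+ m * (m.+1%:R * g + ('X - a%:P) * g^`()).
  by rewrite derivM deriv_exp derivXsubC mul1r exprS /= -mulr_natl; ring.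
rewrite IH // !hornerE subrr mul0r addr0 eqSS factS natrM.
by rewrite -polyC_natr hornerC; ring.
Qed.

(** The truncated Horner polynomial [c_k + c_(k+1) D + ... + c_n D^(n-k)] in the derivative [D],
    applied to [z]; write [M_k z] for it. For the characteristic polynomial of [A] these are the
    coefficients of the adjugate of [D - A] in powers of [A], so the state [sum_k A^k B M_(k+1) z]
    belongs to the input [M_0 z]. *)
Definition opM (c : nat -> R) n k (z : {poly R}) := \sum_(i < n.+1 - k) c (k + i)%N *: z^`(i).

Lemma opM_rec c n k z : (k <= n)%N -> opM c n k z = c k *: z + (opM c n k.+1 z)^`().
Proof.
move=> kn; rewrite /opM subSn // big_ord_recl addn0 derivn0; congr (_ + _).
rewrite raddf_sum subSS; apply: eq_bigr => i _.
by rewrite /= derivZ -derivnS /bump /= addnA addn1.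
Qed.

Lemma opMn c n z : c n = 1 -> opM c n n z = z.
Proof. by move=> cn; rewrite /opM subSnn big_ord1 addn0 cn scale1r derivn0. Qed.

Lemma opMD c n k z y : opM c n k (z + y) = opM c n k z + opM c n k y.
Proof.
by rewrite /opM -big_split; apply: eq_bigr => i _; rewrite derivnD scalerDr.
Qed.

(** [M_(k+1)] has order [n - k - 1] and leading coefficient 1, so the conditions are triangular.
    They are met for decreasing [k]: the correction [y] vanishes to order [m] at both ends and
    leaves the conditions of lower order intact. *)
Lemma opM_interpolation c n (a b : nat -> R) : c n = 1 ->
  exists z, forall k, (k < n)%N -> (opM c n k.+1 z).[0] = a k /\ (opM c n k.+1 z).[1] = b k.
Proof.
move=> cn; suff H m : (m <= n)%N -> exists z, forall k, (n - m <= k < n)%N ->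
    (opM c n k.+1 z).[0] = a k /\ (opM c n k.+1 z).[1] = b k.
  have [z Hz] := H n (leqnn n); exists z => k kn; apply: Hz; by rewrite subnn.
elim: m => [|m IH] mn; first by exists 0 => k; rewrite subn0; lia.
have [z Hz] := IH (ltnW mn); pose k0 := (n - m.+1)%N.
pose m1 : R := m`!%:R; have m1_neq0 : m1 != 0 by rewrite pnatr_eq0 -lt0n fact_gt0.
(* The [m]-th derivative of [y] below is [m! (-1)^m al] at 0 and [m! (al + be)] at 1, which
   determines [al] and [be]. *)
pose al := (-1) ^+ m * (a k0 - (opM c n k0.+1 z).[0]) / m1.
pose be := (b k0 - (opM c n k0.+1 z).[1]) / m1 - al.
pose y : {poly R} := ('X - 0%:P) ^+ m * (('X - 1%:P) ^+ m * (al%:P + be *: 'X)).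
have y0 i : (i <= m)%N -> (y^`(i)).[0] = (i == m)%:R * (a k0 - (opM c n k0.+1 z).[0]).
  move=> im; rewrite derivn_multiple_root // -/m1 -mulrA; congr (_ * _).
  rewrite !hornerE ?sub0r ?mulr0 ?addr0 /al; set x := _ - _.
  rewrite -[LHS]/(m1 * (-1) ^+ m * (-1) ^+ m * x / m1) -(mulrA m1) -expr2 sqrr_sign.
  by rewrite mulr1 mulrAC divff // mul1r.
have y1 i : (i <= m)%N -> (y^`(i)).[1] = (i == m)%:R * (b k0 - (opM c n k0.+1 z).[1]).
  move=> im; rewrite /y mulrCA derivn_multiple_root // -/m1 -mulrA; congr (_ * _).
  rewrite hornerM horner_exp hornerXsubC subr0 expr1n mul1r hornerD hornerC hornerZ hornerX mulr1.
  by rewrite /be addrC subrK mulrC divfK.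
have opy t k w : (n - m.+1 <= k < n)%N -> (forall i, (i <= m)%N -> (y^`(i)).[t] = (i == m)%:R * w) ->
    (opM c n k.+1 y).[t] = (k == k0)%:R * w.
  move=> kn yt; rewrite /opM horner_sum subSS.
  have -> : (n - k)%N = (n - k).-1.+1 by lia.
  rewrite big_ord_recr /= big1 ?add0r => [|i _].
    rewrite hornerZ yt; last by lia.
    have -> : (k.+1 + (n - k).-1)%N = n by lia.
    by rewrite cn mul1r; congr (_%:R * _); congr nat_of_bool; rewrite /k0; lia.
  have ltin := ltn_ord i; rewrite hornerZ yt; last by lia.
  by rewrite (_ : (_ == m) = false) ?mul0r ?mulr0 //; apply/negbTE; lia.
exists (z + y) => k kn; rewrite !opMD !hornerD (opy _ _ _ _ y0) // (opy _ _ _ _ y1) //.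
have [->|kk0] := eqVneq k k0; first by rewrite !mul1r !subrKC.
by rewrite !mul0r !addr0; apply: Hz; move: kk0; rewrite /k0; lia.
Qed.

Lemma map_deriv_mulC m n p (C : 'M[R]_(m, n)) (y : 'M[{poly R}]_(n, p)) :
  map_mx (@deriv R) (map_mx polyC C *m y) = map_mx polyC C *m map_mx (@deriv R) y.
Proof.
apply/matrixP => i j; rewrite !mxE raddf_sum; apply: eq_bigr => k _ /=.
by rewrite !mxE mul_polyC derivZ mul_polyC.
Qed.

Lemma map_horner_polyC m n (C : 'M[R]_(m, n)) t :
  map_mx (horner_eval t) (map_mx polyC C) = C.
Proof. by apply/matrixP => i j; rewrite !mxE /horner_eval hornerC. Qed.

Lemma kalman_controllable n p (A : 'M[R]_n) (B : 'M[R]_(n, p)) :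
  kalman A B -> controllable A B.
Proof.
move=> kal x0 x1; pose c k := (char_poly A)`_k.
have cn : c n = 1 by exact: char_poly_coefn.
have Gu : gram A B \in unitmx by rewrite unitmxE unitfE kalman_gram.
(* Inverting the Gram matrix writes every state as a combination of the columns of the [A^k B], with
   these coefficients; they become the interpolation data at times 0 and 1. *)
pose om (x : 'cV[R]_n) k := (A ^+ k *m B)^T *m invmx (gram A B) *m x.
have omE x : \sum_(k < n) A ^+ k *m B *m om x k = x.
  rewrite -[RHS]mul1mx -(mulmxV Gu) /gram !mulmx_suml; apply: eq_bigr => k _.
  by rewrite /om !mulmxA.
have /choice [z zE] : forall l : 'I_p, exists z, forall k, (k < n)%N ->
    (opM c n k.+1 z).[0] = om x0 k l 0 /\ (opM c n k.+1 z).[1] = om x1 k l 0.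
  by move=> l; exact: (opM_interpolation (fun k => om x0 k l 0) (fun k => om x1 k l 0) cn).
pose M k : 'cV[{poly R}]_p := \col_l opM c n k (z l).
pose AB k := map_mx polyC (A ^+ k *m B).
pose X := \sum_(k < n) AB k *m M k.+1.
have AAB k : map_mx polyC A *m AB k = AB k.+1 by rewrite /AB -map_mxM mulmxA -[A *m _]exprS.
(* The derivative of [M k.+1] is [M k - c_k M n]. The terms [M k] make up the right-hand side up to
   [A^n B M n], which Cayley-Hamilton supplies from the others. *)
have X' : map_mx (@deriv R) X = map_mx polyC A *m X + map_mx polyC B *m M 0.
  have -> : map_mx (@deriv R) X = \sum_(k < n) (AB k *m M k - (c k)%:P *: (AB k *m M n)).
    rewrite /X raddf_sum; apply: eq_bigr => k _ /=.
    rewrite map_deriv_mulC scalemxAr -mulmxBr; congr (_ *m _); apply/colP => l.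
    rewrite mxE [in LHS]mxE mxBE mxZE !mxE opMn // mul_polyC (opM_rec _ _ (ltnW (ltn_ord k))).
    by rewrite addrC addKr.
  rewrite sumrB.
  have -> : \sum_(k < n) (c k)%:P *: (AB k *m M n) = - (AB n *m M n).
    apply/eqP; rewrite -addr_eq0; apply/eqP.
    transitivity (map_mx polyC (\sum_(k < n.+1) (char_poly A)`_k *: A ^+ k *m B) *m M n).
      rewrite big_ord_recr /= char_poly_coefn scale1r map_mxD mulmxDl raddf_sum mulmx_suml.
      congr (_ + _); apply: eq_bigr => k _ /=.
      by rewrite -scalemxAl map_mxZ -scalemxAl.
    by rewrite -mulmx_suml char_poly_mx_sum mul0mx map_mx0 mul0mx.
  rewrite opprK /X mulmx_sumr.
  transitivity (\sum_(k < n.+1) AB k *m M k); first by rewrite big_ord_recr.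
  rewrite big_ord_recl addrC; congr (_ + _); last by rewrite /AB expr0 mul1mx.
  by apply: eq_bigr => k _; rewrite mulmxA AAB.
have XE x t : (forall k l, (k < n)%N -> (opM c n k.+1 (z l)).[t] = om x k l 0) ->
    map_mx (horner_eval t) X = x.
  move=> H; rewrite -[RHS]omE /X raddf_sum; apply: eq_bigr => k _ /=.
  rewrite map_mxM map_horner_polyC; congr (_ *m _); apply/matrixP => i j.
  by rewrite ord1 -H // !mxE.
exists 1, (fun t => map_mx (horner_eval t) (M 0)), (fun t => map_mx (horner_eval t) X); split.
- exact: ltr01.
- move=> j; have -> : (fun t => map_mx (horner_eval t) (M 0) j 0) = horner (M 0 j 0).
    by apply/funext => t; rewrite mxE.
  exact: continuous_horner.
- move=> t i; have -> : (fun s => map_mx (horner_eval s) X i 0) = horner (X i 0).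
    by apply/funext => s; rewrite mxE.
  suff -> : (A *m map_mx (horner_eval t) X + B *m map_mx (horner_eval t) (M 0)) i 0 =
      ((X i 0)^`()).[t] by exact: is_derive_poly.
  have := congr1 (fun Y => map_mx (horner_eval t) Y i 0) X'.
  rewrite map_mxD !map_mxM !map_horner_polyC => <-.
  by rewrite [LHS]mxE [in LHS]mxE.
- by apply: XE => k l kn; have [] := zE l k kn.
- by apply: XE => k l kn; have [] := zE l k kn.
Qed.

End PolynomialTrajectories.

(** * Structural controllability as a graph condition *)

Section GraphConditions.
Local Open Scope ring_scope.

Definition matchable n (G : 'M[bool]_n) (S : {set 'I_n}) :=
  exists2 f : 'I_n -> 'I_n, {in ~: S &, injective f} & forall x, x \notin S -> G x (f x).

Lemma perm_extension (T : finType) (D : {set T}) (f : T -> T) :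
  {in D &, injective f} -> exists s : {perm T}, {in D, s =1 f}.
Proof.
move=> injf; pose E := enum (~: (f @: D)).
have szE : size (enum (~: D)) = size E.
  by rewrite -!cardE [LHS]cardsCs [RHS]cardsCs !setCK card_in_imset.
pose h x := if x \in D then f x else nth x E (index x (enum (~: D))).
have idx x : x \notin D -> (index x (enum (~: D)) < size E)%N.
  by move=> xD; rewrite -szE index_mem mem_enum inE.
have hE x : x \notin D -> h x \notin f @: D.
  move=> xD; rewrite /h (negbTE xD).
  by have := mem_nth x (idx x xD); rewrite mem_enum inE.
have injh : injective h.
  move=> x y; have [xD|xD] := boolP (x \in D); have [yD|yD] := boolP (y \in D).
  - by rewrite /h xD yD; exact: injf.
  - by move=> hxy; have := hE y yD; rewrite -hxy /h xD imset_f.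
  - by move=> hxy; have := hE x xD; rewrite hxy /h yD imset_f.
  rewrite /h (negbTE xD) (negbTE yD) (set_nth_default y) ?idx // => /eqP.
  rewrite nth_uniq ?idx ?enum_uniq // => /eqP H.
  by rewrite -(nth_index x (s := enum (~: D)) (x := x)) ?mem_enum ?inE // H nth_index // mem_enum inE.
by exists (perm injh) => x xD; rewrite permE /h xD.
Qed.

Lemma unitmx_perm (F : fieldType) n (A : 'M[F]_n) :
  A \in unitmx -> exists s : {perm 'I_n}, forall i, A i (s i) != 0.
Proof.
rewrite unitmxE unitfE => detA; apply: contrapT => nex; case/eqP: detA.
rewrite /determinant big1 // => s _; apply/eqP; rewrite mulf_eq0; apply/orP; right.
apply: contraT => /prodf_neq0 H; case: nex; exists s => i; exact: H.
Qed.

Lemma matchableS n (G : 'M[bool]_n) (S S' : {set 'I_n}) :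
  S \subset S' -> matchable G S -> matchable G S'.
Proof.
move=> /subsetP SS' [f injf Gf]; exists f => [x y|x xS'].
  rewrite !inE => xS yS; apply: injf; rewrite !inE.
    by apply: contraNN xS; exact: SS'.
  by apply: contraNN yS; exact: SS'.
by apply: Gf; apply: contraNN xS'; exact: SS'.
Qed.

(** An invertible maximal minor of [[A B]] has a nonzero term in its Leibniz expansion, which
    matches every row with a column; [S] collects the rows matched into [B]. The last clause counts
    columns of [B], which bounds feedback entries once [B] is replaced by its product with the
    feedback. *)
Lemma full_rank_matching (F : fieldType) n p (A : 'M[F]_n) (B : 'M[F]_(n, p))
    (G : 'M[bool]_n) :
  (forall i j, A i j != 0 -> G i j) ->
  (forall v : 'rV[F]_n, v *m A = 0 -> v *m B = 0 -> v = 0) ->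
  exists S : {set 'I_n}, [/\ matchable G S, forall i, i \in S -> exists j, B i j != 0 &
    forall D : {set 'I_p}, (forall i j, B i j != 0 -> j \in D) -> (#|S| <= #|D|)%N].
Proof.
move=> AG ker0; pose M := row_mx A B.
have fM : row_full M^T.
  rewrite /row_full mxrank_tr -/(row_free M); apply/inj_row_free => v.
  by rewrite mul_mx_row -row_mx0 => /eq_row_mx [vA vB]; exact: ker0.
have [s sM] := unitmx_perm (fullrowsub_unit fM).
pose f := fullrankfun fM; pose g x := f ((s^-1)%g x).
have injg : injective g.
  by move=> x y /fullrankfun_inj; exact: perm_inj.
have gM x : M x (g x) != 0 by have := sM ((s^-1)%g x); rewrite !mxE permKV.
pose S := [set x | n <= g x]%N.
have gS x : x \in S -> exists2 j, g x = rshift n j & B x j != 0.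
  rewrite inE => nx; have := gM x; rewrite mxE; case: splitP => [j jE|j jE Bx].
    by have := ltn_ord j; rewrite -jE ltnNge nx.
  by exists j => //; exact: val_inj.
have gNS x : x \notin S -> exists2 j, g x = lshift p j & A x j != 0.
  rewrite inE -ltnNge => nx; have := gM x; rewrite mxE; case: splitP => [j jE Ax|j jE].
    by exists j => //; exact: val_inj.
  by move: nx; rewrite jE ltnNge leq_addr.
exists S; split; last 1 first.
- move=> D BD; rewrite -(card_imset _ injg) -(card_imset (mem D) (@rshift_inj n p)).
  apply/subset_leq_card/subsetP => _ /imsetP [x xS ->].
  by have [j -> /BD jD] := gS x xS; exact: imset_f.
- pose h x := match split (g x) with inl j => j | inr _ => x end.
  have hE x : x \notin S -> g x = lshift p (h x).
    by move=> /gNS [j gx _]; rewrite /h gx (unsplitK (inl j)).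
  exists h => [x y|x xS].
    by rewrite !in_setC => xS yS hxy; apply: injg; rewrite !hE // hxy.
  by have [j gx /AG] := gNS x xS; rewrite /h gx (unsplitK (inl j)).
- by move=> i /gS [j _ Bij]; exists j.
Qed.

Lemma full_rank_matchable (F : fieldType) n p (A : 'M[F]_n) (B : 'M[F]_(n, p))
    (G : 'M[bool]_n) (S : {set 'I_n}) :
  (forall i j, A i j != 0 -> G i j) -> (forall i j, B i j != 0 -> i \in S) ->
  (forall v : 'rV[F]_n, v *m A = 0 -> v *m B = 0 -> v = 0) -> matchable G S.
Proof.
move=> AG BS /(full_rank_matching AG) [S' [mS' S'B _]]; apply: matchableS mS'.
by apply/subsetP => i /S'B [j]; exact: BS.
Qed.

(** If [W] were proper, the row vectors vanishing on [W] would form a nonzero invariant subspace. An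
    eigenvector in it is not seen by the inputs, which all act on [W]. *)
Lemma pbh_reaching (F : closedFieldType) n p (A : 'M[F]_n) (B : 'M[F]_(n, p))
    (G : 'M[bool]_n) (S : {set 'I_n}) :
  (forall i j, A i j != 0 -> G i j) -> (forall i j, B i j != 0 -> i \in S) ->
  (forall z (v : 'rV[F]_n), v *m B = 0 -> v *m A = z *: v -> v = 0) -> reaching G S.
Proof.
move=> AG BS pbhAB W /subsetP SW clW; apply/setP => x0; rewrite inE; apply: contraT => x0W.
pose P (v : 'rV[F]_n) := forall y, y \in W -> v 0 y = 0.
have [w z Pw y yW|y yW||w [z [Pw w0 wE]]] := @eigenvector_in _ _ A P (delta_mx 0 x0).
- rewrite mxBE mxZE Pw // mulr0 subr0 mxE big1 // => x _.
  have [xW|xW] := boolP (x \in W); first by rewrite Pw ?mul0r.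
  have [->|/AG Gxy] := eqVneq (A x y) 0; first by rewrite mulr0.
  by case/negP: xW; apply: clW Gxy.
- by rewrite mxE /=; case: eqP => // yx; rewrite -yx yW in x0W.
- by apply/eqP => /(congr1 (fun M : 'rV_n => M 0 x0)) /eqP; rewrite !mxE !eqxx oner_eq0.
- case/eqP: w0; apply: pbhAB wE; apply/rowP => j; rewrite !mxE big1 // => x _.
  have [->|/BS xS] := eqVneq (B x j) 0; first by rewrite mulr0.
  by rewrite Pw ?mul0r // SW.
Qed.

Variable R : realType.

Lemma is_derive_mulmx n (a : 'rV[R]_n) (x : R -> 'cV[R]_n) (dx : 'cV[R]_n) t :
  (forall i, is_derive t (1 : R) (fun s => x s i 0) (dx i 0)) ->
  is_derive t (1 : R) (fun s => (a *m x s) 0 0) ((a *m dx) 0 0).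
Proof.
move=> xd; pose h i : R -> R := fun s => a 0 i * x s i 0.
have -> : (fun s => (a *m x s) 0 0) = \sum_i h i.
  by apply/funext => s; rewrite mxE fct_sumE.
rewrite mxE; exact: is_derive_sum.
Qed.

(* Along a trajectory, a pair of rows spanning a complex left eigenvector that is
   killed by the input matrix gives two outputs whose squared norm solves
   [psi' = 2 al psi]. *)
Lemma controllable_pbh n p (A : 'M[R]_n) (B : 'M[R]_(n, p)) :
  controllable A B -> forall z (v : 'rV[R[i]]_n), v *m toC B = 0 -> v *m toC A = z *: v -> v = 0.
Proof.
move=> ctrl [al be] v vB vA.
pose a : 'rV[R]_n := map_mx (@complex.Re R) v; pose b : 'rV[R]_n := map_mx (@complex.Im R) v.
have reM m (M : 'M[R]_(n, m)) : a *m M = map_mx (@complex.Re R) (v *m toC M).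
  apply/rowP => j; rewrite !mxE raddf_sum; apply: eq_bigr => k _; rewrite !mxE.
  by case: (v 0 k) => c d /=; rewrite mulr0 subr0.
have imM m (M : 'M[R]_(n, m)) : b *m M = map_mx (@complex.Im R) (v *m toC M).
  apply/rowP => j; rewrite !mxE raddf_sum; apply: eq_bigr => k _; rewrite !mxE.
  by case: (v 0 k) => c d /=; rewrite mulr0 add0r.
have aB : a *m B = 0 by rewrite reM vB; apply/rowP => j; rewrite !mxE.
have bB : b *m B = 0 by rewrite imM vB; apply/rowP => j; rewrite !mxE.
have aA : a *m A = al *: a - be *: b.
  by rewrite reM vA; apply/rowP => j; rewrite !mxE; case: (v 0 j).
have bA : b *m A = al *: b + be *: a.
  by rewrite imM vA; apply/rowP => j; rewrite !mxE; case: (v 0 j).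
have ab0 (x1 : 'cV[R]_n) : (a *m x1) 0 0 = 0 /\ (b *m x1) 0 0 = 0.
  have [T [u [x [T0 _ xd x0 xT]]]] := ctrl 0 x1.
  pose pa s := (a *m x s) 0 0; pose pb s := (b *m x s) 0 0.
  have da t : is_derive t (1 : R) pa (al * pa t - be * pb t).
    have := is_derive_mulmx a (xd t); rewrite mulmxDr !mulmxA aA aB mul0mx addr0.
    by rewrite mulmxBl -!scalemxAl mxBE !mxZE.
  have db t : is_derive t (1 : R) pb (al * pb t + be * pa t).
    have := is_derive_mulmx b (xd t); rewrite mulmxDr !mulmxA bA bB mul0mx addr0.
    by rewrite mulmxDl -!scalemxAl mxDE !mxZE.
  pose e (t : R) := expR (- (2 * al) * t).
  have de t : is_derive t (1 : R) e (- (2 * al) * e t).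
    apply: trigger_derive; rewrite /e /GRing.scale /=; ring.
  pose psi t := (pa t * pa t + pb t * pb t) * e t.
  have dpsi t : is_derive t (1 : R) psi 0.
    have ? := da t; have ? := db t; have ? := de t.
    by apply: trigger_derive; rewrite /GRing.scale /=; ring.
  have psiT : psi T = psi 0.
    have [|c _] := MVT_segment (ltW T0) (fun t _ => dpsi t).
      by apply: derivable_within_continuous => t _; exact: (@ex_derive _ _ _ _ _ _ _ (dpsi t)).
    by rewrite mul0r => /eqP; rewrite subr_eq0 => /eqP.
  have psi0 : psi 0 = 0 by rewrite /psi /pa /pb x0 !mulmx0 !mxE !mul0r addr0 mul0r.
  move/eqP: psiT; rewrite psi0 /psi mulf_eq0 [e T == 0]gt_eqF ?expR_gt0 // orbF.
  rewrite -!expr2 paddr_eq0 ?sqr_ge0 // !sqrf_eq0 /pa /pb xT.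
  by move=> /andP [/eqP -> /eqP ->].
have row0 (w : 'rV[R]_n) : (forall x1 : 'cV[R]_n, (w *m x1) 0 0 = 0) -> w = 0.
  move=> w0; apply/rowP => j; have := w0 (delta_mx j 0).
  by rewrite -colE !mxE.
have a0 := row0 a (fun x1 : 'cV[R]_n => (ab0 x1).1); have b0 := row0 b (fun x1 : 'cV[R]_n => (ab0 x1).2).
apply/rowP => j; have := congr1 (fun M : 'rV_n => M 0 j) a0.
have := congr1 (fun M : 'rV_n => M 0 j) b0; rewrite !mxE.
by case: (v 0 j) => c d /= -> ->.
Qed.

Definition row_support n p (B : 'M[bool]_(n, p)) : {set 'I_n} := [set i | [exists j, B i j]].

Lemma card_row_support n p (B : 'M[bool]_(n, p)) : (#|row_support B| <= nnz B)%N.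
Proof.
apply: leq_trans (leq_imset_card fst _); apply/subset_leq_card/subsetP => i.
rewrite inE => /existsP [j Bij]; apply/imsetP; exists (i, j) => //.
by rewrite inE.
Qed.

Lemma structurally_controllable_graph n p (A : 'M[bool]_n) (B : 'M[bool]_(n, p)) :
  structurally_controllable R A B ->
  matchable A (row_support B) /\ reaching A (row_support B).
Proof.
move=> [A0 [B0 [AA BB /controllable_pbh pbhAB]]].
have toC0 m (M : 'M[R]_(n, m)) i j : (toC M i j != 0) = (M i j != 0).
  by rewrite mxE fmorph_eq0.
have AG i j : toC A0 i j != 0 -> A i j by rewrite toC0 AA.
have BS i j : toC B0 i j != 0 -> i \in row_support B.
  by rewrite toC0 BB inE => Bij; apply/existsP; exists j.
split; last exact: pbh_reaching AG BS pbhAB.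
(* The Hautus test at eigenvalue 0 says that [[A B]] has full row rank. *)
apply: full_rank_matchable AG BS _ => v vA vB; apply: (pbhAB 0) => //.
by rewrite scale0r.
Qed.

Lemma matchable_pbh n (G : 'M[bool]_n) (S : {set 'I_n}) :
  matchable G S -> reaching G S ->
  exists N : 'M[nat]_n, (forall x y, N x y != 0%N -> G x y) /\ pbh (natmx R[i] N) S.
Proof.
move=> [f injf Gf] reach; have [s sf] := perm_extension injf.
apply: (@generic_pbh _ _ _ _ s) => // x xS.
by rewrite sf ?inE // Gf.
Qed.

Lemma toC_natmx n (N : 'M[nat]_n) : toC (natmx R N) = natmx R[i] N.
Proof. by apply/matrixP => i j; rewrite !mxE rmorph_nat. Qed.

(** The zero-one input matrix already has its exact pattern, so only the system matrix is
    perturbed. *)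
Lemma graph_structurally_controllable n (A : 'M[bool]_n) (S : {set 'I_n}) :
  matchable A S -> reaching A S ->
  structurally_controllable R A (\matrix_(i, j) ((i == j) && (i \in S))).
Proof.
move=> mS reach; have [N [NG pbhN]] := matchable_pbh mS reach.
have kal : kalman (natmx R N) (diag_set R S).
  apply: pbh_kalman => z v; rewrite (_ : toC (diag_set R S) = diag_set R[i] S); last first.
    by apply/matrixP => i j; rewrite !mxE rmorph_nat.
  rewrite toC_natmx mul_diag_set => vS; apply: pbhN => t tS.
  by have := congr1 (fun M : 'rV_n => M 0 t) vS; rewrite !mxE tS mulr1.
have [|A' [AA' detA']] := exact_pattern _ (kalman_gram kal) (G := A).
  by move=> i j; rewrite mxE pnatr_eq0; exact: NG.
exists A', (diag_set R S); split => // [i j|].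
  by rewrite !mxE pnatr_eq0 eqb0 negbK.
apply: kalman_controllable; have := @gram_kalman R R idfun _ _ _ _ detA'.
by rewrite !map_mx_id.
Qed.

End GraphConditions.

(** * Structurally fixed modes *)

Section FixedModes.
Local Open Scope ring_scope.
Variable R : realType.

Lemma eigenvalue_tr (F : fieldType) n (M : 'M[F]_n) z : eigenvalue M^T z = eigenvalue M z.
Proof.
rewrite !eigenvalue_root_char /char_poly; congr (root _ z).
rewrite -det_tr; congr (\det _); apply/matrixP => i j.
by rewrite !mxE eq_sym.
Qed.

Lemma pbh_eigenvalue (F : fieldType) n p q (A : 'M[F]_n) (B : 'M[F]_(n, p))
    (C : 'M[F]_(q, n)) z (v : 'rV[F]_n) :
  v != 0 -> v *m B = 0 -> v *m A = z *: v -> forall K, eigenvalue (A + B *m K *m C) z.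
Proof.
move=> v0 vB vA K; apply/eigenvalueP; exists v => //.
by rewrite mulmxDr !mulmxA vB !mul0mx addr0.
Qed.

Lemma toC_fixed n p q (A : 'M[R]_n) (B : 'M[R]_(n, p)) (K : 'M[R]_(p, q)) (C : 'M[R]_(q, n)) :
  toC (A + B *m K *m C) = toC A + toC B *m toC K *m toC C.
Proof. by rewrite /toC map_mxD !map_mxM. Qed.

(** Negating the definition yields one triple [A0], [B0], [C0] for which every [z] is avoided by
    some feedback. A left eigenvector of [A0] killed by [B0], or a right one killed by [C0], would
    be a fixed mode; this gives the first two bounds. The bounds on the feedback come from [z = 0]
    and from an eigenvalue of [A0]. *)
Lemma no_fixed_modes_graph n (A B K C : 'M[bool]_n) :
  ~ has_structurally_fixed_modes R A B K C ->
  [/\ exists S, [/\ matchable A S, reaching A S & (#|S| <= nnz B)%N],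
      exists S, [/\ matchable A^T S, reaching A^T S & (#|S| <= nnz C)%N],
      exists2 S, matchable A S & (#|S| <= nnz K)%N
    & (0 < n)%N -> (0 < nnz K)%N].
Proof.
move=> nosfm.
have [A0 [B0 [C0 [AA BB CC nofix]]]] : exists (A0 B0 C0 : 'M[R]_n),
    [/\ structural_class A A0, structural_class B B0, structural_class C C0 &
     forall z, exists2 K0, structural_class K K0 & ~~ eigenvalue (toC (A0 + B0 *m K0 *m C0)) z].
  apply: contrapT => nex; apply: nosfm => A0 B0 C0 AA BB CC.
  apply: contrapT => noz; apply: nex; exists A0, B0, C0; split => // z.
  apply: contrapT => noK; apply: noz; exists z => K0 KK /=.
  by apply: contrapT => /negP nK; apply: noK; exists K0.
have classC m m' (M : 'M[R]_(m, m')) (G : 'M[bool]_(m, m')) :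
    structural_class G M -> forall i j, toC M i j != 0 -> G i j.
  by move=> GM i j; rewrite mxE fmorph_eq0; apply: contraR => /GM ->.
have classT m m' (M : 'M[R]_(m, m')) (G : 'M[bool]_(m, m')) :
    structural_class G M -> structural_class G^T M^T.
  by move=> GM i j; rewrite !mxE; exact: GM.
have pbhB z (v : 'rV[R[i]]_n) : v *m toC B0 = 0 -> v *m toC A0 = z *: v -> v = 0.
  move=> vB vA; apply/eqP; apply: contraT => v0; have [K0 _] := nofix z.
  by rewrite toC_fixed (pbh_eigenvalue _ v0 vB vA).
have pbhC z (v : 'rV[R[i]]_n) : v *m toC C0^T = 0 -> v *m toC A0^T = z *: v -> v = 0.
  move=> vB vA; apply/eqP; apply: contraT => v0; have [K0 _] := nofix z.
  rewrite toC_fixed -eigenvalue_tr linearD /= !trmx_mul mulmxA /toC !map_trmx.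
  by rewrite (pbh_eigenvalue _ v0 vB vA).
have rs (G : 'M[bool]_n) (M : 'M[R]_n) : structural_class G M ->
    forall i j, toC M i j != 0 -> i \in row_support G.
  by move=> GM i j /(classC _ _ _ _ GM) Gij; rewrite inE; apply/existsP; exists j.
have graph (G H : 'M[bool]_n) (M N : 'M[R]_n) : structural_class G M -> structural_class H N ->
    (forall z (v : 'rV[R[i]]_n), v *m toC N = 0 -> v *m toC M = z *: v -> v = 0) ->
    exists S, [/\ matchable G S, reaching G S & (#|S| <= nnz H)%N].
  move=> GM HN pbhMN; exists (row_support H); split; last exact: card_row_support.
    apply: full_rank_matchable (classC _ _ _ _ GM) (rs _ _ HN) _ => v vM vN.
    by apply: (pbhMN 0) => //; rewrite scale0r.
  exact: pbh_reaching (classC _ _ _ _ GM) (rs _ _ HN) pbhMN.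
have nnz_tr (M : 'M[bool]_n) : (nnz M^T <= nnz M)%N.
  rewrite /nnz -(card_imset _ (@can_inj _ _ (fun ij => (ij.2, ij.1)) (fun ij => (ij.2, ij.1)) _)).
    apply/subset_leq_card/subsetP => _ /imsetP [[i j] + ->].
    by rewrite !inE mxE.
  by case.
split.
- exact: graph AA BB pbhB.
- have [S [mS rS cS]] := graph _ _ _ _ (classT _ _ _ _ AA) (classT _ _ _ _ CC) pbhC.
  by exists S; split => //; apply: leq_trans cS (nnz_tr C).
- have [K0 KK] := nofix 0; rewrite toC_fixed => noev.
  (* [B0 K0] acts as the input matrix: since 0 is not an eigenvalue of the closed loop, no nonzero
     row vector is killed by both [A0] and [B0 K0], and the nonzero columns of [B0 K0] are among
     those of the pattern [K]. *)
  have [|S [mS SB SD]] := full_rank_matching (B := toC B0 *m toC K0) (classC _ _ _ _ AA).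
    move=> v vA vBK; apply/eqP; apply: contraR noev => v0; apply/eigenvalueP; exists v => //.
    by rewrite mulmxDr mulmxA vA vBK mul0mx addr0 scale0r.
  exists S => //; apply: leq_trans (SD (row_support K^T) _) _.
    move=> i j; rewrite mxE => BK; rewrite inE; apply: contraNT BK => /existsPn noK.
    rewrite big1 // => k _; have := noK k; rewrite mxE => /KK Kkj.
    by rewrite [toC K0 _ _]mxE Kkj rmorph0 mulr0.
  exact: leq_trans (card_row_support _) (nnz_tr _).
(* An empty pattern leaves only the zero feedback, and then every eigenvalue of [A0] is a fixed
   mode. *)
- move=> n0; rewrite lt0n; apply/negP; rewrite cards_eq0 => /eqP K0.
  have KK0 K1 : structural_class K K1 -> K1 = 0.
    move=> KK; apply/matrixP => i j; rewrite mxE; apply: KK.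
    by have := congr1 (fun S : {set _} => (i, j) \in S) K0; rewrite !inE => ->.
  have [z rz] : exists z, root (char_poly (toC A0)) z.
    by apply/closed_rootP; rewrite size_char_poly; lia.
  have [K1 /KK0 ->] := nofix z; rewrite mulmx0 mul0mx addr0.
  by rewrite eigenvalue_root_char rz.
Qed.

(** For a left eigenvector [w] of [M + b c] and a right eigenvector [x] of [M], evaluating
    [w (M + b c) x] in two ways gives [(w b)(c x) = 0]. Observability excludes [c x = 0], so
    [w b = 0] and [w] is an eigenvector of [M] against controllability. *)
Lemma siso_no_common_eigenvalue (F : fieldType) n (M : 'M[F]_n) (b : 'cV[F]_n) (c : 'rV[F]_n) z :
  (forall v : 'rV[F]_n, v *m b = 0 -> v *m M = z *: v -> v = 0) ->
  (forall v : 'rV[F]_n, v *m c^T = 0 -> v *m M^T = z *: v -> v = 0) ->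
  eigenvalue M z -> eigenvalue (M + b *m c) z -> False.
Proof.
move=> ctrl obs; rewrite -eigenvalue_tr => /eigenvalueP [x xM x0] /eigenvalueP [w wM w0].
have cx : (x *m c^T) 0 0 != 0.
  apply: contraNneq x0 => cx; apply/eqP; apply: obs => //.
  by apply/matrixP => i j; rewrite !ord1 cx mxE.
move: wM; rewrite mulmxDr mulmxA => wM.
have wb : w *m b = 0.
  have := congr1 (fun u => (u *m x^T) 0 0) wM.
  rewrite mulmxDl -[w *m M *m _]mulmxA -[M *m x^T]trmxK trmx_mul trmxK xM linearZ /=.
  rewrite -scalemxAr -scalemxAl mxDE addrC => /(canRL (addrK _)); rewrite subrr.
  rewrite -mulmxA -[c *m x^T]trmxK trmx_mul trmxK mxE big_ord1 [_^T _ _]mxE => /eqP.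
  rewrite mulf_eq0 (negbTE cx) orbF => /eqP wb.
  by apply/matrixP => i j; rewrite !ord1 wb mxE.
case/eqP: w0; apply: ctrl => //.
by rewrite -wM wb mul0mx addr0.
Qed.

Lemma gram_no_common_eigenvalue n (M : 'M[R]_n) (b : 'cV[R]_n) (c : 'rV[R]_n) z :
  \det (gram M b) != 0 -> \det (gram M^T c^T) != 0 ->
  eigenvalue (toC M) z -> eigenvalue (toC (M + b *m c)) z -> False.
Proof.
move=> ctrl obs evM; rewrite /toC map_mxD map_mxM => evMbc.
apply: siso_no_common_eigenvalue evM evMbc => v.
  exact: (kalman_pbh (@gram_kalman _ _ (real_complex R) _ _ _ _ ctrl)).
rewrite !map_trmx.
exact: (kalman_pbh (@gram_kalman _ _ (real_complex R) _ _ _ _ obs)).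
Qed.

Definition hub_inputs n (S Sx : {set 'I_n}) (h : 'I_n) : 'M[bool]_n :=
  \matrix_(i, j) ((i == j) && (i \in S) || (i \in Sx) && (j == h)).

(** The hub entry coincides with a pair when [h] is in [S] and [s h = h']. It is listed separately
    for empty [S], where one feedback entry is still required. *)
Definition hub_feedback n (S : {set 'I_n}) (s : {perm 'I_n}) (h h' : 'I_n) : 'M[bool]_n :=
  \matrix_(i, j) ((i \in S) && (j == s i) || (i == h) && (j == h')).

(** Reachability from the hub input alone in the closed loop: the output at [s i] feeds the input at
    [i], except at the hub, whose loop stays open. *)
Definition hub_reaching n (A : 'M[bool]_n) (S Sx : {set 'I_n}) (s : {perm 'I_n}) (h : 'I_n) :=
  forall W : {set 'I_n}, (h \in S -> h \in W) -> Sx \subset W ->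
  (forall i j, i \in W -> A j i -> j \in W) ->
  (forall i, i \in S -> i != h -> s i \in W -> i \in W) -> W = [set: 'I_n]%SET.

(** The hub input becomes an extra state [u], so that [matchable_pbh] applies with [u] as the only
    input. Of the weights obtained, those allowed by [A] go to [A0]; the others are produced by the
    feedback loops off the hub. *)
Lemma hub_controllable n (A : 'M[bool]_n) (S Sx T Tx : {set 'I_n}) (s : {perm 'I_n}) (h h' : 'I_n) :
  (forall x, x \notin S -> A x (s x)) -> (forall x, (s x \in T) = (x \in S)) ->
  hub_reaching A S Sx s h ->
  exists A0 B0 K0 C0 : 'M[R]_n,
    [/\ structural_class A A0, structural_class (hub_inputs S Sx h) B0,
        structural_class (hub_feedback S s h h') K0,
        structural_class (hub_inputs T Tx h')^T C0 &
        \det (gram (A0 + B0 *m K0 *m C0) (col h B0)) != 0].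
Proof.
move=> As sT reach.
pose b : 'cV[bool]_n := \col_i ((i \in Sx) || (i == h) && (h \in S)).
pose Acl : 'M[bool]_n := \matrix_(i, j) (A i j || [&& i \in S, i != h & j == s i]).
pose G : 'M[bool]_(1 + n) := block_mx (const_mx false) (const_mx false) b Acl.
pose u : 'I_(1 + n) := lshift n ord0.
have uE x : x \notin [set u] -> exists i, x = rshift 1 i.
  rewrite inE; case: (split_ordP x) => [j ->|j -> _]; last by exists j.
  by rewrite [j]ord1 eqxx.
have mG : matchable G [set u].
  exists (fun x => match split x with
    | inl _ => u
    | inr i => if (i == h) && (h \in S) then u else rshift 1 (s i) end) => [x y|x].
    rewrite !in_setC => /uE [i ->] /uE [j ->]; rewrite !(unsplitK (inr _)).
    case: ifPn => [/andP [/eqP -> hS]|ih]; case: ifPn => [/andP [/eqP -> _] //|jh].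
    - by move=> /(congr1 val) /=; rewrite add1n.
    - by move=> /rshift_inj /perm_inj ->.
  move=> /uE [i ->]; rewrite (unsplitK (inr _)); case: ifPn => [/andP [/eqP -> hS]|ih].
    by rewrite /G block_mxEdl mxE eqxx hS orbT.
  rewrite /G block_mxEdr mxE eqxx; have [iS|iS] := boolP (i \in S); last by rewrite As.
  rewrite andbT /=; apply/orP; right; apply: contraNneq ih => ih.
  by rewrite -ih eqxx.
have rG : reaching G [set u].
  move=> W /subsetP uW clW; have uinW : u \in W by apply: uW; rewrite inE.
  have : [set i | rshift 1 i \in W] = [set: 'I_n]%SET.
    apply: reach => [hS||i j|i iS ih].
    - by rewrite inE; apply: clW uinW _; rewrite block_mxEdl mxE eqxx hS orbT.
    - apply/subsetP => i iSx; rewrite inE; apply: clW uinW _.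
      by rewrite block_mxEdl mxE iSx.
    - rewrite !inE => iW Aji; apply: clW iW _.
      by rewrite block_mxEdr mxE Aji.
    - rewrite !inE => siW; apply: clW siW _.
      by rewrite block_mxEdr mxE iS ih eqxx orbT.
  move=> /setP WT; apply/setP => x; rewrite !inE; have [/uE [i ->]|] := boolP (x \notin [set u]).
    by have := WT i; rewrite !inE.
  by rewrite negbK inE => /eqP ->.
have [N [NG pbhN]] := matchable_pbh R mG rG.
pose D := drsubmx (natmx R N); pose bb := dlsubmx (natmx R N).
have DG i j : D i j != 0 -> Acl i j.
  rewrite /D /drsubmx !mxE pnatr_eq0 => /NG.
  by rewrite /G block_mxEdr mxE.
have bG i : bb i 0 != 0 -> b i 0.
  rewrite /bb /dlsubmx !mxE pnatr_eq0 => /NG.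
  by rewrite /G block_mxEdl mxE.
have kal : kalman D bb.
  apply: pbh_kalman => z v vb vD.
  have : row_mx (0 : 'rV_1) v = 0.
    apply: (pbhN z) => [x|].
      rewrite inE => /eqP ->; by rewrite row_mxEl mxE.
    rewrite -toC_natmx -[natmx R N]submxK /toC map_block_mx mul_row_block !mul0mx !add0r.
    by rewrite -/(toC _) -/(toC _) vb vD scale_row_mx scaler0.
  by move=> /(congr1 rsubmx); rewrite row_mxKr linear0.
clearbody D bb.
(* Off column [h], [B0] is the identity on [S], and [C0] is the identity on [T], so [B0 K0 C0]
   reproduces [K0]. Row [h] of [K0] is zero, which leaves column [h] of [B0] free for [bb]. *)
exists (\matrix_(i, j) (if A i j then D i j else 0)).
exists (\matrix_(i, j) (if j == h then bb i 0 else ((i == j) && (i \in S))%:R)).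
exists (\matrix_(i, j) (if [&& i \in S, i != h & j == s i] && ~~ A i j then D i j else 0)).
exists (\matrix_(i, j) ((i == j) && (i \in T))%:R); split.
- by move=> i j; rewrite mxE => /negbTE ->.
- move=> i j; rewrite !mxE negb_or => /andP [ijS ijSx].
  case: (eqVneq j h) ijS ijSx => [->|_] ijS ijSx; last by rewrite (negbTE ijS).
  apply/eqP; apply: contraNT ijSx => /bG; rewrite mxE andbT => /orP [//|/andP [/eqP ih hS]].
  by rewrite ih eqxx hS in ijS.
- move=> i j; rewrite !mxE negb_or => /andP [ijS _]; case: ifP => // /andP [/and3P [iS _ /eqP ji]].
  by rewrite iS ji eqxx in ijS.
- move=> i j; rewrite !mxE negb_or eq_sym => /andP [ijS _].
  by case: eqP ijS => //= -> /negbTE ->.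
set A0 := \matrix_(i, j) _; set B0 := \matrix_(i, j) _; set K0 := \matrix_(i, j) _.
set C0 := \matrix_(i, j) _.
have -> : col h B0 = bb by apply/colP => i; rewrite !mxE eqxx.
suff -> : A0 + B0 *m K0 *m C0 = D by exact: kalman_gram.
apply/matrixP => i j; rewrite mxDE -mulmxA mxE [X in _ + X]mxE.
have KC k : (K0 *m C0) k j = K0 k j.
  rewrite mxE (bigD1 j) //= [C0 j j]mxE eqxx big1 ?addr0 => [|l lj]; last first.
    by rewrite [C0 _ _]mxE (negbTE lj) mulr0.
  rewrite mxE; case: ifP => [/andP [/and3P [kS _ /eqP ->] _]|]; last by rewrite mul0r.
  by rewrite sT kS mulr1.
rewrite (bigD1 i) //= big1 ?addr0 => [|k ki]; rewrite KC [K0 _ _]mxE; last first.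
  case: ifP => [/andP [/and3P [kS kh _] _]|]; last by rewrite mulr0.
  by rewrite mxE (negbTE kh) eq_sym (negbTE ki) mul0r.
have [Aij|Aij] := boolP (A i j); first by rewrite andbF mulr0 addr0.
rewrite andbT add0r; case: ifP => [/and3P [iS ih _]|ijS].
  by rewrite mxE (negbTE ih) eqxx iS mul1r.
rewrite mulr0; apply/esym/eqP; apply: contraFT ijS => /DG; rewrite mxE (negbTE Aij).
by [].
Qed.

(** The system and its transpose yield two different sets of matrices. On the line joining them both
    Gram determinants are nonzero polynomials in [t], so a single [t] serves both. A fixed mode
    would then be common to a feedback and to the same feedback with its hub entry raised by 1. *)
Lemma hub_no_fixed_modes n (A : 'M[bool]_n) (S Sx T Tx : {set 'I_n}) (s : {perm 'I_n}) (h h' : 'I_n) :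
  (forall x, x \notin S -> A x (s x)) -> (forall x, (s x \in T) = (x \in S)) ->
  hub_reaching A S Sx s h -> hub_reaching A^T T Tx (s^-1)%g h' ->
  ~ has_structurally_fixed_modes R A (hub_inputs S Sx h) (hub_feedback S s h h')
      (hub_inputs T Tx h')^T.
Proof.
move=> As sT reach1 reach2 sfm.
have [A1 [B1 [K1 [C1 [AA1 BB1 KK1 CC1 det1]]]]] := hub_controllable Tx h' As sT reach1.
have [|x|A2 [B2 [K2 [C2 [AA2 BB2 KK2 CC2 det2]]]]] := @hub_controllable n A^T T Tx S Sx (s^-1)%g h' h _ _ reach2.
- by move=> x xT; rewrite mxE -{2}[x](permKV s) As // -sT permKV.
- by rewrite -sT permKV.
pose P m1 m2 (M N : 'M[R]_(m1, m2)) : 'M[{poly R}]_(m1, m2) :=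
  map_mx polyC M + 'X *: map_mx polyC (N - M).
have PE m1 m2 (M N : 'M[R]_(m1, m2)) t : map_mx (horner_eval t) (P _ _ M N) = M + t *: (N - M).
  by apply/matrixP => i j; rewrite !mxE /horner_eval !hornerE.
have classP m1 m2 (G : 'M[bool]_(m1, m2)) M N t : structural_class G M -> structural_class G N ->
    structural_class G (map_mx (horner_eval t) (P _ _ M N)).
  by move=> GM GN i j Gij; rewrite PE mxDE mxZE mxBE GM // GN // subrr mulr0 addr0.
have classT (G : 'M[bool]_n) (M : 'M[R]_n) : structural_class G M -> structural_class G^T M^T.
  by move=> GM i j; rewrite !mxE; exact: GM.
pose At := P _ _ A1 A2^T; pose Bt := P _ _ B1 C2^T.
pose Kt := P _ _ K1 K2^T; pose Ct := P _ _ C1 B2^T.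
pose Mt := At + Bt *m Kt *m Ct.
pose ev t m1 m2 (M : 'M[{poly R}]_(m1, m2)) := map_mx (horner_eval t) M.
have MtE t : ev t _ _ Mt = ev t _ _ At + ev t _ _ Bt *m ev t _ _ Kt *m ev t _ _ Ct.
  by rewrite /ev /Mt map_mxD !map_mxM.
pose d1 := \det (gram Mt (col h Bt)); pose d2 := \det (gram Mt^T (row h' Ct)^T).
have d1E t : d1.[t] = \det (gram (ev t _ _ Mt) (col h (ev t _ _ Bt))).
  by rewrite /ev -map_col -map_gram det_map_mx.
have d2E t : d2.[t] = \det (gram (ev t _ _ Mt)^T (row h' (ev t _ _ Ct))^T).
  by rewrite /ev -map_row !map_trmx -map_gram det_map_mx.
have : d1 * d2 != 0.
  rewrite mulf_neq0 //.
    apply: contraNneq det1 => d10; have := d1E 0; rewrite d10 horner0 MtE /ev !PE.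
    by rewrite !scale0r !addr0 => <-.
  apply: contraNneq det2 => d20; have := d2E 1; rewrite d20 horner0 MtE /ev !PE.
  rewrite !scale1r !subrKC => /esym; rewrite linearD /= !trmx_mul !trmxK mulmxA => E.
  by rewrite -{}E; apply/eqP; congr (\det (gram _ _)); apply/matrixP => i j; rewrite !mxE.
case/poly_nonroot => t; rewrite hornerM mulf_eq0 negb_or d1E d2E => /andP [dt1 dt2].
have classB : structural_class (hub_inputs S Sx h) (ev t _ _ Bt).
  by apply: classP => //; rewrite -[hub_inputs _ _ _]trmxK; exact: classT.
have classA : structural_class A (ev t _ _ At).
  by apply: classP => //; rewrite -[A]trmxK; exact: classT.
have classC : structural_class (hub_inputs T Tx h')^T (ev t _ _ Ct).
  by apply: classP => //; exact: classT.
have classK : structural_class (hub_feedback S s h h') (ev t _ _ Kt).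
  apply: classP => //.
  rewrite (_ : hub_feedback S s h h' = (hub_feedback T (s^-1)%g h' h)^T); first exact: classT.
  apply/matrixP => i j; rewrite !mxE [(j == h') && _]andbC; congr (_ || _).
  have [->|ji] := eqVneq j (s i); first by rewrite permK eqxx sT.
  rewrite andbF; apply/esym/negbTE; apply: contraNN ji => /andP [_ /eqP ->].
  by rewrite permKV.
have [z zK] := sfm _ _ _ classA classB classC.
have classK' : structural_class (hub_feedback S s h h') (ev t _ _ Kt + delta_mx h h').
  move=> i j Kij; rewrite mxDE classK // add0r mxE; move: Kij; rewrite mxE negb_or.
  by case/andP => _ /negbTE ->.
have ev1 := zK _ classK; have ev2 := zK _ classK'.
move: dt1 dt2 ev1 ev2; rewrite MtE.
move: (ev t _ _ At) (ev t _ _ Bt) (ev t _ _ Kt) (ev t _ _ Ct) => a b k c dt1 dt2 ev1 ev2.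
apply: (gram_no_common_eigenvalue dt1 dt2 ev1).
have -> : a + b *m k *m c + col h b *m row h' c = a + b *m (k + delta_mx h h') *m c.
  by rewrite mulmxDr mulmxDl addrA colE rowE -(mul_delta_mx (0 : 'I_1) h h') !mulmxA.
exact: ev2.
Qed.

End FixedModes.

(** * Maximum matchings and source components *)

Section Combinatorics.
Local Open Scope nat_scope.

(* The columns [c < n] of the bipartite graph [E] are the states and the columns [n + r]
   the source components; [mc] and [mr] store matched partners, shifted by one, with 0
   for unmatched vertices. *)
Definition matching n (E : nat -> nat -> bool) (mc mr : nat -> nat) :=
  (forall c i, c < 2 * n -> mc c = i.+1 -> [/\ i < n, E c i & mr i = c.+1]) /\
  (forall i c, i < n -> mr i = c.+1 -> c < 2 * n /\ mc c = i.+1).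

(** Columns from which no augmenting path starts: an alternating search from [D] meets only matched
    rows and never leaves [D]. *)
Definition dead n (E : nat -> nat -> bool) (mr : nat -> nat) (D : pred nat) :=
  forall c i, D c -> i < n -> E c i -> exists2 c', mr i = c'.+1 & D c'.

(** The parameter [L] is there because one matching has to be maximum for two column sets, the
    states alone and all valid columns. *)
Definition optimal n (E : nat -> nat -> bool) (L : pred nat) (mc : nat -> nat) :=
  forall (X : {set 'I_n}) (f : 'I_n -> nat), {in X &, injective f} ->
  (forall i, i \in X -> [/\ f i < 2 * n, L (f i) & E (f i) i]) ->
  #|X| <= #|[set c : 'I_(2 * n) | L c && (mc c != 0)]|.

(* Koenig's argument: the rows seen from a dead column are matched to dead columns. *)
Lemma dead_optimal n E (L D : pred nat) mc mr :
  matching n E mc mr -> dead n E mr D ->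
  (forall c, c < 2 * n -> L c -> mc c = 0 -> D c) ->
  (forall c, c < 2 * n -> mc c != 0 -> L c) -> optimal n E L mc.
Proof.
move=> [M1 M2] deadD freeD covL X f injf Xf.
pose phi i := if D (f i) then (mr i).-1 else f i.
have phiP (i : 'I_n) : i \in X -> [/\ phi i < 2 * n, L (phi i), mc (phi i) != 0 & D (phi i) = D (f i)].
  move=> /Xf [fn Lf Ef]; rewrite /phi; have [Df|Df] := boolP (D (f i)); last first.
    by split => //; rewrite ?(negbTE Df) //; apply: contraNneq Df; exact: freeD.
  have [c' mrE Dc'] := deadD _ _ Df (ltn_ord i) Ef; have [cn mcE] := M2 _ _ (ltn_ord i) mrE.
  by rewrite mrE /= Dc' covL ?mcE.
have injphi : {in X &, injective phi}.
  move=> i j iX jX; have [_ _ _ Di] := phiP i iX; have [_ _ _ Dj] := phiP j jX.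
  move=> eqp; move: Di; rewrite eqp Dj => Dij; move: eqp; rewrite /phi -Dij.
  have [Df|Df] := boolP (D (f j)); last exact: injf.
  have [_ _ Ej] := Xf j jX; have [fi _ Ei] := Xf i iX.
  have [c' mrj _] := deadD _ _ Df (ltn_ord j) Ej; rewrite Dij in Df.
  have [c mri _] := deadD _ _ Df (ltn_ord i) Ei; rewrite mri mrj /= => cc; subst c'.
  have [_ mci] := M2 _ _ (ltn_ord i) mri; have [_] := M2 _ _ (ltn_ord j) mrj.
  by rewrite mci => -[] /val_inj.
case: (set_0Vmem X) => [->|[i0 i0X]]; first by rewrite cards0.
have z0 : 0 < 2 * n by have := ltn_ord i0; lia.
pose psi i := insubd (Ordinal z0) (phi i).
have psiE i : i \in X -> psi i = phi i :> nat.
  by move=> /phiP [lt _ _ _]; rewrite /psi val_insubd lt.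
rewrite -(card_in_imset (f := psi) (D := X)).
  apply/subset_leq_card/subsetP => _ /imsetP [i iX ->].
  by rewrite inE psiE //; have [_ -> -> _] := phiP i iX.
by move=> i j iX jX /(congr1 (@nat_of_ord _)); rewrite !psiE //; exact: injphi.
Qed.

Definition conn n (G : 'M[bool]_n) : rel 'I_n := connect (fun a b => G b a).

(** The least member of a strongly connected component that nothing enters; the least index makes
    representatives unique. *)
Definition source_rep n (G : 'M[bool]_n) (r : 'I_n) :=
  [forall y, conn G y r ==> conn G r y && (r <= y)].

Lemma conn_closed n (G : 'M[bool]_n) (W : {set 'I_n}) x y :
  (forall i j, i \in W -> G j i -> j \in W) -> conn G x y -> x \in W -> y \in W.
Proof.
move=> clW /connectP [p + ->]; elim: p x => //= z p IH x /andP [Gzx pz] xW.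
by apply: IH pz _; exact: clW Gzx.
Qed.

Lemma reachingP n (G : 'M[bool]_n) (S : {set 'I_n}) :
  reaching G S <-> forall x, exists2 s, s \in S & conn G s x.
Proof.
split=> [reach x|H W /subsetP SW clW]; last first.
  apply/setP => x; rewrite inE; have [s sS sx] := H x.
  by apply: conn_closed clW sx _; exact: SW.
have := reach [set y | [exists s in S, conn G s y]].
move=> /(_ _ _) /setP H; have : x \in [set y | [exists s in S, conn G s y]].
  rewrite H ?inE //.
    apply/subsetP => s sS; rewrite inE; apply/existsP; exists s.
    by rewrite sS /conn connect0.
  move=> i j; rewrite !inE => /existsP [s /andP [sS si]] Gji; apply/existsP; exists s.
  by rewrite sS /=; apply: connect_trans si _; apply: connect1.
by rewrite inE => /existsP [s /andP [sS sx]]; exists s.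
Qed.

(** Among the vertices reaching [x], one with fewest predecessors lies in a source component, since
    whatever reaches it has the same predecessors. *)
Lemma source_rep_exists n (G : 'M[bool]_n) x : exists2 r, source_rep G r & conn G r x.
Proof.
pose pre y := [set z | conn G z y].
have preS y z : conn G z y -> pre z \subset pre y.
  by move=> zy; apply/subsetP => t; rewrite !inE => tz; exact: connect_trans tz zy.
have xx : conn G x x by exact: connect0.
case: (@arg_minnP _ x (fun y => conn G y x) (fun y => #|pre y|) xx) => y yx ymin.
have ysrc z : conn G z y -> conn G y z.
  move=> zy; have zx := connect_trans zy yx.
  have /setP /(_ y) : pre z = pre y by apply/eqP; rewrite eqEcard preS // ymin.
  by rewrite !inE /conn connect0.
have yy : conn G y y && conn G y y by rewrite /conn connect0.
case: (@arg_minnP _ y (fun z => conn G y z && conn G z y) (@nat_of_ord n) yy) => r /andP [yr ry] rmin.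
exists r; last exact: connect_trans ry yx.
apply/forallP => w; apply/implyP => wr; have wy := connect_trans wr ry; have yw := ysrc _ wy.
rewrite (connect_trans ry yw : conn G r w) /=; apply: rmin; by rewrite yw.
Qed.

Section Analysis.
Variables (n : nat) (G : 'M[bool]_n) (E : nat -> nat -> bool) (mc mr : nat -> nat).
Hypothesis E_state : forall i c : 'I_n, E c i = G i c.
Hypothesis E_source : forall i r : 'I_n, E (n + r) i = source_rep G r && conn G i r.
Hypothesis matchE : matching n E mc mr.

Definition valid_col : pred nat := fun c => (c < n) || [exists r : 'I_n, source_rep G r && (c == n + r)].

Hypothesis opt_state : optimal n E (fun c => c < n) mc.
Hypothesis opt_all : optimal n E valid_col mc.

(** Because of the shift, [n < mr i] means that row [i] is matched to a source column. Such a state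
    still needs an input, which then serves the source component too. *)
Definition unmatched_rows : {set 'I_n} := [set i : 'I_n | (mr i == 0) || (n < mr i)].
Definition unmatched_sources : {set 'I_n} := [set r | source_rep G r && (mc (n + r) == 0)].

Lemma source_repP r y : source_rep G r -> conn G y r -> conn G r y /\ r <= y.
Proof. by move=> /forallP /(_ y) /implyP H /H /andP. Qed.

Lemma unmatched_rowsN (i : 'I_n) : i \notin unmatched_rows ->
  exists c : 'I_n, [/\ mr i = c.+1, mc c = i.+1 & G i c].
Proof.
rewrite inE negb_or -leqNgt => /andP [mr0 mrn]; case mrE: (mr i) mr0 mrn => [|c] // _ cn.
have [c2 mcE] := matchE.2 _ _ (ltn_ord i) mrE; exists (Ordinal cn); split => //.
by have [_ + _] := matchE.1 _ _ c2 mcE; rewrite -[c]/(nat_of_ord (Ordinal cn)) E_state.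
Qed.

Lemma unmatched_rowsT (c : 'I_n) : mc c != 0 -> exists2 i : 'I_n, mc c = i.+1 & mr i = c.+1.
Proof.
case mcE: (mc c) => [|i] // _; have [|iN _ mrE] := matchE.1 _ _ _ mcE.
  by have := ltn_ord c; lia.
by exists (Ordinal iN).
Qed.

Lemma card_matched_states :
  #|[set c : 'I_(2 * n) | (c < n) && (mc c != 0)]| + #|unmatched_rows| = n.
Proof.
rewrite -[RHS]card_ord -(cardsC unmatched_rows) addnC; congr (_ + _).
case: (posnP n) => [n0|n0].
  rewrite [LHS]eq_card0 => [|c]; last by rewrite inE; apply/negbTE; lia.
  by apply/esym/eq_card0 => x; have := ltn_ord x; lia.
have z0 : 0 < 2 * n by lia.
pose psi (i : 'I_n) := insubd (Ordinal z0) (mr i).-1.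
have psiE i : i \notin unmatched_rows -> psi i = (mr i).-1 :> nat.
  move=> /unmatched_rowsN [c [mrE _ _]]; have lt := ltn_ord c; rewrite /psi val_insubd mrE /=.
  by rewrite ifT //; lia.
rewrite -(card_in_imset (f := psi)); last first.
  move=> i j; rewrite !in_setC => iS jS /(congr1 (@nat_of_ord _)); rewrite !psiE //.
  have [c [-> mci _]] := unmatched_rowsN iS; have [d [-> mcj _]] := unmatched_rowsN jS.
  by move=> /= /val_inj cd; apply: val_inj; move: mci; rewrite cd mcj => -[].
apply: eq_card => c; apply/idP/imsetP.
  rewrite inE => /andP [cn mc0]; have [i mcE mrE] := unmatched_rowsT (c := Ordinal cn) mc0.
  have iS : i \notin unmatched_rows by rewrite inE mrE /= ltnS -ltnNge.
  exists i; first by rewrite inE.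
  by apply: val_inj; rewrite /= psiE // mrE.
case=> i + ->; rewrite in_setC => iS; have [d [mrE mcE _]] := unmatched_rowsN iS.
by rewrite inE psiE // mrE /= ltn_ord mcE.
Qed.

Lemma unmatched_rows_min (S' : {set 'I_n}) : matchable G S' -> #|unmatched_rows| <= #|S'|.
Proof.
move=> [f injf Gf].
have := opt_state (X := ~: S') (f := fun i => f i).
have := cardsC S'; rewrite card_ord; have := card_matched_states.
suff H : {in ~: S' &, injective (fun i => nat_of_ord (f i))} /\
    (forall i, i \in ~: S' -> [/\ f i < 2 * n, f i < n & E (f i) i]).
  by move=> ? ? /(_ H.1 H.2); lia.
split=> [i j iS jS /val_inj|i]; first exact: injf.
by rewrite inE => /Gf Gi; have := ltn_ord (f i); rewrite E_state Gi; split => //; lia.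
Qed.

Lemma card_matched_sources :
  #|[set c : 'I_(2 * n) | valid_col c && (mc c != 0)]| + #|unmatched_sources| <=
  #|[set c : 'I_(2 * n) | (c < n) && (mc c != 0)]| + #|[set r | source_rep G r]|.
Proof.
set V := [set c : 'I_(2 * n) | _ && _]; set W := [set c : 'I_(2 * n) | _ && _].
pose reps := [set r | source_rep G r].
have -> : #|reps| = #|unmatched_sources| + #|reps :\: unmatched_sources|.
  rewrite -(cardsID unmatched_sources reps); congr (_ + _).
  by congr #|pred_of_set _|; apply/setIidPr/subsetP => r; rewrite !inE => /andP [].
suff : #|V :\: W| <= #|reps :\: unmatched_sources|.
  rewrite -(cardsID W V); have : #|V :&: W| <= #|W| by rewrite subset_leq_card // subsetIr.
  by lia.
case: (set_0Vmem (V :\: W)) => [->|[c0 c0V]]; first by rewrite cards0.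
have n0 : 0 < n by have := ltn_ord c0; lia.
pose psi (c : 'I_(2 * n)) := insubd (Ordinal n0) (c - n).
have psiE c : c \in V :\: W -> exists r : 'I_n, [/\ source_rep G r, c = n + r :> nat, mc c != 0 & psi c = r].
  rewrite !inE => /andP [cW /andP [+ mc0]]; rewrite mc0 andbT in cW.
  rewrite /valid_col (negbTE cW) /= => /existsP [r /andP [rr /eqP cE]]; exists r.
  by split => //; apply: val_inj; rewrite /psi val_insubd /= cE addKn ltn_ord.
have injpsi : {in V :\: W &, injective psi}.
  move=> x y xV yV; have [r [_ xE _ ->]] := psiE x xV; have [r' [_ yE _ ->]] := psiE y yV.
  by move=> rr; apply: val_inj; rewrite /= xE yE rr.
apply: (@leq_trans #|psi @: (V :\: W)|); first by rewrite card_in_imset.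
apply/subset_leq_card/subsetP => _ /imsetP [c /psiE [r [rr cE mc0 ->]] ->].
by rewrite !inE rr /= -cE mc0.
Qed.

(** A competing [S'] has an input in every source component, and these are distinct. Sending them to
    the source columns and the states outside [S'] to state columns gives a matching of [n - |S'|]
    rows plus one per source, to be compared with the computed maximum. *)
Lemma unmatched_total_min (S' : {set 'I_n}) : matchable G S' -> reaching G S' ->
  #|unmatched_rows| + #|unmatched_sources| <= #|S'|.
Proof.
move=> [f injf Gf] /reachingP reach.
pose g r := odflt r [pick s in S' | conn G s r].
have gP r : source_rep G r -> [/\ g r \in S', conn G (g r) r & conn G r (g r)].
  move=> rr; rewrite /g; case: pickP => [s /andP [sS sr]|no] /=.
    by split => //; have [] := source_repP rr sr.
  by have [s sS sr] := reach r; have := no s; rewrite sS sr.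
have injg : {in [set r | source_rep G r] &, injective g}.
  move=> r r'; rewrite !inE => rr rr' gg.
  have [_ g1 g2] := gP r rr; have [_ g1' g2'] := gP r' rr'; rewrite gg in g1 g2.
  have [_ le1] := source_repP rr (connect_trans g2' g1).
  have [_ le2] := source_repP rr' (connect_trans g2 g1').
  by apply: val_inj; apply/eqP; rewrite eqn_leq le1 le2.
pose Y := g @: [set r | source_rep G r].
have cardY : #|Y| = #|[set r | source_rep G r]| by rewrite card_in_imset.
have YS : Y \subset S' by apply/subsetP => y /imsetP [r + ->]; rewrite inE => /gP [].
pose h i := if i \in S' then n + odflt i [pick r | source_rep G r && (g r == i)] else f i.
have hY i : i \in Y -> exists r : 'I_n, [/\ source_rep G r, g r = i & h i = n + r].
  move=> iY; rewrite /h (subsetP YS _ iY); case: pickP => [r /andP [rr /eqP gr]|no] /=; first by exists r.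
  by case/imsetP: iY => r; rewrite inE => rr iE; have := no r; rewrite rr iE eqxx.
have hS i : i \notin S' -> h i = f i by rewrite /h => /negbTE ->.
have := opt_all (X := ~: S' :|: Y) (f := h).
have -> : #|~: S' :|: Y| = #|~: S'| + #|Y|.
  rewrite cardsU (_ : ~: S' :&: Y = set0) ?cards0 ?subn0 //.
  by apply/eqP; rewrite setI_eq0 disjoint_sym disjoints_subset setCK.
have := cardsC S'; rewrite card_ord cardY; have := card_matched_states.
have := card_matched_sources.
suff H : {in ~: S' :|: Y &, injective h} /\
    (forall i, i \in ~: S' :|: Y -> [/\ h i < 2 * n, valid_col (h i) & E (h i) i]).
  by move=> ? ? ? /(_ H.1 H.2); lia.
have caseX i : i \in ~: S' :|: Y -> i \notin S' \/ i \in Y.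
  by rewrite inE => /orP [|]; [rewrite inE; left|right].
split=> [i j /caseX [iS|/hY [r [rr gr ->]]] /caseX [jS|/hY [r' [rr' gr' ->]]]|i /caseX [iS|/hY [r [rr gr ->]]]].
- by rewrite !hS // => /val_inj; apply: injf; rewrite inE.
- by rewrite hS // => fE; have := ltn_ord (f i); lia.
- by rewrite hS // => fE; have := ltn_ord (f j); lia.
- by move=> /addnI /val_inj rE; rewrite -gr -gr' rE.
- have lt := ltn_ord (f i); rewrite hS //; split; first by lia.
    by rewrite /valid_col lt.
  by rewrite E_state Gf.
- have lt := ltn_ord r; split; first by lia.
    by rewrite /valid_col; apply/orP; right; apply/existsP; exists r; rewrite rr eqxx.
  by rewrite E_source rr -gr; have [_] := gP r rr.
Qed.

Lemma unmatched_reaching : reaching G (unmatched_rows :|: unmatched_sources).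
Proof.
apply/reachingP => x; have [r rr rx] := source_rep_exists G x.
have [mc0|mc0] := eqVneq (mc (n + r)) 0.
  by exists r => //; rewrite !inE rr mc0 eqxx orbT.
case mcE: (mc (n + r)) mc0 => [|i] // _; have ltr := ltn_ord r.
have [|iN Ei mrE] := matchE.1 _ _ _ mcE; first by lia.
have := E_source (Ordinal iN) r; rewrite /= Ei => /esym /andP [_ ir].
exists (Ordinal iN); last exact: connect_trans ir rx.
by rewrite !inE /= mrE ltnS leq_addr orbT.
Qed.

End Analysis.

(* Strong augmentation: [P] and [Q] are the inputs and outputs already chained into one
   cycle through [h]; an unchained input is fed by an unchained output, which is
   reached from a chained input or from an extra one. *)
Lemma hub_reaching_of_pairing n (G : 'M[bool]_n) (S Sx P : {set 'I_n}) (s : {perm 'I_n}) (h : 'I_n) :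
  reaching G (S :|: Sx) ->
  (forall v w, v \in S -> w \in S -> v \notin P -> w \notin P -> conn G v (s w) -> False) ->
  (P != set0 -> h \in P) -> P \subset S ->
  (forall W : {set 'I_n}, (forall i j, i \in W -> G j i -> j \in W) ->
     (forall i, i \in P -> i != h -> s i \in W -> i \in W) -> h \in P -> h \in W -> P \subset W) ->
  hub_reaching G S Sx s h.
Proof.
move=> /reachingP reach max hP PS chain W hW SxW clW clK.
suff SW : S \subset W.
  have /reachingP := reach; apply => //.
  by rewrite subUset SW SxW.
have PW : P \subset W.
  have [->|P0] := eqVneq P set0; first exact: sub0set.
  have hP' := hP P0; apply: chain => //; last by apply: hW; exact: (subsetP PS).
  by move=> i iP ih; apply: clK => //; exact: (subsetP PS).
apply/subsetP => v vS; have [vP|vP] := boolP (v \in P); first exact: (subsetP PW).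
have [vh|vh] := eqVneq v h; first by rewrite vh; apply: hW; rewrite -vh.
apply: clK => //; have [y + yw] := reach (s v).
rewrite inE => /orP [yS|/(subsetP SxW) yW]; last exact: conn_closed clW yw yW.
apply: (conn_closed clW yw); apply: (subsetP PW); apply: contraT => yP.
by case: (max y v yS vS yP vP yw).
Qed.

End Combinatorics.

(** * A language of bounded loops and its compilation *)

Section ForLanguage.
Local Open Scope nat_scope.

Inductive hexpr : Type :=
| HC of nat
| HN
| HV of nat
| HA of nat & hexpr
| HAdd of hexpr & hexpr
| HSub of hexpr & hexpr
| HRow of hexpr.

Inductive hcmd : Type :=
| HSkip
| HSet of nat & hexpr
| HPut of nat & hexpr & hexpr
| HSeq of hcmd & hcmd
| HIf of hexpr & hcmd & hcmd
| HFor of nat & nat & hcmd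
| HRead of nat & hexpr
| HWrite of hexpr & hexpr.

(* [hr] holds the scalars, [ha] the named arrays, [hm] the input and then the output. *)
Record hstate : Type := HState { hr : nat -> nat; ha : nat -> nat -> nat; hm : nat -> nat }.

Definition set_r s r v := HState (upd (hr s) r v) (ha s) (hm s).
Definition set_a s b k v :=
  HState (hr s) (fun b' => if b' == b then upd (ha s b) k v else ha s b') (hm s).
Definition set_m s a v := HState (hr s) (ha s) (upd (hm s) a v).

(* [HRow e] is the offset of row [e] in a row-major matrix with [n] columns; it is read
   from a table because the machine cannot multiply. *)
Fixpoint heval n s e : nat :=
  match e with
  | HC k => k
  | HN => n
  | HV r => hr s r
  | HA b e1 => ha s b (heval n s e1)
  | HAdd e1 e2 => heval n s e1 + heval n s e2
  | HSub e1 e2 => heval n s e1 - heval n s e2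
  | HRow e1 => let i := heval n s e1 in if i < 2 * n then i * n else 0
  end.

(** A loop leaves its counter at the bound, as the compiled [While] does. Reads and writes beyond
    the first [3 n^2] cells do nothing, since the arrays live there; this makes the simulation
    unconditional. *)
Fixpoint hrun n c s : hstate :=
  match c with
  | HSkip => s
  | HSet r e => set_r s r (heval n s e)
  | HPut b e1 e2 => set_a s b (heval n s e1) (heval n s e2)
  | HSeq c1 c2 => hrun n c2 (hrun n c1 s)
  | HIf e c1 c2 => if heval n s e != 0 then hrun n c1 s else hrun n c2 s
  | HFor r k c1 =>
      set_r (foldl (fun s' i => hrun n c1 (set_r s' r i)) s (iota 0 (k * n))) r (k * n)
  | HRead r e => if heval n s e < 3 * (n * n) then set_r s r (hm s (heval n s e)) else s
  | HWrite e1 e2 =>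
      if heval n s e1 < 3 * (n * n) then set_m s (heval n s e1) (heval n s e2) else s
  end.

Fixpoint assigns r c : bool :=
  match c with
  | HSet r' _ | HRead r' _ => r' == r
  | HSeq c1 c2 | HIf _ c1 c2 => assigns r c1 || assigns r c2
  | HFor r' _ c1 => (r' == r) || assigns r c1
  | _ => false
  end.

Fixpoint puts b c : bool :=
  match c with
  | HPut b' _ _ => b' == b
  | HSeq c1 c2 | HIf _ c1 c2 => puts b c1 || puts b c2
  | HFor _ _ c1 => puts b c1
  | _ => false
  end.

Fixpoint writes c : bool :=
  match c with
  | HWrite _ _ => true
  | HSeq c1 c2 | HIf _ c1 c2 => writes c1 || writes c2
  | HFor _ _ c1 => writes c1
  | _ => false
  end.

Lemma hrun_foldl_ind n c r (P : hstate -> Prop) l s :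
  (forall s' i, P s' -> P (hrun n c (set_r s' r i))) -> P s ->
  P (foldl (fun s' i => hrun n c (set_r s' r i)) s l).
Proof. by move=> Pc; elim: l s => //= i l IH s Ps; apply: IH; exact: Pc. Qed.

Lemma hr_frame n r c s : ~~ assigns r c -> hr (hrun n c s) r = hr s r.
Proof.
elim: c s => //=.
- by move=> r' e s; rewrite /upd eq_sym => /negbTE ->.
- by move=> c1 IH1 c2 IH2 s; rewrite negb_or => /andP [a1 a2]; rewrite IH2 // IH1.
- by move=> e c1 IH1 c2 IH2 s; rewrite negb_or => /andP [a1 a2]; case: ifP; rewrite ?IH1 ?IH2.
- move=> r' k c IH s; rewrite negb_or => /andP [rr' rc]; rewrite /upd eq_sym (negbTE rr').
  pose P s' := hr s' r = hr s r; apply: (hrun_foldl_ind (P := P)) => // s' i Ps'.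
  by rewrite /P IH //= /upd eq_sym (negbTE rr').
- by move=> r' e s rr'; case: ifP => //= _; rewrite /upd eq_sym (negbTE rr').
- by move=> e1 e2 s _; case: ifP.
Qed.

Lemma ha_frame n b c s : ~~ puts b c -> ha (hrun n c s) b = ha s b.
Proof.
elim: c s => //=.
- by move=> b' e1 e2 s; rewrite eq_sym => /negbTE ->.
- by move=> c1 IH1 c2 IH2 s; rewrite negb_or => /andP [a1 a2]; rewrite IH2 // IH1.
- by move=> e c1 IH1 c2 IH2 s; rewrite negb_or => /andP [a1 a2]; case: ifP; rewrite ?IH1 ?IH2.
- move=> r' k c IH s bc; pose P s' := ha s' b = ha s b.
  by apply: (hrun_foldl_ind (P := P)) => // s' i Ps'; rewrite /P IH.
- by move=> r' e s _; case: ifP.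
- by move=> e1 e2 s _; case: ifP.
Qed.

Lemma hm_frame n c s : ~~ writes c -> hm (hrun n c s) = hm s.
Proof.
elim: c s => //=.
- by move=> c1 IH1 c2 IH2 s; rewrite negb_or => /andP [a1 a2]; rewrite IH2 // IH1.
- by move=> e c1 IH1 c2 IH2 s; rewrite negb_or => /andP [a1 a2]; case: ifP; rewrite ?IH1 ?IH2.
- move=> r' k c IH s bc; pose P s' := hm s' = hm s.
  by apply: (hrun_foldl_ind (P := P)) => // s' i Ps'; rewrite /P IH.
- by move=> r' e s _; case: ifP.
Qed.

Lemma hfor_ind n r k c s (P : nat -> hstate -> Prop) :
  P 0 s -> (forall i s', i < k * n -> P i s' -> P i.+1 (hrun n c (set_r s' r i))) ->
  (forall s' v, P (k * n) s' -> P (k * n) (set_r s' r v)) ->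
  P (k * n) (hrun n (HFor r k c) s).
Proof.
move=> P0 Pc Pr /=; apply: Pr.
have H m i s' : i + m = k * n -> P i s' ->
    P (k * n) (foldl (fun s' i => hrun n c (set_r s' r i)) s' (iota i m)).
  elim: m i s' => [|m IH] i s' /=; first by rewrite addn0 => <-.
  by move=> im Pi; apply: IH; [lia|apply: Pc => //; lia].
exact: H.
Qed.

End ForLanguage.

Section Compilation.
Local Open Scope nat_scope.

Fixpoint wfe e : bool :=
  match e with
  | HA b e1 => (b < 15) && wfe e1
  | HAdd e1 e2 | HSub e1 e2 => wfe e1 && wfe e2
  | HRow e1 => wfe e1
  | _ => true
  end.

Fixpoint wfc c : bool :=
  match c with
  | HSkip => true
  | HSet _ e | HRead _ e => wfe e
  | HPut b e1 e2 => [&& b < 15, wfe e1 & wfe e2]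
  | HSeq c1 c2 => wfc c1 && wfc c2
  | HIf e c1 c2 => [&& wfe e, wfc c1 & wfc c2]
  | HFor r _ c1 => ~~ assigns r c1 && wfc c1
  | HWrite e1 e2 => wfe e1 && wfe e2
  end.

Fixpoint depth c : nat :=
  match c with
  | HSeq c1 c2 | HIf _ c1 c2 => maxn (depth c1) (depth c2)
  | HFor _ _ c1 => (depth c1).+1
  | _ => 0
  end.

Definition mul16 e := let d e := Add e e in d (d (d (d e))).

(* Register 0 holds n and register 1 the address 3 n^2, above which the row table
   (residue 0) and the arrays (residues 1 to 15) are interleaved modulo 16, so that
   no bound on the array sizes is needed. *)
Definition cell e b := Add (Reg 1) (Add (mul16 e) (Cst b)).

(** Scalars start at register 4: registers 0 and 1 keep [n] and [3 n^2], and 2 and 3 serve the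
    prologue. *)
Fixpoint comp_e e : expr :=
  match e with
  | HC k => Cst k
  | HN => Reg 0
  | HV r => Reg (r + 4)
  | HA b e1 => Defs.Mem (cell (comp_e e1) b.+1)
  | HAdd e1 e2 => Add (comp_e e1) (comp_e e2)
  | HSub e1 e2 => Defs.Sub (comp_e e1) (comp_e e2)
  | HRow e1 => Defs.Mem (cell (comp_e e1) 0)
  end.

Fixpoint times_n k : expr := if k is k'.+1 then Add (Reg 0) (times_n k') else Cst 0.

Definition loop r g p := While (Defs.Sub g (Reg r)) (Seq p (SetReg r (Add (Reg r) (Cst 1)))).

Fixpoint comp c : cmd :=
  match c with
  | HSkip => Skip
  | HSet r e => SetReg (r + 4) (comp_e e)
  | HPut b e1 e2 => SetMem (cell (comp_e e1) b.+1) (comp_e e2)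
  | HSeq c1 c2 => Seq (comp c1) (comp c2)
  | HIf e c1 c2 => If (comp_e e) (comp c1) (comp c2)
  | HFor r k c1 => Seq (SetReg (r + 4) (Cst 0)) (loop (r + 4) (times_n k) (comp c1))
  | HRead r e => If (Defs.Sub (Reg 1) (comp_e e)) (SetReg (r + 4) (Defs.Mem (comp_e e))) Skip
  | HWrite e1 e2 => If (Defs.Sub (Reg 1) (comp_e e1)) (SetMem (comp_e e1) (comp_e e2)) Skip
  end.

(** An upper bound that charges both branches of a conditional. Apart from the bound expression, 7
    pays for the test and the increment of a round, 3 for the final test. *)
Fixpoint hcost n c : nat :=
  match c with
  | HSkip => 1
  | HSet r e => (ecost (comp_e e)).+1
  | HPut b e1 e2 => (ecost (cell (comp_e e1) b.+1) + ecost (comp_e e2)).+1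
  | HSeq c1 c2 => hcost n c1 + hcost n c2
  | HIf e c1 c2 => (ecost (comp_e e)).+1 + (hcost n c1 + hcost n c2)
  | HFor r k c1 => 2 + ((k * n) * (hcost n c1 + ecost (times_n k) + 7) + (ecost (times_n k) + 3))
  | HRead r e => (ecost (comp_e e) + 3) + (ecost (comp_e e)).+2
  | HWrite e1 e2 => (ecost (comp_e e1) + 3) + (ecost (comp_e e1) + ecost (comp_e e2)).+1
  end.

Definition set_reg s r v := State (upd (regs s) r v) (Defs.mem s).

Lemma exec_loop r g p N C (P : nat -> state -> Prop) :
  (forall i s, P i s -> regs s r = i /\ Defs.eval s g = N) ->
  (forall i s, i < N -> P i s -> exists t s', [/\ exec p s t s', t <= C &
     P i.+1 (set_reg s' r (regs s' r).+1)]) ->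
  forall m i s, i + m = N -> P i s ->
  exists t s', [/\ exec (loop r g p) s t s',
     t <= m * (C + ecost g + 7) + (ecost g + 3) & P N s'].
Proof.
move=> Pr Pp; elim=> [|m IH] i s im Pi; have [ri gi] := Pr _ _ Pi.
  exists (ecost (Defs.Sub g (Reg r))).+1, s; split; first 1 last.
  - by rewrite /=; lia.
  - by rewrite -im addn0.
  by apply: ExecWhileFalse => /=; rewrite ri gi; lia.
have [|t1 [s1 [E1 t1C P1]]] := Pp i s _ Pi; first by lia.
have [|t2 [s2 [E2 t2C P2]]] := IH i.+1 _ _ P1; first by lia.
exists ((ecost (Defs.Sub g (Reg r))).+1 + (t1 + (ecost (Add (Reg r) (Cst 1))).+1) + t2), s2; split=> //.
  apply: ExecWhileTrue E2; first by rewrite /= ri gi; lia.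
  apply: ExecSeq E1 _; rewrite -[(regs s1 r).+1]addn1.
  exact: (ExecSetReg s1 r (Add (Reg r) (Cst 1))).
by rewrite /= mulSn; lia.
Qed.

Lemma eval_times_n s k : Defs.eval s (times_n k) = k * regs s 0.
Proof. by elim: k => [|k IH] //=; rewrite IH mulSn. Qed.

Lemma eval_cell s e b : Defs.eval s (cell e b) = regs s 1 + (16 * Defs.eval s e + b).
Proof. by rewrite /cell /mul16 /=; lia. Qed.

Definition sim n (s : state) (h : hstate) : Prop :=
  [/\ regs s 0 = n /\ regs s 1 = 3 * (n * n),
      forall r, regs s (r + 4) = hr h r,
      forall b k, b < 15 -> Defs.mem s (3 * (n * n) + (16 * k + b.+1)) = ha h b k,
      forall k, Defs.mem s (3 * (n * n) + 16 * k) = if k < 2 * n then k * n else 0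
    & forall a, a < 3 * (n * n) -> Defs.mem s a = hm h a].

Lemma sim_eval n s h e : sim n s h -> wfe e -> Defs.eval s (comp_e e) = heval n h e.
Proof.
move=> [[r0 r1] rr aa tt mm]; elim: e => //=.
- by move=> b e IH /andP [b15 /IH E]; rewrite E r1 -aa //; congr Defs.mem; lia.
- by move=> e1 IH1 e2 IH2 /andP [/IH1 -> /IH2 ->].
- by move=> e1 IH1 e2 IH2 /andP [/IH1 -> /IH2 ->].
- by move=> e IH /IH E; rewrite E r1 -tt; congr Defs.mem; lia.
Qed.

Lemma sim_set_r n s h r v : sim n s h -> sim n (set_reg s (r + 4) v) (set_r h r v).
Proof.
move=> [[r0 r1] rr aa tt mm]; split => //=; rewrite /upd.
  by split; rewrite ?r0 ?r1; case: eqP => //; lia.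
by move=> r'; rewrite eqn_add2r rr.
Qed.

Lemma sim_set_a n s h b k v : b < 15 -> sim n s h ->
  sim n (State (regs s) (upd (Defs.mem s) (3 * (n * n) + (16 * k + b.+1)) v)) (set_a h b k v).
Proof.
move=> b15 [[r0 r1] rr aa tt mm]; split => //=.
- move=> b' k' b15'; rewrite /upd; case: (eqVneq b' b) => [->|bb].
    have [->|kk] := eqVneq k' k; first by rewrite eqxx.
    by rewrite ifF ?aa //; apply/negbTE; lia.
  by rewrite ifF ?aa //; apply/negbTE; lia.
- by move=> k'; rewrite /upd ifF ?tt //; apply/negbTE; lia.
- by move=> a aB; rewrite /upd ifF ?mm //; apply/negbTE; lia.
Qed.

Lemma sim_set_m n s h a v : a < 3 * (n * n) -> sim n s h ->
  sim n (State (regs s) (upd (Defs.mem s) a v)) (set_m h a v).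
Proof.
move=> aB [[r0 r1] rr aa tt mm]; split => //=.
- by move=> b' k' b15'; rewrite /upd ifF ?aa //; apply/negbTE; lia.
- by move=> k'; rewrite /upd ifF ?tt //; apply/negbTE; lia.
- by move=> a' aB'; rewrite /upd mm.
Qed.

Lemma comp_correct n c s h : wfc c -> sim n s h ->
  exists t s', [/\ exec (comp c) s t s', t <= hcost n c & sim n s' (hrun n c h)].
Proof.
elim: c s h => /=.
- by move=> s h _ S; exists 1, s; split => //; exact: ExecSkip.
- move=> r e s h we S; eexists; eexists; split; [exact: ExecSetReg|by []|].
  by rewrite (sim_eval S we); exact: (sim_set_r r _ S).
- move=> b e1 e2 s h /and3P [b15 we1 we2] S; eexists; eexists; split.
  + exact: ExecSetMem.
  + by rewrite /=; lia.
  + rewrite eval_cell (sim_eval S we1) (sim_eval S we2); have [[_ ->] _ _ _ _] := S.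
    exact: sim_set_a.
- move=> c1 IH1 c2 IH2 s h /andP [w1 w2] S.
  have [t1 [s1 [E1 T1 S1]]] := IH1 s h w1 S; have [t2 [s2 [E2 T2 S2]]] := IH2 s1 _ w2 S1.
  by exists (t1 + t2), s2; split => //; [exact: ExecSeq E1 E2|exact: leq_add].
- move=> e c1 IH1 c2 IH2 s h /and3P [we w1 w2] S.
  have [t1 [s1 [E1 T1 S1]]] := IH1 s h w1 S; have [t2 [s2 [E2 T2 S2]]] := IH2 s _ w2 S.
  have [e0|e0] := eqVneq (heval n h e) 0.
    eexists; eexists; split; [apply: ExecIfFalse E2|lia|exact: S2].
    by rewrite (sim_eval S we).
  eexists; eexists; split; [apply: ExecIfTrue E1|lia|exact: S1].
  by rewrite (sim_eval S we).
- move=> r k c IH s h /andP [rc wc] S.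
  pose P i s' := exists2 h', sim n s' (set_r h' r i) &
    h' = foldl (fun s' i => hrun n c (set_r s' r i)) h (iota 0 i).
  have [||||t [s' [E T [h' S' hE]]]] := @exec_loop (r + 4) (times_n k) (comp c) (k * n) (hcost n c) P
      _ _ (k * n) 0 (set_reg s (r + 4) 0).
  + move=> i s1 [h1 [[r0 _] rr _ _ _] _]; split; last by rewrite eval_times_n r0.
    by rewrite rr /= /upd eqxx.
  + move=> i s1 _ [h1 S1 h1E]; have [t [s2 [E T S2]]] := IH _ _ wc S1.
    exists t, s2; split => //; exists (hrun n c (set_r h1 r i)).
      have -> : regs s2 (r + 4) = i.
        by have [_ -> _ _ _] := S2; rewrite hr_frame //= /upd eqxx.
      exact: sim_set_r.
    by rewrite -[i.+1]addn1 iotaD foldl_cat -h1E.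
  + by [].
  + by exists h => //; exact: sim_set_r.
  exists (2 + t), s'; split; [|by rewrite leq_add2l|by rewrite -hE].
  by apply: ExecSeq E; exact: (ExecSetReg s (r + 4) (Cst 0)).
- move=> r e s h we S; have E := sim_eval S we; have [[_ r1] _ _ _ mm] := S.
  case: ifP => lt.
    eexists; eexists; split; [apply: ExecIfTrue (ExecSetReg _ _ _)|rewrite /=; lia|].
      by rewrite /= r1 E; lia.
    by rewrite /= E mm //; exact: (sim_set_r r _ S).
  eexists; eexists; split; [apply: ExecIfFalse (ExecSkip _)|rewrite /=; lia|exact: S].
  by rewrite /= r1 E; lia.
- move=> e1 e2 s h /andP [we1 we2] S; have E1 := sim_eval S we1; have E2 := sim_eval S we2.
  have [[_ r1] _ _ _ mm] := S.
  case: ifP => lt.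
    eexists; eexists; split; [apply: ExecIfTrue (ExecSetMem _ _ _)|rewrite /=; lia|].
      by rewrite /= r1 E1; lia.
    by rewrite /= E1 E2; exact: sim_set_m.
  eexists; eexists; split; [apply: ExecIfFalse (ExecSkip _)|rewrite /=; lia|exact: S].
  by rewrite /= r1 E1; lia.
Qed.

(** Powers of [n.+1] absorb constant costs even for [n = 0]. *)
Lemma hcost_poly c : exists K, forall n, hcost n c <= K * n.+1 ^ depth c.
Proof.
have join c1 c2 K1 K2 n : hcost n c1 <= K1 * n.+1 ^ depth c1 -> hcost n c2 <= K2 * n.+1 ^ depth c2 ->
    hcost n c1 + hcost n c2 <= (K1 + K2) * n.+1 ^ maxn (depth c1) (depth c2).
  move=> H1 H2; rewrite mulnDl; apply: leq_add.
    by apply: leq_trans H1 _; rewrite leq_mul2l leq_pexp2l ?leq_maxl ?orbT.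
  by apply: leq_trans H2 _; rewrite leq_mul2l leq_pexp2l ?leq_maxr ?orbT.
elim: c => /=; try by move=> *; eexists => n; rewrite expn0 muln1; exact: leqnn.
- by move=> c1 [K1 H1] c2 [K2 H2]; exists (K1 + K2) => n; exact: join.
- move=> e c1 [K1 H1] c2 [K2 H2]; exists ((ecost (comp_e e)).+1 + (K1 + K2)) => n.
  by rewrite mulnDl leq_add ?join // leq_pmulr // expn_gt0.
- move=> r k c [K H]; exists (2 + (k * (K + ecost (times_n k) + 7) + (ecost (times_n k) + 3))) => n.
  have Hn := H n; set E := ecost _; have p0 : 0 < n.+1 ^ depth c by rewrite expn_gt0.
  rewrite expnS; set q := n.+1 ^ _ in Hn p0 *.
  apply: (@leq_trans (2 * (n.+1 * q) + (k * n * ((K + E + 7) * q) + (E + 3) * (n.+1 * q)))).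
    apply: leq_add; first by nia.
    apply: leq_add; last by nia.
    rewrite leq_mul2l; apply/orP; right; rewrite !mulnDl.
    by apply: leq_add; [apply: leq_add|]; rewrite ?Hn // leq_pmulr.
  rewrite (mulnDl 2) leq_add2l (mulnDl (k * _)) leq_add2r mulnACA.
  by rewrite leq_mul2l leq_mul2r leqnSn !orbT.
Qed.

(** Products are accumulated: [3 n^2] as [n] times [3 n], and the row offsets as running multiples
    of [n] in register 3. The table has [2 n] entries because the bipartite graph has [2 n] columns,
    each stored as a block of [n] cells. *)
Definition prologue :=
  Seq (loop 2 (times_n 1) (SetReg 1 (Add (Reg 1) (times_n 3))))
 (Seq (SetReg 2 (Cst 0))
      (loop 2 (times_n 2) (Seq (SetMem (cell (Reg 2) 0) (Reg 3)) (SetReg 3 (Add (Reg 3) (Reg 0)))))).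

Definition hinit n (A : 'M[bool]_n) : hstate :=
  HState (fun=> 0) (fun _ _ => 0) (Defs.mem (input_state A)).

Lemma input_state_out n (A : 'M[bool]_n) a : n * n <= a -> Defs.mem (input_state A) a = 0.
Proof.
move=> na; rewrite /=; apply/eqP; rewrite eqb0; apply/existsP => -[i /existsP [j /andP [/eqP aE _]]].
by have := ltn_ord i; have := ltn_ord j; nia.
Qed.

Lemma prologue_correct : exists K, forall n (A : 'M[bool]_n), exists t s,
  [/\ exec prologue (input_state A) t s, t <= K * n.+1 & sim n s (hinit A)].
Proof.
exists 200 => n A; set s0 := input_state A.
pose P1 i s := [/\ Defs.mem s = Defs.mem s0, regs s 0 = n, regs s 1 = i * (3 * n), regs s 2 = i
  & forall r, 2 < r -> regs s r = 0].
have [||||t1 [s1 [E1 T1 [s1E r0 r1 _ rr]]]] := @exec_loop 2 (times_n 1) (SetReg 1 (Add (Reg 1) (times_n 3)))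
  n 12 P1 _ _ n 0 s0.
- by move=> i s [_ r0 _ r2 _]; rewrite eval_times_n r0 mul1n.
- move=> i s _ [sE r0 r1 r2 rr]; eexists; eexists; split; [exact: ExecSetReg|by []|].
  split => //=; rewrite /upd /= ?r0 ?r1 ?r2 //; first by rewrite mulSn; lia.
  by move=> r r3; rewrite rr // !ifF //; apply/negbTE; lia.
- by rewrite add0n.
- by split => //= r; case: r => // -[|[]].
pose P2 i s := [/\ regs s 0 = n /\ regs s 1 = 3 * (n * n), regs s 2 = i, regs s 3 = i * n
  & (forall r, 3 < r -> regs s r = 0) /\ forall a, Defs.mem s a =
  if a < 3 * (n * n) then Defs.mem s0 a else
  if (a - 3 * (n * n)) %% 16 == 0 then
    (if (a - 3 * (n * n)) %/ 16 < i then (a - 3 * (n * n)) %/ 16 * n else 0) else 0].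
have [||||t2 [s2 [E2 T2 [[r0' r1'] _ _ [rr' mm]]]]] := @exec_loop 2 (times_n 2)
  (Seq (SetMem (cell (Reg 2) 0) (Reg 3)) (SetReg 3 (Add (Reg 3) (Reg 0)))) (2 * n) 50
  P2 _ _ (2 * n) 0 (set_reg s1 2 0).
- by move=> i s [[r0' _] r2 _ _]; rewrite eval_times_n r0'.
- move=> i s _ [[r0' r1'] r2 r3 [rr' mm]]; eexists; eexists; split.
  + by apply: ExecSeq; [exact: ExecSetMem|exact: ExecSetReg].
  + by [].
  + split; rewrite /= /upd /= ?r0' ?r1' ?r2 ?r3 //; first by rewrite mulSn addnC.
    split=> [r r4|a]; first by rewrite rr' // !ifF //; apply/negbTE; lia.
    rewrite mm; have -> : 3 * (n * n) + (i + i + (i + i) + (i + i + (i + i)) +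
      (i + i + (i + i) + (i + i + (i + i))) + 0) = 3 * (n * n) + 16 * i by lia.
    set B := 3 * _; have [->|aE] := eqVneq a (B + 16 * i).
      by rewrite ltnNge leq_addr addKn (mulnC 16) modnMl mulnK //= ltnSn.
    case: ltnP => // Ba; case: eqP => // mod0.
    have -> : ((a - B) %/ 16 < i.+1) = ((a - B) %/ 16 < i) by have := divn_eq (a - B) 16; lia.
    by [].
- by rewrite add0n.
- split; rewrite /= /upd /= ?(rr 3) //; first by rewrite r0 r1 mulnCA.
  split=> [r r4|a]; first by rewrite ifF ?rr //; [lia|apply/negbTE; lia].
  rewrite s1E; case: ifP => // aB; rewrite input_state_out; last by lia.
  by case: ifP.
exists (t1 + (2 + t2)), s2; split.
- by apply: ExecSeq E1 _; apply: ExecSeq E2; exact: (ExecSetReg s1 2 (Cst 0)).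
- by move: T1 T2; rewrite /=; lia.
split => //.
- by move=> r; rewrite rr' //= addnC.
- move=> b k b15 /=; rewrite mm; case: ifP => [|_]; first by lia.
  by case: ifP => //; lia.
- move=> k; rewrite mm; case: ifP => [|_]; first by lia.
  by rewrite addKn (mulnC 16) modnMl mulnK.
- by move=> a aB; rewrite mm aB.
Qed.

Lemma compile_cubic c (post : forall n, 'M[bool]_n -> state -> Prop) :
  wfc c -> depth c <= 3 ->
  (forall n (A : 'M[bool]_n) s,
     (forall a, a < 3 * (n * n) -> Defs.mem s a = hm (hrun n c (hinit A)) a) -> post n A s) ->
  computes_in_cubic_time (Seq prologue (comp c)) post.
Proof.
move=> wc d3 Hpost; have [K1 H1] := prologue_correct; have [K2 H2] := hcost_poly c.
exists (8 * (K1 + K2)), 1 => n A.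
have [t1 [s1 [E1 T1 S1]]] := H1 n A; have [t2 [s2 [E2 T2 S2]]] := comp_correct wc S1.
exists (t1 + t2), s2; split; first exact: ExecSeq E1 E2.
  by apply: Hpost => a aB; have [_ _ _ _ ->] := S2.
move=> n1; have n8 : n.+1 ^ 3 <= 8 * n ^ 3.
  by rewrite -[8]/(2 ^ 3) -expnMn leq_exp2r //; lia.
apply: (@leq_trans ((K1 + K2) * n.+1 ^ 3)); last by nia.
rewrite mulnDl leq_add //.
  by apply: leq_trans T1 _; rewrite leq_mul2l -{1}[n.+1]expn1 leq_pexp2l ?orbT.
apply: leq_trans T2 _; apply: leq_trans (H2 n) _.
by rewrite leq_mul2l leq_pexp2l ?orbT.
Qed.

End Compilation.

(** * Invariants and frame conditions for loops *)

Section LoopRules.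
Local Open Scope nat_scope.

Definition kept (rs : seq nat) c s s' :=
  [/\ forall b, ~~ puts b c -> ha s' b = ha s b,
      forall q, q \notin rs -> ~~ assigns q c -> hr s' q = hr s q
    & ~~ writes c -> hm s' = hm s].

Lemma kept_refl rs c s : kept rs c s s. Proof. by []. Qed.

Lemma kept_run n rs c s s' : kept rs c s s' -> kept rs c s (hrun n c s').
Proof.
move=> [ka kr km]; split.
- by move=> b bc; rewrite ha_frame // ka.
- by move=> q qr qc; rewrite hr_frame // kr.
- by move=> wc; rewrite hm_frame // km.
Qed.

Lemma kept_set rs c s s' r v : r \in rs -> kept rs c s s' -> kept rs c s (set_r s' r v).
Proof.
move=> rr [ka kr km]; split => // q qr qc /=; rewrite /upd.
by rewrite ifF ?kr //; apply: contraNF qr => /eqP ->.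
Qed.

Lemma hfor_inv n r k c s (P : nat -> hstate -> Prop) :
  ~~ assigns r c -> (forall i s' v, P i s' -> P i (set_r s' r v)) -> P 0 s ->
  (forall i s', i < k * n -> hr s' r = i -> kept [:: r] c s s' -> P i s' -> P i.+1 (hrun n c s')) ->
  P (k * n) (hrun n (HFor r k c) s).
Proof.
move=> rc Pset P0 Pc.
suff: kept [:: r] c s (hrun n (HFor r k c) s) /\ P (k * n) (hrun n (HFor r k c) s) by case.
have r1 : r \in [:: r] by rewrite inE.
apply: (hfor_ind (P := fun i s' => kept [:: r] c s s' /\ P i s')).
- by split => //; exact: kept_refl.
- move=> i s' ik [ks Ps]; split; first by apply: kept_run; exact: kept_set.
  apply: Pc => //; [by rewrite /= /upd eqxx|exact: kept_set|exact: Pset].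
- by move=> s' v [ks Ps]; split; [exact: kept_set|exact: Pset].
Qed.

Definition reg_free (get : hstate -> nat -> nat) :=
  forall s r v, get (set_r s r v) = get s.

Lemma fill1 n r k c s (get : hstate -> nat -> nat) (F : nat -> nat) :
  reg_free get -> ~~ assigns r c ->
  (forall i s', i < k * n -> hr s' r = i -> kept [:: r] c s s' ->
     (forall a, get s' a = if a < i then F a else get s a) ->
     forall a, get (hrun n c s') a = if a == i then F i else get s' a) ->
  forall a, get (hrun n (HFor r k c) s) a = if a < k * n then F a else get s a.
Proof.
move=> gr rc body.
apply: (@hfor_inv n r k c s (fun i s' => forall a, get s' a = if a < i then F a else get s a)) => //.
- by move=> i s' v; rewrite gr.
- move=> i s' ik ri ks H a; rewrite (body i s' ik ri ks H) H.
  have -> : (a < i.+1) = (a == i) || (a < i) by rewrite ltnS leq_eqVlt.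
  by case: eqVneq => [->|].
Qed.

Lemma rowmajor_inj n i j i' j' : j < n -> j' < n ->
  (i * n + j == i' * n + j') = (i == i') && (j == j').
Proof.
move=> jn jn'; apply/eqP/andP => [e|[/eqP -> /eqP ->]//].
have n0 : 0 < n by lia.
have : (i * n + j) %/ n = (i' * n + j') %/ n by rewrite e.
rewrite !divnMDl // !divn_small // !addn0 => ii; split; first by rewrite ii.
by move: e; rewrite ii => /addnI ->.
Qed.

(** The body may rely on the exact mixture of new and old cells at its turn, as updates in place
    such as Warshall's require. *)
Lemma fill2 n ri rj c s (get : hstate -> nat -> nat) off (F : nat -> nat -> nat) :
  reg_free get -> ~~ assigns ri c -> ~~ assigns rj c -> ri != rj ->
  (forall i j s', i < n -> j < n -> hr s' ri = i -> hr s' rj = j -> kept [:: ri; rj] c s s' ->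
     (forall i' j', i' < n -> j' < n -> get s' (off + (i' * n + j')) =
        if (i' < i) || (i' == i) && (j' < j) then F i' j' else get s (off + (i' * n + j'))) ->
     forall a, get (hrun n c s') a = if a == off + (i * n + j) then F i j else get s' a) ->
  let s1 := hrun n (HFor ri 1 (HFor rj 1 c)) s in
  (forall i j, i < n -> j < n -> get s1 (off + (i * n + j)) = F i j) /\
  (forall a, (a < off) || (off + n * n <= a) -> get s1 a = get s a).
Proof.
move=> gr ric rjc rij body s1.
pose P i j s' := (forall i' j', i' < n -> j' < n -> get s' (off + (i' * n + j')) =
   if (i' < i) || (i' == i) && (j' < j) then F i' j' else get s (off + (i' * n + j'))) /\
   (forall a, (a < off) || (off + n * n <= a) -> get s' a = get s a).
suff [H1 H2] : P n 0 s1.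
  by split => // i j iN jN; rewrite H1 // iN.
have := @hfor_inv n ri 1 (HFor rj 1 c) s (fun i s' => P i 0 s'); rewrite mul1n; apply.
- by rewrite /= negb_or eq_sym rij.
- by move=> i s' v; rewrite /P !gr.
- by split => // i' j' _ _; rewrite ltn0 andbF.
move=> i s' iN ri' [ka kr km] [H1 H2].
suff [H1' H2'] : P i n (hrun n (HFor rj 1 c) s').
  split => // i' j' iN' jN'; rewrite H1' // jN' andbT ltn0 andbF orbF.
  by rewrite orbC -leq_eqVlt.
have := @hfor_inv n rj 1 c s' (fun j s2 => hr s2 ri = i /\ P i j s2); rewrite mul1n => H.
have [] // : hr (hrun n (HFor rj 1 c) s') ri = i /\ P i n (hrun n (HFor rj 1 c) s').
apply: H => //.
- by move=> j s2 v [Hr HP]; rewrite /P !gr /= /upd (negbTE rij).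
move=> j s2 jN rj' [ka2 kr2 km2] [ri2 [H12 H22]].
split; first by rewrite hr_frame.
have B : forall a, get (hrun n c s2) a = if a == off + (i * n + j) then F i j else get s2 a.
  apply: body => //; split.
  - by move=> b bc; rewrite ka2 // ka.
  - move=> q; rewrite !inE negb_or => /andP [qi qj] qc; rewrite kr2 ?inE // kr ?inE //=.
    by rewrite negb_or eq_sym qj.
  - by move=> wc; rewrite km2 // km.
split=> [i' j' iN' jN'|a aout].
  rewrite B eqn_add2l rowmajor_inj // H12 //; case: eqVneq => [->|ii] /=; last by rewrite orbF.
  by rewrite ltnn /= ltnS; case: (ltngtP j' j) => // ->.
rewrite B H22 // ifF //; apply: contraTF aout => /eqP ->.
by rewrite negb_or -leqNgt leq_addr /= -ltnNge ltn_add2l; nia.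
Qed.

End LoopRules.

(** * Programs for matchings and reachability *)

Section ReachabilityPrograms.
Local Open Scope nat_scope.

Lemma hrun_seq n c1 c2 s : hrun n (HSeq c1 c2) s = hrun n c2 (hrun n c1 s).
Proof. by []. Qed.

Definition at2 b e1 e2 := HA b (HAdd (HRow e1) e2).
Definition put2 b e1 e2 e3 := HPut b (HAdd (HRow e1) e2) e3.
Definition HWhen e c := HIf e c HSkip.
Definition HUnless e c := HIf e HSkip c.

(* Arrays: 0 bipartite graph, one block of rows per column; 1 reachability; 7 representatives
   of the source components. *)
Definition load (tr : bool) :=
  HFor 0 1 (HFor 1 1 (HSeq
    (HRead 12 (if tr then HAdd (HRow (HV 1)) (HV 0) else HAdd (HRow (HV 0)) (HV 1)))
    (put2 0 (HV 0) (HV 1) (HV 12)))).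

Definition init_reach :=
  HFor 0 1 (HFor 1 1
    (HIf (HAdd (HSub (HV 0) (HV 1)) (HSub (HV 1) (HV 0)))
      (put2 1 (HV 0) (HV 1) (at2 0 (HV 0) (HV 1)))
      (put2 1 (HV 0) (HV 1) (HC 1)))).

Definition warshall_step :=
  HFor 0 1 (HFor 1 1
    (HWhen (at2 1 (HV 0) (HV 2)) (HWhen (at2 1 (HV 2) (HV 1)) (put2 1 (HV 0) (HV 1) (HC 1))))).

Definition find_sources :=
  HFor 0 1 (HSeq (HPut 7 (HV 0) (HC 1))
    (HFor 1 1 (HWhen (at2 1 (HV 1) (HV 0))
      (HIf (at2 1 (HV 0) (HV 1))
         (HWhen (HSub (HV 0) (HV 1)) (HPut 7 (HV 0) (HC 0)))
         (HPut 7 (HV 0) (HC 0)))))).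

Definition add_sources :=
  HFor 0 1 (HFor 1 1
    (HIf (HA 7 (HV 0)) (put2 0 (HAdd HN (HV 0)) (HV 1) (at2 1 (HV 1) (HV 0)))
                       (put2 0 (HAdd HN (HV 0)) (HV 1) (HC 0)))).

Definition reach_cmd :=
  HSeq init_reach (HSeq (HFor 2 1 warshall_step) (HSeq find_sources add_sources)).

Lemma reg_free_ha b : reg_free (fun s => ha s b). Proof. by []. Qed.
Lemma reg_free_hm : reg_free hm. Proof. by []. Qed.

Lemma lt2n i n : i < n -> i < 2 * n. Proof. lia. Qed.

Lemma load_spec n tr s : forall i j, i < n -> j < n ->
  ha (hrun n (load tr) s) 0 (i * n + j) = hm s (if tr then j * n + i else i * n + j).
Proof.
rewrite /load; set c := HSeq _ _.
have [||||H _] := @fill2 n 0 1 c s (fun s => ha s 0) 0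
  (fun i j => hm s (if tr then j * n + i else i * n + j)) (reg_free_ha 0).
- by [].
- by [].
- by [].
- move=> i j s' iN jN ri rj [_ _ /(_ isT) km] _ a.
  have lt : (if tr then j * n + i else i * n + j) < 3 * (n * n) by case: (tr); nia.
  have E : heval n s' (if tr then HAdd (HRow (HV 1)) (HV 0) else HAdd (HRow (HV 0)) (HV 1)) =
    (if tr then j * n + i else i * n + j) by case: (tr) => /=; rewrite ri rj lt2n.
  rewrite /= E lt /= /upd /= ri rj lt2n // km.
  by case: eqP.
by move=> i j iN jN; have := H i j iN jN; rewrite add0n.
Qed.

Lemma init_reach_spec n s : forall i j, i < n -> j < n ->
  ha (hrun n init_reach s) 1 (i * n + j) = if i == j then 1 else ha s 0 (i * n + j).
Proof.
rewrite /init_reach; set c := HIf _ _ _.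
have [||||H _] := @fill2 n 0 1 c s (fun s => ha s 1) 0
  (fun i j => if i == j then 1 else ha s 0 (i * n + j)) (reg_free_ha 1).
- by [].
- by [].
- by [].
- move=> i j s' iN jN ri rj [/(_ 0 isT) ka _ _] _ a.
  rewrite /= ri rj lt2n // ka; case: (eqVneq i j) => [->|ij].
    by rewrite subnn /= /upd.
  rewrite ifT; last by apply/eqP; move/eqP: ij; lia.
  by [].
by move=> i j iN jN; have := H i j iN jN; rewrite add0n.
Qed.

Lemma warshall_step_spec n k s : k < n -> hr s 2 = k -> forall i j, i < n -> j < n ->
  ha (hrun n warshall_step s) 1 (i * n + j) =
  if (ha s 1 (i * n + k) != 0) && (ha s 1 (k * n + j) != 0) then 1 else ha s 1 (i * n + j).
Proof.
move=> kn rk; pose R i j := ha s 1 (i * n + j).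
rewrite /warshall_step; set c := HWhen (at2 1 (HV 0) _) _.
have [||||H _] := @fill2 n 0 1 c s (fun s => ha s 1) 0
  (fun i j => if (R i k != 0) && (R k j != 0) then 1 else R i j) (reg_free_ha 1).
- by [].
- by [].
- by [].
- move=> i j s' iN jN ri rj [_ /(_ 2 isT isT) kr _] H a; rewrite rk in kr.
  rewrite /= ri rj kr !lt2n //; have Hik := H i k iN kn; have Hkj := H k j kn jN.
  have Hij := H i j iN jN; rewrite !add0n in Hik Hkj Hij *.
  rewrite ltnn eqxx /= ltnn -/(R _ _) in Hij.
  (* Step [k] does not change which entries of row [k] and column [k] are nonzero, so updating in
     place is harmless. *)
  have Eik : (ha s' 1 (i * n + k) != 0) = (R i k != 0).
    rewrite Hik; case: ifP => // _; rewrite -/(R i k).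
    by case: (R i k) => //= ?; case: (R k k).
  have Ekj : (ha s' 1 (k * n + j) != 0) = (R k j != 0).
    rewrite Hkj; case: ifP => // _; rewrite -/(R k j).
    by case: (R k j) => //= [|?]; [rewrite andbF|case: (R k k)].
  rewrite Eik Ekj.
  by case: (R i k != 0); case: (R k j != 0); rewrite //= ?add0n; case: eqP => // ->; rewrite Hij.
by move=> i j iN jN; have := H i j iN jN; rewrite add0n.
Qed.

(** The invariant is transitivity through intermediate vertices below [k], not a statement about
    paths; for [k = n] completeness follows by induction on a path. *)
Lemma warshall_spec n (G : 'M[bool]_n) s :
  (forall i j : 'I_n, (ha s 1 (i * n + j) != 0) = (i == j) || G j i) ->
  forall i j : 'I_n, (ha (hrun n (HFor 2 1 warshall_step) s) 1 (i * n + j) != 0) = conn G i j.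
Proof.
move=> R0.
pose P k s' := [/\ forall i j : 'I_n, ha s' 1 (i * n + j) != 0 -> conn G i j,
  forall i j : 'I_n, (i == j) || G j i -> ha s' 1 (i * n + j) != 0
  & forall k' i j : 'I_n, k' < k -> ha s' 1 (i * n + k') != 0 -> ha s' 1 (k' * n + j) != 0 ->
    ha s' 1 (i * n + j) != 0].
have [|//||k s' kn rk _ [H1 H2 H3]|H1 H2 H3] := @hfor_inv n 2 1 warshall_step s P.
- by [].
- split=> [i j|i j|//]; rewrite R0 //.
  by case/orP => [/eqP ->|Gji]; [exact: connect0|exact: connect1].
- rewrite mul1n in kn; have E i j := warshall_step_spec kn rk (ltn_ord i) (ltn_ord j).
  pose kk := Ordinal kn; have [E1 E2] : (forall i j : 'I_n, ha (hrun n warshall_step s') 1 (i * n + j) != 0 ->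
      ha s' 1 (i * n + j) != 0 \/ (ha s' 1 (i * n + kk) != 0 /\ ha s' 1 (kk * n + j) != 0)) /\
    (forall i j : 'I_n, ha s' 1 (i * n + j) != 0 \/ (ha s' 1 (i * n + kk) != 0 /\ ha s' 1 (kk * n + j) != 0) ->
      ha (hrun n warshall_step s') 1 (i * n + j) != 0).
    split=> i j; rewrite E -/(nat_of_ord kk).
      by case: ifP => [/andP [? ?] _|_]; [right|left].
    by case=> [Rij|[-> ->]//]; case: ifP.
  split=> [i j /E1 [/H1 //|[/H1 c1 /H1 c2]]|i j ij|k' i j]; first exact: connect_trans c1 c2.
    by apply: E2; left; exact: H2.
  rewrite ltnS leq_eqVlt => /orP [/eqP k'k|k'k].
    have -> : k' = kk by exact: val_inj.
    by move=> /E1 [a1|[a1 a2]] /E1 [b1|[b1 b2]]; apply: E2; right.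
  move=> /E1 [a1|[a1 a2]] /E1 [b1|[b1 b2]]; apply: E2.
  - by left; exact: H3 a1 b1.
  - by right; split => //; exact: H3 a1 b1.
  - by right; split => //; exact: H3 a2 b1.
  - by right.
move=> i j; apply/idP/idP; first exact: H1.
case/connectP => p + ->; elim: p i => [|z p IH] i /=; first by move=> _; apply: H2; rewrite eqxx.
case/andP => Gzi /IH Rz; apply: H3 Rz; first by rewrite mul1n.
by apply: H2; rewrite Gzi orbT.
Qed.

Lemma find_sources_spec n (G : 'M[bool]_n) s :
  (forall i j : 'I_n, (ha s 1 (i * n + j) != 0) = conn G i j) ->
  forall r : 'I_n, ha (hrun n find_sources s) 7 r = source_rep G r.
Proof.
move=> R; pose cond i j := (ha s 1 (j * n + i) != 0) ==> (ha s 1 (i * n + j) != 0) && (i <= j).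
rewrite /find_sources; set c1 := HWhen _ _; set c := HSeq _ _ => r.
rewrite (@fill1 n 0 1 c s (fun s => ha s 7) (fun i => all (cond i) (iota 0 n))) //.
  rewrite mul1n ltn_ord; congr nat_of_bool; apply/allP/forallP => H j.
    by have := H j; rewrite mem_iota ltn_ord /cond !R => /(_ isT).
  rewrite mem_iota /= add0n => jn; have := H (Ordinal jn); rewrite /cond -!R.
  by [].
move=> i s' iN ri [ka _ _] _ a; rewrite mul1n in iN.
rewrite /c hrun_seq [hrun n (HPut _ _ _) _]/= ri; set s0 := set_a s' 7 i 1.
pose P j s2 := hr s2 0 = i /\ forall a, ha s2 7 a = if a == i then (all (cond i) (iota 0 j) : nat) else ha s' 7 a.
have [|||j s2 jn rj [ka2 kr2 _] [r0 H]|_ H] := @hfor_inv n 1 1 c1 s0 P.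
- by [].
- by [].
- by split => //= b; rewrite /upd.
- rewrite mul1n in jn; split; first by rewrite hr_frame.
  have Rn b : ha s2 1 b = ha s 1 b by rewrite ka2 //= ka.
  move=> b; have -> : all (cond i) (iota 0 j.+1) = all (cond i) (iota 0 j) && cond i j.
    by rewrite -addn1 iotaD all_cat /= andbT.
  rewrite /= r0 rj !lt2n // !Rn /cond.
  case: (ha s 1 (j * n + i) != 0); last by rewrite /= andbT.
  case: (ha s 1 (i * n + j) != 0); last by rewrite /= /upd ?r0 ?H; case: eqP => _; rewrite ?andbF.
  rewrite /= subn_eq0; case: (i <= j); first by rewrite /= andbT.
  by rewrite /= /upd ?r0 ?H; case: eqP => _; rewrite ?andbF.
by rewrite H mul1n.
Qed.

Lemma add_sources_spec n s : forall r i, r < n -> i < n ->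
  ha (hrun n add_sources s) 0 ((n + r) * n + i) =
  if ha s 7 r != 0 then ha s 1 (i * n + r) else 0.
Proof.
rewrite /add_sources; set c := HIf _ _ _.
have [||||H _] := @fill2 n 0 1 c s (fun s => ha s 0) (n * n)
  (fun r i => if ha s 7 r != 0 then ha s 1 (i * n + r) else 0) (reg_free_ha 0).
- by [].
- by [].
- by [].
- move=> r i s' rN iN r0 r1 [ka _ _] _ a; have k7 := ka 7 isT; have k1 := ka 1 isT.
  have nr : n + r < 2 * n by lia.
  rewrite /= r0 r1 k7 k1 nr !lt2n //.
  by case: (ha s 7 r != 0); rewrite /= /upd mulnDl addnA; case: eqP.
by move=> r i rN iN; rewrite -H // mulnDl addnA.
Qed.

Lemma add_sources_below n s a : a < n * n -> ha (hrun n add_sources s) 0 a = ha s 0 a.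
Proof.
rewrite /add_sources; set c := HIf _ _ _.
have [||||_ H] := @fill2 n 0 1 c s (fun s => ha s 0) (n * n)
  (fun r i => if ha s 7 r != 0 then ha s 1 (i * n + r) else 0) (reg_free_ha 0).
- by [].
- by [].
- by [].
- move=> r i s' rN iN r0 r1 [ka _ _] _ b; have k7 := ka 7 isT; have k1 := ka 1 isT.
  have nr : n + r < 2 * n by lia.
  rewrite /= r0 r1 k7 k1 nr !lt2n //.
  by case: (ha s 7 r != 0); rewrite /= /upd mulnDl addnA; case: eqP.
by move=> an; rewrite H // an.
Qed.

Lemma reach_cmd_spec n (G : 'M[bool]_n) s :
  (forall i c : 'I_n, ha s 0 (c * n + i) = G i c) ->
  let s1 := hrun n reach_cmd s in
  [/\ forall i c : 'I_n, (ha s1 0 (c * n + i) != 0) = G i c,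
      forall i r : 'I_n, (ha s1 0 ((n + r) * n + i) != 0) = source_rep G r && conn G i r,
      forall i j : 'I_n, (ha s1 1 (i * n + j) != 0) = conn G i j
    & forall r : 'I_n, ha s1 7 r = source_rep G r].
Proof.
move=> HE s1; pose sa := hrun n init_reach s; pose sb := hrun n (HFor 2 1 warshall_step) sa.
pose sc := hrun n find_sources sb.
have Rb : forall i j : 'I_n, (ha sb 1 (i * n + j) != 0) = conn G i j.
  apply: warshall_spec => i j; rewrite /sa init_reach_spec //.
  by case: (eqVneq i j) => [->|ij]; rewrite ?eqxx // HE ifN // eqb0 negbK.
have OKc := find_sources_spec Rb.
have s1E : s1 = hrun n add_sources sc by [].
have Rc i : ha sc 1 i = ha sb 1 i by rewrite /sc ha_frame.
have E0 a : ha sc 0 a = ha s 0 a by rewrite /sc ha_frame // /sb ha_frame // /sa ha_frame.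
split.
- move=> i c; rewrite s1E add_sources_below ?E0 ?HE ?eqb0 ?negbK //.
  by have := ltn_ord i; have := ltn_ord c; nia.
- move=> i r; rewrite s1E add_sources_spec // /sc OKc Rc -/sc.
  by case: (source_rep G r); rewrite //= Rb.
- by move=> i j; rewrite s1E ha_frame // Rc Rb.
- by move=> r; rewrite s1E ha_frame // OKc.
Qed.

End ReachabilityPrograms.

(** * Breadth-first search and augmentation of a matching *)

Section AugmentingPaths.
Local Open Scope nat_scope.
Variables (n : nat) (E : nat -> nat -> bool).

Section Search.
Variables (mc mr : nat -> nat) (c0 : nat).

(* [Q] is the queue of columns, [V] marks visited rows, [Par] their parent columns and
   [found] the last free row met, shifted by one. *)
Definition bfs_inv (Q V Par : nat -> nat) tail found :=
  [/\ 0 < tail /\ Q 0 = c0,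
      forall a, a < tail -> Q a < 2 * n,
      forall a b, a < tail -> b < tail -> Q a = Q b -> a = b,
      forall a, 0 < a < tail -> exists i, [/\ i < n, V i != 0 & mr i = (Q a).+1] &
      (forall i, i < n -> V i != 0 -> exists a,
        [/\ a < tail, Par i = Q a, E (Q a) i, mr i = 0 -> found != 0 &
         forall c, mr i = c.+1 -> exists b, a < b < tail /\ Q b = c]) /\
      (found != 0 -> exists i, [/\ i < n, found = i.+1, V i != 0 & mr i = 0])].

Hypothesis matchE : matching n E mc mr.
Hypothesis c0_lt : c0 < 2 * n.
Hypothesis c0_free : mc c0 = 0.

Lemma bfs_start Par Q V : Q 0 = c0 -> (forall i, i < n -> V i = 0) -> bfs_inv Q V Par 1 0.
Proof.
move=> Q0 V0; split=> //; last by split => // i /V0 ->.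
- by case=> // _; rewrite Q0.
- by case=> // -[].
- by case.
Qed.

(** The partner of an unvisited row is new to the queue: the start column is free, and all other
    queued columns are partners of visited rows. *)
Lemma bfs_push Q V Par tail found h i c : bfs_inv Q V Par tail found ->
  h < tail -> i < n -> V i = 0 -> E (Q h) i -> mr i = c.+1 ->
  bfs_inv (upd Q tail c) (upd V i 1) (upd Par i (Q h)) tail.+1 found.
Proof.
move=> [[t0 Q0] B2 B3 B4 [B5 B6]] ht iN Vi Ehi mri.
have Qlt a : a < tail -> upd Q tail c a = Q a by rewrite /upd => at'; rewrite ifN // neq_ltn at'.
have Qt : upd Q tail c tail = c by rewrite /upd eqxx.
have [c2 mcc] := matchE.2 i c iN mri.
have fresh a : a < tail -> Q a <> c.
  case: a => [|a] at'; first by rewrite Q0 => c0c; move: c0_free; rewrite c0c mcc.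
  have [j [jN Vj mrj]] := B4 a.+1 at'; move=> Qa; rewrite Qa in mrj.
  have [_] := matchE.2 j c jN mrj; rewrite mcc => -[ij]; by rewrite -ij Vi in Vj.
have Vup j : V j != 0 -> upd V i 1 j != 0 by rewrite /upd; case: (j == i).
split.
- by rewrite Qlt.
- move=> a; rewrite ltnS leq_eqVlt => /predU1P [->|at']; first by rewrite Qt.
  by rewrite Qlt // B2.
- have lt_case a : a < tail.+1 -> a = tail \/ a < tail by rewrite ltnS leq_eqVlt => /predU1P.
  move=> a b /lt_case [->|at'] /lt_case [->|bt] //.
  + by rewrite Qt Qlt // => /esym /(fresh b bt).
  + by rewrite Qt Qlt // => /(fresh a at').
  + by rewrite !Qlt //; exact: B3.
- move=> a /andP [a0]; rewrite ltnS leq_eqVlt => /predU1P [->|at'].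
    by exists i; rewrite Qt /upd eqxx.
  have [j [jN Vj mrj]] := B4 a (introT andP (conj a0 at')).
  by exists j; rewrite Qlt // Vup.
split; last by move=> /B6 [j [jN fj Vj mrj]]; exists j; rewrite Vup.
move=> j jN; rewrite {1 2}/upd; case: (eqVneq j i) => [->|ji] Vj.
  exists h; rewrite Qlt // ltnW // mri; split => // c' [<-]; exists tail.
  by rewrite Qt ht ltnSn.
have [a [at' Pa Ea fa Ha]] := B5 j jN Vj; exists a; rewrite Qlt // ltnW //; split => // c' /Ha.
by move=> [b [/andP [ab bt] Qb]]; exists b; rewrite ab ltnW // Qlt.
Qed.

Lemma bfs_found Q V Par tail found h i : bfs_inv Q V Par tail found ->
  h < tail -> i < n -> V i = 0 -> E (Q h) i -> mr i = 0 ->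
  bfs_inv Q (upd V i 1) (upd Par i (Q h)) tail i.+1.
Proof.
move=> [B1 B2 B3 B4 [B5 B6]] ht iN Vi Ehi mri.
have Vup j : V j != 0 -> upd V i 1 j != 0 by rewrite /upd; case: (j == i).
split=> //.
  by move=> a /B4 [j [jN Vj mrj]]; exists j; rewrite Vup.
split; last by move=> _; exists i; rewrite /upd eqxx.
move=> j jN; rewrite {1 2}/upd; case: (eqVneq j i) => [->|ji] Vj.
  by exists h; rewrite mri; split.
by have [a [at' Pa Ea fa Ha]] := B5 j jN Vj; exists a; split.
Qed.

(** Queued columns are distinct; hence [2 n] rounds suffice both for the search and for flipping a
    path. *)
Lemma bfs_tail Q V Par tail found : bfs_inv Q V Par tail found -> tail <= 2 * n.
Proof.
move=> [_ B2 B3 _ _]; pose f (a : 'I_tail) := Ordinal (B2 a (ltn_ord a)).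
rewrite -[tail]card_ord -[2 * n]card_ord; apply: (@leq_card _ _ f) => a b /(congr1 val) /= ab.
by apply: val_inj; exact: (B3 _ _ (ltn_ord a) (ltn_ord b) ab).
Qed.

Lemma bfs_dead Q V Par tail (D : pred nat) : bfs_inv Q V Par tail 0 ->
  (forall a i, a < tail -> i < n -> E (Q a) i -> V i != 0) -> dead n E mr D ->
  dead n E mr (fun c => D c || [exists a : 'I_tail, Q a == c]).
Proof.
move=> [_ _ _ _ [B5 _]] closed deadD c i /orP [Dc|/existsP [a /eqP <-]] iN Eci.
  by have [c' mri Dc'] := deadD c i Dc iN Eci; exists c'; rewrite ?Dc'.
have Vi := closed a i (ltn_ord a) iN Eci; have [b [bt _ _ f0 Hb]] := B5 i iN Vi.
case mri: (mr i) => [|c']; first by have := f0 mri; rewrite eqxx.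
have [b' [/andP [_ bt'] Qb]] := Hb c' mri; exists c' => //; apply/orP; right.
by apply/existsP; exists (Ordinal bt'); rewrite /= Qb.
Qed.

End Search.

Section Augmentation.
Variables (mc0 mr0 : nat -> nat) (c0 : nat) (Q V Par : nat -> nat) (tail found0 : nat) (D : pred nat).
Hypothesis match0 : matching n E mc0 mr0.
Hypothesis c0_free : mc0 c0 = 0.
Hypothesis bfs0 : bfs_inv mr0 c0 Q V Par tail found0.
Hypothesis deadD : dead n E mr0 D.

(* The row [found - 1] is waiting for a new column; the path still to be flipped only uses
   queue positions that have not been touched yet, and never meets a dead row. *)
Definition aug_inv m (mc mr : nat -> nat) found :=
  [/\ (forall c i, c < 2 * n -> mc c = i.+1 -> [/\ i < n, E c i, mr i = c.+1 & found <> i.+1]),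
      (forall i c, i < n -> found <> i.+1 -> mr i = c.+1 -> c < 2 * n /\ mc c = i.+1),
      [/\ forall c, mc0 c != 0 -> mc c != 0, forall c, c <> c0 -> mc0 c = 0 -> mc c = 0 &
          found = 0 -> mc c0 != 0],
      (forall i, found = i.+1 -> [/\ i < n, V i != 0, forall c, D c -> E c i -> False &
         exists a, [/\ a + m < tail, Par i = Q a, E (Q a) i &
           forall b, b <= a -> mc (Q b) = mc0 (Q b)]]) &
      (forall c i, D c -> i < n -> E c i -> mr i = mr0 i)].

Lemma aug_start : found0 != 0 -> aug_inv 0 mc0 mr0 found0.
Proof.
move=> f0; have [_ _ _ _ [B5 /(_ f0) [t [tN ft Vt mrt]]]] := bfs0.
split=> //.
- move=> c i c2 mci; have [iN Eci mri] := match0.1 c i c2 mci; split => //.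
  by rewrite ft => -[ti]; move: mri; rewrite -ti mrt.
- by move=> i c iN _ mri; exact: match0.2.
- by split => // f00; rewrite f00 in f0.
- move=> i; rewrite ft => -[<-]; split => //.
    by move=> c Dc Ect; have [c' mrt' _] := deadD Dc tN Ect; rewrite mrt in mrt'.
  by have [a [at' Pa Ea _ _]] := B5 t tN Vt; exists a; rewrite addn0.
Qed.

(** The waiting row [t] takes its parent column [d], and the former partner of [d] waits next; there
    is none exactly when [d] is the start column. A row's parent precedes its partner in the queue,
    so positions decrease and [a + m < tail] is maintained. *)
Lemma aug_step m mc mr t : aug_inv m mc mr t.+1 ->
  aug_inv m.+1 (upd mc (Par t) t.+1) (upd mr t (Par t).+1) (mc (Par t)).
Proof.
move=> [M1 M2 [C1 C2 _] cur dd]; have [_ B2 B3 B4 [B5 _]] := bfs0.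
have [tN Vt tD [a [am Pa Ea mcQ]]] := cur t erefl; set d := Par t in Pa *.
have at' : a < tail by lia.
have d2 : d < 2 * n by rewrite Pa B2.
have mcd : mc d = mc0 d by rewrite Pa mcQ.
have Etd : E d t by rewrite Pa.
have tfree c : c < 2 * n -> mc c <> t.+1 by move=> c2 mct; have [_ _ _] := M1 c t c2 mct; exact.
split.
- move=> c i c2; rewrite /upd; case: (eqVneq c d) => [-> [<-]|cd mci].
    by rewrite eqxx; split => //; exact: tfree.
  have [iN Eci mri _] := M1 c i c2 mci; have it : i <> t by move=> it; apply: (tfree c c2); rewrite mci it.
  rewrite ifN; last exact/eqP.
  split => // mcdi; have [_ _ mri' _] := M1 d i d2 mcdi; move: mri'; rewrite mri => -[] /eqP.
  by rewrite (negbTE cd).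
- move=> i c iN ti; rewrite {1}/upd; case: (eqVneq i t) => [-> [<-]|it mri]; first by rewrite /upd eqxx.
  have [c2 mci] : c < 2 * n /\ mc c = i.+1 by apply: M2 => // -[ti']; rewrite ti' eqxx in it.
  split => //; rewrite /upd ifN //; apply/eqP => cd; apply: ti; by rewrite -cd.
- split.
  + by move=> c /C1 mcc; rewrite /upd; case: ifP.
  + move=> c cc0 mc0c; rewrite /upd; case: eqP => [cd|_]; last exact: C2.
    case: a {am Ea mcQ} Pa at' => [|a] Pa at'.
      by have [[_ Q0] _ _ _ _] := bfs0; case: cc0; rewrite cd Pa Q0.
    have [j [jN Vj mrj]] := B4 a.+1 at'; have [_] := match0.2 j _ jN mrj.
    by rewrite -Pa -cd mc0c.
  + move=> mcd0; rewrite /upd; case: (eqVneq c0 d) => // /eqP dc0; case: dc0.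
    case: a {am Ea mcQ} Pa at' => [|a] Pa at'.
      by have [[_ Q0] _ _ _ _] := bfs0; rewrite Pa Q0.
    have [j [jN Vj mrj]] := B4 a.+1 at'; have [_] := match0.2 j _ jN mrj.
    by rewrite -Pa -mcd mcd0.
- move=> i mcdi; have [iN Edi mri it] := M1 d i d2 mcdi.
  have mri0 : mr0 i = d.+1.
    by have [|//] := match0.1 d i d2 _; rewrite -mcd.
  have a0 : 0 < a.
    rewrite lt0n; apply/eqP => a0; have [[_ Q0] _ _ _ _] := bfs0.
    by move: mcdi; rewrite mcd Pa a0 Q0 c0_free.
  have Vi : V i != 0.
    have [j [jN Vj mrj]] := B4 a (introT andP (conj a0 at')); have [_] := match0.2 j _ jN mrj.
    by rewrite -Pa -mcd mcdi => -[->].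
  have [b [bt Pb Eb _ /(_ d mri0) [b' [/andP [bb' bt'] Qb']]]] := B5 i iN Vi.
  have b'a : b' = a by apply: B3 => //; rewrite Qb' Pa.
  split => //.
    (* If the next row were seen from a dead column, its old partner [d] would be dead, but [d] sees
       [t]. *)
    move=> c Dc Eci; have [c' mri' Dc'] := deadD Dc iN Eci.
    by move: mri'; rewrite mri0 => -[dc']; apply: tD Etd; rewrite dc'.
  exists b; split => //; first by lia.
  move=> b1 b1b; rewrite /upd ifN; first by apply: mcQ; lia.
  by apply/eqP; rewrite Pa => /B3 H; have := H _ at'; lia.
- move=> c i Dc iN Eci; rewrite /upd ifN; first exact: dd Dc iN Eci.
  by apply/eqP => it; apply: tD Dc _; rewrite -it.
Qed.

Lemma aug_end m mc mr found : 2 * n <= m -> aug_inv m mc mr found ->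
  [/\ matching n E mc mr, forall c, mc0 c != 0 -> mc c != 0,
      forall c, c <> c0 -> mc0 c = 0 -> mc c = 0, mc c0 != 0 & dead n E mr D].
Proof.
move=> nm [M1 M2 [C1 C2 C3] cur dd]; have tn := bfs_tail bfs0.
have f0 : found = 0.
  by case: found cur {M1 M2 C3} => // t /(_ t erefl) [_ _ _ [a [am _ _ _]]]; lia.
split => //; [split|exact: C3|].
- by move=> c i c2 /(M1 c i c2) [].
- by move=> i c iN; apply: M2 => //; rewrite f0.
- by move=> c i Dc iN Eci; rewrite (dd c i Dc iN Eci); exact: deadD Dc iN Eci.
Qed.

End Augmentation.

(** The dead set witnesses that treated columns left free remain hopeless. Optimality on the states
    is recorded on reaching column [n] and persists because covered columns stay covered. *)
Definition match_inv (mci : nat -> nat) c (mc mr : nat -> nat) :=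
  [/\ matching n E mc mr,
      exists2 D : pred nat, dead n E mr D & forall c', c' < c -> mc c' = 0 -> D c',
      forall c', mci c' != 0 -> mc c' != 0,
      forall c', c <= c' -> mci c' = 0 -> mc c' = 0
    & n <= c -> optimal n E (fun c' => c' < n) mc].

Lemma match_inv_start mci mri : matching n E mci mri -> match_inv mci 0 mci mri.
Proof.
move=> matchE; split => //; first by exists pred0.
rewrite leqn0 => /eqP n0 X f _ _; rewrite (_ : X = set0) ?cards0 //.
by apply/setP => x; have := ltn_ord x; lia.
Qed.

Lemma match_inv_step mci c mc mr mc' mr' (D : pred nat) : c < 2 * n ->
  (forall c', n <= c' -> mci c' = 0) ->
  match_inv mci c mc mr -> matching n E mc' mr' ->
  (forall c', mc c' != 0 -> mc' c' != 0) -> (forall c', c' <> c -> mc c' = 0 -> mc' c' = 0) ->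
  dead n E mr' D -> (forall c', c' <= c -> mc' c' = 0 -> D c') ->
  match_inv mci c.+1 mc' mr'.
Proof.
move=> c2 srcfree [M _ C1 C2 O] M' C1' C2' D1 D2.
have after c' : c.+1 <= c' -> mci c' = 0 -> mc' c' = 0.
  move=> cc' mci0; apply: C2'; first by lia.
  by apply: C2 => //; lia.
split => //.
- by exists D.
- by move=> c' /C1 /C1'.
move=> nc1; have [nc|cn] := leqP n c.
  move=> X f injf Xf; apply: leq_trans (O nc X f injf Xf) _.
  apply/subset_leq_card/subsetP => x; rewrite !inE => /andP [-> mcx]; exact: C1'.
(* Here [c.+1 = n]: the source columns are still free, so all matched columns are states. *)
apply: dead_optimal M' D1 _ _ => c' c'2.
  by move=> c'n; apply: D2; lia.
by rewrite ltnNge; apply: contra => nc'; rewrite after ?srcfree //; lia.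
Qed.

End AugmentingPaths.

(** * The matching program *)

Section MatchingProgram.
Local Open Scope nat_scope.

(* Arrays: 2 and 3 partners of columns and rows, 4 visited rows, 5 parents, 6 queue.
   Registers: 3 start column, 4 queue head, 5 column scanned, 6 queue tail, 7 free row. *)
Definition clear_visited := HFor 0 1 (HPut 4 (HV 0) (HC 0)).
Definition init_queue := HSeq (HPut 6 (HC 0) (HV 3)) (HSeq (HSet 6 (HC 1)) (HSet 7 (HC 0))).
Definition visit :=
  HWhen (at2 0 (HV 5) (HV 0)) (HUnless (HA 4 (HV 0))
    (HSeq (HPut 4 (HV 0) (HC 1)) (HSeq (HPut 5 (HV 0) (HV 5))
      (HIf (HA 3 (HV 0))
        (HSeq (HPut 6 (HV 6) (HSub (HA 3 (HV 0)) (HC 1))) (HSet 6 (HAdd (HV 6) (HC 1))))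
        (HSet 7 (HAdd (HV 0) (HC 1))))))).
Definition expand :=
  HWhen (HSub (HV 6) (HV 4)) (HUnless (HV 7) (HSeq (HSet 5 (HA 6 (HV 4))) (HFor 0 1 visit))).
Definition flip :=
  HWhen (HV 7) (HSeq (HSet 8 (HSub (HV 7) (HC 1))) (HSeq (HSet 5 (HA 5 (HV 8)))
    (HSeq (HSet 7 (HA 2 (HV 5))) (HSeq (HPut 2 (HV 5) (HAdd (HV 8) (HC 1)))
      (HPut 3 (HV 8) (HAdd (HV 5) (HC 1))))))).
Definition augment_col :=
  HUnless (HA 2 (HV 3)) (HSeq clear_visited (HSeq init_queue (HSeq (HFor 4 2 expand) (HFor 4 2 flip)))).
Definition match_cmd := HFor 3 2 augment_col.

Definition edge n s c i := ha s 0 (c * n + i) != 0.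

Definition bfs_state n c0 s :=
  bfs_inv n (edge n s) (ha s 3) c0 (ha s 6) (ha s 4) (ha s 5) (hr s 6) (hr s 7).

Lemma visit_spec n c0 s h i : matching n (edge n s) (ha s 2) (ha s 3) ->
  c0 < 2 * n -> ha s 2 c0 = 0 -> bfs_state n c0 s ->
  h < hr s 6 -> hr s 5 = ha s 6 h -> hr s 0 = i -> i < n ->
  let s1 := hrun n visit s in
  [/\ bfs_state n c0 s1, hr s 6 <= hr s1 6,
      forall a, a < hr s 6 -> ha s1 6 a = ha s 6 a,
      forall i', ha s 4 i' != 0 -> ha s1 4 i' != 0 &
      edge n s (ha s 6 h) i -> ha s1 4 i != 0].
Proof.
move=> matchE c02 c0free B ht rd ri iN s1.
have d2 : ha s 6 h < 2 * n by have [_ B2 _ _ _] := B; exact: B2.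
have eE : edge n s (ha s 6 h) i = (heval n s (at2 0 (HV 5) (HV 0)) != 0) by rewrite /= rd d2 ri.
rewrite /s1 {s1} /visit /HWhen /HUnless; set c := HSeq _ _.
have E1 : hrun n (HIf (at2 0 (HV 5) (HV 0)) (HIf (HA 4 (HV 0)) HSkip c) HSkip) s =
  if edge n s (ha s 6 h) i then (if ha s 4 i != 0 then s else hrun n c s) else s.
  by rewrite eE -ri.
rewrite {}E1; case: ifP => [Ehi|_]; last by split.
have [Vi|Vi] := eqVneq (ha s 4 i) 0; last by rewrite /=; split.
rewrite /= ri; case mri: (ha s 3 i) => [|c'] /=; rewrite ?rd ?ri ?mri ?subn1 /=.
  split => //; last by rewrite /upd eqxx.
    by have := bfs_found B ht iN Vi Ehi mri; rewrite /bfs_state /= ?addn1.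
  by move=> i' Vi'; rewrite /upd; case: (i' == i).
split; rewrite ?addn1 //.
- have := bfs_push matchE c0free B ht iN Vi Ehi mri.
  by rewrite /bfs_state /= ?addn1.
- by move=> a at'; rewrite /upd ifN // neq_ltn at'.
- by move=> i' Vi'; rewrite /upd; case: (i' == i).
- by rewrite /upd eqxx.
Qed.

Lemma expand_spec n c0 s h : matching n (edge n s) (ha s 2) (ha s 3) ->
  c0 < 2 * n -> ha s 2 c0 = 0 -> h < 2 * n -> hr s 4 = h -> bfs_state n c0 s ->
  (hr s 7 = 0 -> forall a i, a < h -> a < hr s 6 -> i < n -> edge n s (ha s 6 a) i -> ha s 4 i != 0) ->
  let s1 := hrun n expand s in
  bfs_state n c0 s1 /\
  (hr s1 7 = 0 -> forall a i, a < h.+1 -> a < hr s1 6 -> i < n -> edge n s (ha s1 6 a) i -> ha s1 4 i != 0).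
Proof.
move=> matchE c02 c0free h2 rh B B7 s1.
have -> : s1 = if hr s 6 - h != 0 then (if hr s 7 != 0 then s else
  hrun n (HFor 0 1 visit) (set_r s 5 (ha s 6 h))) else s by rewrite -rh.
set X := hrun n (HFor 0 1 visit) _.
have [ht|th] := ltnP h (hr s 6); last first.
  rewrite (_ : hr s 6 - h = 0) /=; last by lia.
  by split => // f0 a i ah at' iN Eai; apply: (B7 f0 a i) => //; lia.
rewrite (_ : hr s 6 - h != 0 = true) /=; last by lia.
have [f0|f0] := eqVneq (hr s 7) 0; last by split => // f0'; rewrite f0' in f0.
rewrite /= /X {X}.
pose P i s2 := [/\ bfs_state n c0 s2 /\ h < hr s2 6, hr s2 5 = ha s2 6 h,
  forall a i, a < h -> i < n -> edge n s (ha s2 6 a) i -> ha s2 4 i != 0 &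
  forall i', i' < i -> edge n s (ha s2 6 h) i' -> ha s2 4 i' != 0].
have [||||[B' ht'] rd H1 H2] := @hfor_inv n 0 1 visit (set_r s 5 (ha s 6 h)) P.
- by [].
- by [].
- split => // a i ah iN; apply: (B7 f0 a i) => //; lia.
- move=> i s2 iN ri [ka kr _] [[B2 ht2] rd H1 H2]; rewrite mul1n in iN.
  have k0 := ka 0 isT; have k2 := ka 2 isT; have k3 := ka 3 isT; rewrite /= in k0 k2 k3.
  have eE : edge n s2 = edge n s by rewrite /edge k0.
  have [||B3 t3 Q3 V3 e3] := @visit_spec n c0 s2 h i _ c02 _ B2 ht2 rd ri iN.
  + by rewrite eE k2 k3.
  + by rewrite k2.
  split.
  + by split => //; exact: leq_trans ht2 t3.
  + by rewrite hr_frame // Q3.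
  + move=> a i' ah i'N; rewrite Q3; last by lia.
    by move=> /(H1 a i' ah i'N) /V3.
  + move=> i'; rewrite ltnS leq_eqVlt Q3 // => /predU1P [->|i'i]; first by rewrite -eE.
    by move=> /(H2 i' i'i) /V3.
split => // _ a i; rewrite ltnS leq_eqVlt => /predU1P [->|ah] _ iN.
  by apply: H2; rewrite mul1n.
exact: H1.
Qed.

Lemma search_spec n c0 s : matching n (edge n s) (ha s 2) (ha s 3) ->
  c0 < 2 * n -> ha s 2 c0 = 0 -> hr s 3 = c0 ->
  let s1 := hrun n (HSeq clear_visited (HSeq init_queue (HFor 4 2 expand))) s in
  bfs_state n c0 s1 /\
  (hr s1 7 = 0 -> forall a i, a < hr s1 6 -> i < n -> edge n s (ha s1 6 a) i -> ha s1 4 i != 0).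
Proof.
move=> matchE c02 c0free rc s1; pose sa := hrun n clear_visited s.
have V0 i : i < n -> ha sa 4 i = 0.
  move=> iN; rewrite /sa (@fill1 n 0 1 _ s (fun s => ha s 4) (fun=> 0)) //; first by rewrite mul1n iN.
  by move=> i' s' _ r0 _ _ a; rewrite /= r0.
have sa3 : hr sa 3 = c0 by rewrite /sa hr_frame.
pose sb := hrun n init_queue sa.
have eb : edge n sb = edge n s by rewrite /edge /sb ha_frame // /sa ha_frame.
have kb b : b \in [:: 2; 3] -> ha sb b = ha s b.
  by rewrite !inE => /orP [] /eqP ->; rewrite /sb ha_frame // /sa ha_frame.
have B0 : bfs_state n c0 sb.
  apply: bfs_start => [||i iN]; first exact: c02.
    exact: sa3.
  by rewrite /sb ha_frame // V0.
pose P h s2 := bfs_state n c0 s2 /\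
  (hr s2 7 = 0 -> forall a i, a < h -> a < hr s2 6 -> i < n -> edge n s (ha s2 6 a) i -> ha s2 4 i != 0).
have [||||B' H'] := @hfor_inv n 4 2 expand sb P.
- by [].
- by [].
- by split.
- move=> h s2 h2 rh [ka _ _] [B2 H2].
  have k0 := ka 0 isT; have k2 := ka 2 isT; have k3 := ka 3 isT.
  have eE : edge n s2 = edge n s by rewrite -eb /edge k0.
  have := @expand_spec n c0 s2 h; rewrite eE k2 k3 !kb //; exact.
split=> // f0 a i at'; apply: (H' f0 a i) => //.
by apply: leq_trans at' _; exact: (bfs_tail B').
Qed.

Lemma flip_spec n s t : hr s 7 = t.+1 ->
  let s1 := hrun n flip s in
  [/\ ha s1 2 = upd (ha s 2) (ha s 5 t) t.+1, ha s1 3 = upd (ha s 3) t (ha s 5 t).+1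
    & hr s1 7 = ha s 2 (ha s 5 t)].
Proof.
by move=> f; rewrite /flip /HWhen /= f /= /upd /= ?f ?subn1 /= ?addn1; split.
Qed.

Lemma augment_col_spec n mci c s : matching n (edge n s) (ha s 2) (ha s 3) ->
  (forall c', n <= c' -> mci c' = 0) -> c < 2 * n -> hr s 3 = c ->
  match_inv n (edge n s) mci c (ha s 2) (ha s 3) ->
  let s1 := hrun n augment_col s in match_inv n (edge n s) mci c.+1 (ha s1 2) (ha s1 3).
Proof.
move=> matchE srcfree c2 rc I s1; have [_ [D deadD freeD] _ _ _] := I.
have -> : s1 = if ha s 2 c != 0 then s else hrun n (HFor 4 2 flip)
   (hrun n (HSeq clear_visited (HSeq init_queue (HFor 4 2 expand))) s) by rewrite -rc.
set X := hrun n (HFor 4 2 flip) _.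
have [mc0|mc0] := eqVneq (ha s 2 c) 0; last first.
  apply: match_inv_step I matchE _ _ deadD _ => // c'; rewrite leq_eqVlt => /predU1P [->|].
    by move=> mcc; rewrite mcc in mc0.
  exact: freeD.
have -> : (if ~~ true then s else X) = X by [].
rewrite /X {X}; set sa := hrun n _ s; have [B closed] := search_spec matchE c2 mc0 rc.
rewrite -/sa in B closed.
have k0 : edge n sa = edge n s by rewrite /edge /sa ha_frame.
have k2 : ha sa 2 = ha s 2 by rewrite /sa ha_frame.
have k3 : ha sa 3 = ha s 3 by rewrite /sa ha_frame.
rewrite /bfs_state k0 k3 in B.
have [f0|f0] := eqVneq (hr sa 7) 0.
  have [||||_ [-> ->]] := @hfor_inv n 4 2 flip sa (fun _ s2 => hr s2 7 = 0 /\ ha s2 2 = ha s 2 /\ ha s2 3 = ha s 3).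
  - by [].
  - by [].
  - by [].
  - by move=> h s2 _ _ _ [f2 [E2 E3]]; rewrite /flip /HWhen /= f2.
  (* A failed search turns all queued columns dead, the start column among them. *)
  rewrite f0 in B; have D' := bfs_dead B (closed f0) deadD.
  apply: match_inv_step I matchE _ _ D' _ => // c'; rewrite leq_eqVlt => /predU1P [->|cc'] mcc.
    have [[t0 Q0] _ _ _ _] := B; apply/orP; right; apply/existsP; exists (Ordinal t0).
    by rewrite /= Q0.
  by apply/orP; left; exact: freeD.
pose P m s2 := aug_inv n (edge n s) (ha s 2) (ha s 3) c (ha sa 6) (ha sa 4) (ha sa 5) (hr sa 6) D m
  (ha s2 2) (ha s2 3) (hr s2 7).
have HP : P (2 * n) (hrun n (HFor 4 2 flip) sa).
  apply: hfor_inv.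
  - by [].
  - by [].
  - by rewrite /P k2 k3; exact: aug_start matchE B deadD f0.
  - move=> h s2 _ _ [ka _ _] I2; have k5 := ka 5 isT.
    case f2: (hr s2 7) => [|t].
      rewrite /P /flip /HWhen /= f2 /=; move: I2; rewrite /P f2 => -[M1 M2 C cur dd].
      by split.
    have [E2 E3 E7] := flip_spec n f2; rewrite /P E2 E3 E7 k5.
    by apply: (aug_step matchE mc0 B deadD); rewrite -f2.
have [M C1 C2 C3 dd] := aug_end mc0 B deadD (leqnn _) HP.
apply: (match_inv_step c2 srcfree I M C1 C2 dd) => c'; rewrite leq_eqVlt => /predU1P [->|cc'] mcc.
  by rewrite mcc in C3.
apply: freeD => //; apply/eqP; apply: contraT => /C1.
by rewrite mcc.
Qed.

Lemma match_cmd_spec n s : let E := edge n s in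
  matching n E (ha s 2) (ha s 3) -> (forall c, n <= c -> ha s 2 c = 0) ->
  let s1 := hrun n match_cmd s in
  match_inv n E (ha s 2) (2 * n) (ha s1 2) (ha s1 3).
Proof.
move=> E matchE srcfree s1.
have := @hfor_inv n 3 2 augment_col s (fun c s' => match_inv n E (ha s 2) c (ha s' 2) (ha s' 3)); apply => //.
  exact: match_inv_start.
move=> c s' c2 rc [ka _ _] I; have eE : edge n s' = E by rewrite /edge ka.
rewrite -eE in I *; apply: augment_col_spec => //.
by case: I.
Qed.

End MatchingProgram.

(** * Input and output states from two successive matchings *)

Section CorePrograms.
Local Open Scope nat_scope.

Definition rows_arr (tr : bool) := if tr then 8 else 10.
Definition sources_arr (tr : bool) := if tr then 9 else 11.

(** For a matched row the truncated difference with [n] is nonzero exactly when the partner is a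
    source column; an unmatched row gets 1. *)
Definition outputs tr :=
  HFor 0 1 (HSeq (HIf (HA 3 (HV 0)) (HPut (rows_arr tr) (HV 0) (HSub (HA 3 (HV 0)) HN))
                                    (HPut (rows_arr tr) (HV 0) (HC 1)))
    (HIf (HA 2 (HAdd HN (HV 0))) (HPut (sources_arr tr) (HV 0) (HC 0))
                                 (HPut (sources_arr tr) (HV 0) (HA 7 (HV 0))))).

(* Starting the transposed search from this matching keeps the covered states covered, so that
   one matching of the states determines both [S] and [T]. *)
Definition swap :=
  HFor 0 1 (HSeq (HSet 8 (HA 3 (HV 0))) (HSeq (HWhen (HSub (HV 8) HN) (HSet 8 (HC 0)))
    (HSeq (HPut 3 (HV 0) (HA 2 (HV 0))) (HSeq (HPut 2 (HV 0) (HV 8)) (HPut 2 (HAdd HN (HV 0)) (HC 0)))))).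

Definition core tr := HSeq (load tr) (HSeq reach_cmd (HSeq match_cmd (outputs tr))).

Definition both_sides := HSeq (core true) (HSeq swap (core false)).

Lemma outputs_spec n tr s i : i < n ->
  let s1 := hrun n (outputs tr) s in
  (ha s1 (rows_arr tr) i != 0) = (ha s 3 i == 0) || (n < ha s 3 i) /\
  (ha s1 (sources_arr tr) i != 0) = (ha s 7 i != 0) && (ha s 2 (n + i) == 0).
Proof.
move=> iN; rewrite /outputs; set c := HSeq _ _; split.
- rewrite (@fill1 n 0 1 c s (fun s => ha s (rows_arr tr))
    (fun i => if ha s 3 i != 0 then ha s 3 i - n else 1)) //.
    rewrite mul1n iN; have [->|] := eqVneq (ha s 3 i) 0; first by [].
    by rewrite /= subn_eq0 -ltnNge.
  move=> j s' jN rj ks _ a; have k3 : ha s' 3 = ha s 3 by case: ks => [ka _ _]; apply: ka; rewrite /c; case: (tr).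
  rewrite /c /= rj k3 /rows_arr /sources_arr.
  by case: (ha s 3 j != 0); case: (tr); case: ifP => _; rewrite /= /upd; case: eqP => // ->.
- rewrite (@fill1 n 0 1 c s (fun s => ha s (sources_arr tr))
    (fun i => if ha s 2 (n + i) != 0 then 0 else ha s 7 i)) //.
    rewrite mul1n iN; have [_|] := eqVneq (ha s 2 (n + i)) 0; first by rewrite andbT.
    by rewrite andbF.
  move=> j s' jN rj [ka _ _] _ a.
  have k2 : ha s' 2 = ha s 2 by apply: ka; rewrite /c; case: (tr).
  have k7 : ha s' 7 = ha s 7 by apply: ka; rewrite /c; case: (tr).
  rewrite /c /= rj /rows_arr /sources_arr.
  case: (ha s' 3 j != 0); case: (tr); rewrite /= ?rj ?k2; case: ifP => _; rewrite /= /upd ?rj ?k7 //;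
    by case: eqP => // ->.
Qed.

Lemma swap_spec n s : let s1 := hrun n swap s in
  (forall a, ha s1 3 a = if a < n then ha s 2 a else ha s 3 a) /\
  (forall a, ha s1 2 a = if a < n then (if n < ha s 3 a then 0 else ha s 3 a)
     else if a < n + n then 0 else ha s 2 a).
Proof.
rewrite /swap; set c := HSeq _ _.
pose P i s' := (forall a, ha s' 3 a = if a < i then ha s 2 a else ha s 3 a) /\
  (forall a, ha s' 2 a = if a < i then (if n < ha s 3 a then 0 else ha s 3 a)
     else if (n <= a) && (a < n + i) then 0 else ha s 2 a).
have [||||H1 H2] := @hfor_inv n 0 1 c s P.
- by [].
- by [].
- by split => // a; rewrite ltn0 addn0 leqNgt andNb.
- move=> i s' iN ri _ [H1 H2]; rewrite mul1n in iN.
  have E3 : ha s' 3 i = ha s 3 i by rewrite H1 ltnn.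
  have E2 : ha s' 2 i = ha s 2 i by rewrite H2 ltnn leqNgt iN.
  have [F1 F2] : ha (hrun n c s') 3 = upd (ha s' 3) i (ha s 2 i) /\
      ha (hrun n c s') 2 = upd (upd (ha s' 2) i (if n < ha s 3 i then 0 else ha s 3 i)) (n + i) 0.
    rewrite /c /HWhen /= ri /= /upd /= -subn_gt0 lt0n E3.
    by case: (ha s 3 i - n != 0); rewrite /= /upd /= ?ri E2.
  split=> a; rewrite ?F1 ?F2 /upd.
    have -> : (a < i.+1) = (a == i) || (a < i) by rewrite ltnS leq_eqVlt.
    by rewrite H1; case: (eqVneq a i) => [->|].
  have -> : (a < i.+1) = (a == i) || (a < i) by rewrite ltnS leq_eqVlt.
  rewrite H2 addnS; have [->|ai] := eqVneq a (n + i).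
    have /negbTE -> : ~~ ((n + i == i) || (n + i < i)) by lia.
    by rewrite leq_addr ltnSn.
  have [->|ai'] := eqVneq a i; first by [].
  have -> : (a < (n + i).+1) = (a < n + i) by lia.
  by [].
split=> a; first by rewrite H1 mul1n.
rewrite H2 mul1n; case: ltnP => //= na; by rewrite na.
Qed.

Definition state_matching n (G : 'M[bool]_n) (mc mr : nat -> nat) :=
  [/\ forall c, n <= c -> mc c = 0,
      forall c i, mc c = i.+1 -> exists x y : 'I_n, [/\ c = y, i = x, G x y & mr x = y.+1] &
      forall (x : 'I_n) c, mr x = c.+1 -> exists2 y : 'I_n, c = y & mc y = x.+1].

Lemma state_matchingE n (G : 'M[bool]_n) mc mr (E : nat -> nat -> bool) :
  (forall i c : 'I_n, E c i = G i c) -> state_matching G mc mr -> matching n E mc mr.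
Proof.
move=> EG [M0 M1 M2]; split.
- by move=> c i _ /M1 [x [y [-> -> Gxy ->]]]; rewrite EG ltn_ord.
- move=> i c iN mri; have [y -> mcy] := M2 (Ordinal iN) c mri.
  by split; [have := ltn_ord y; lia|].
Qed.

Lemma matching_swap n (G : 'M[bool]_n) (E : nat -> nat -> bool) mc mr mc' mr' :
  (forall i c : 'I_n, E c i = G i c) -> matching n E mc mr -> (forall c, 2 * n <= c -> mc c = 0) ->
  (forall a, mr' a = if a < n then mc a else mr a) ->
  (forall a, mc' a = if a < n then (if n < mr a then 0 else mr a) else if a < n + n then 0 else mc a) ->
  state_matching (trmx G) mc' mr'.
Proof.
move=> EG [M1 M2] M0 R C; split.
- by move=> c nc; rewrite C ltnNge nc /=; case: ifP => // /negbT; rewrite -leqNgt => c2; apply: M0; lia.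
- move=> c i; rewrite C; case: ltnP => [cn|nc]; last by case: ifP => // /negbT c2; rewrite M0 //; lia.
  case: ltnP => // iN mrc; rewrite mrc in iN; have [_ mci] := M2 c i cn mrc.
  have i2 : i < 2 * n by lia.
  have [_ Eic _] := M1 i c i2 mci; exists (Ordinal iN), (Ordinal cn).
  by rewrite mxE -EG /= R iN.
- move=> x c; rewrite R ltn_ord => mcx; have x2 : x < 2 * n by have := ltn_ord x; lia.
  have [cn Exc mrc] := M1 x c x2 mcx; exists (Ordinal cn) => //=.
  by rewrite C cn mrc ifN // -leqNgt ltn_ord.
Qed.

Definition core_post n (G : 'M[bool]_n) tr (mci : nat -> nat) s1 :=
  [/\ [/\ forall i c : 'I_n, edge n s1 c i = G i c,
          forall i r : 'I_n, edge n s1 (n + r) i = source_rep G r && conn G i r &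
          forall i j : 'I_n, (ha s1 1 (i * n + j) != 0) = conn G i j],
      matching n (edge n s1) (ha s1 2) (ha s1 3),
      optimal n (edge n s1) (fun c => c < n) (ha s1 2) /\
      optimal n (edge n s1) (valid_col G) (ha s1 2),
      (forall c, mci c != 0 -> ha s1 2 c != 0) /\ (forall c, 2 * n <= c -> ha s1 2 c = 0) &
      forall i : 'I_n, (ha s1 (rows_arr tr) i != 0) = (i \in unmatched_rows n (ha s1 3)) /\
        (ha s1 (sources_arr tr) i != 0) = (i \in unmatched_sources G (ha s1 2))].

Lemma core_spec n (G : 'M[bool]_n) tr s :
  (forall i c : 'I_n, hm s (if tr then i * n + c else c * n + i) = G i c) ->
  state_matching G (ha s 2) (ha s 3) -> core_post G tr (ha s 2) (hrun n (core tr) s).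
Proof.
move=> input SM; pose sa := hrun n (load tr) s; pose sb := hrun n reach_cmd sa.
pose sc := hrun n match_cmd sb; pose sd := hrun n (outputs tr) sc.
have -> : hrun n (core tr) s = sd by [].
have sa2 : ha sa 2 = ha s 2 by rewrite /sa ha_frame //; case: (tr).
have sa3 : ha sa 3 = ha s 3 by rewrite /sa ha_frame //; case: (tr).
have sb2 : ha sb 2 = ha s 2 by rewrite /sb ha_frame.
have sb3 : ha sb 3 = ha s 3 by rewrite /sb ha_frame.
have [|E1 E2 Rc OKc] := @reach_cmd_spec n G sa.
  by move=> i c; rewrite /sa load_spec // input.
rewrite -/sb in E1 E2 Rc OKc.
have SM0 : forall c, n <= c -> ha s 2 c = 0 by case: SM.
have [|c|M [D deadD freeD] C1 C2 O] := @match_cmd_spec n sb.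
- by rewrite sb2 sb3; exact: state_matchingE E1 SM.
- by rewrite sb2; exact: SM0.
rewrite -/sc sb2 in M deadD freeD C1 C2 O.
have kd b : b \in [:: 0; 1; 2; 3; 7] -> ha sd b = ha sc b.
  by rewrite !inE => /or4P [| | |/orP []] /eqP ->; rewrite /sd ha_frame //; case: (tr).
have kc b : b \in [:: 0; 1; 7] -> ha sc b = ha sb b.
  by rewrite !inE => /or3P [] /eqP ->; rewrite /sc ha_frame.
have eE : edge n sd = edge n sb by rewrite /edge kd // kc.
have n2 : n <= 2 * n by lia.
rewrite /core_post eE (kd 1 isT) (kd 2 isT) (kd 3 isT); split.
- by split => // i j; rewrite kc.
- by [].
- split; first exact: O.
  apply: (dead_optimal M deadD) => [c c2 _|c c2]; first exact: freeD.
  case mcc: (ha sc 2 c) => [|i] // _; have [iN Eci _] := M.1 c i c2 mcc.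
  rewrite /valid_col; have [//|nc] := ltnP c n; apply/existsP.
  have rN : c - n < n by lia.
  exists (Ordinal rN); rewrite /= subnKC // eqxx andbT.
  have := E2 (Ordinal iN) (Ordinal rN); rewrite /= subnKC // => Ec.
  by move: Eci; rewrite /edge Ec => /andP [].
- split=> // c c2; apply: C2 => //; apply: SM0; lia.
- move=> i; have [-> ->] := outputs_spec tr sc (ltn_ord i).
  rewrite !inE; split => //; congr (_ && _).
  by rewrite kc // OKc; case: source_rep.
Qed.

Lemma hm_core n tr s : hm (hrun n (core tr) s) = hm s.
Proof. by rewrite hm_frame //; case: tr. Qed.

(** Read backwards, the second matching matches states of the original graph outside [S2], its
    uncovered state columns, and [|S2| = |T|]. Covered columns stay covered, so [S2] lies in [S],
    and minimality of [|S|] forces equality. Thus one function sends the complement of [S] into that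
    of [T]. *)
Theorem both_sides_spec n (A : 'M[bool]_n) :
  let s := hrun n both_sides (hinit A) in
  exists S Sx T Tx : {set 'I_n},
  [/\ forall i : 'I_n, [/\ (ha s 8 i != 0) = (i \in S), (ha s 9 i != 0) = (i \in Sx),
        (ha s 10 i != 0) = (i \in T) & (ha s 11 i != 0) = (i \in Tx)],
      [/\ reaching A (S :|: Sx), reaching (trmx A) (T :|: Tx) &
        forall i j : 'I_n, (ha s 1 (i * n + j) != 0) = conn (trmx A) i j],
      [/\ forall S', matchable A S' -> reaching A S' -> #|S| + #|Sx| <= #|S'|,
          forall T', matchable (trmx A) T' -> reaching (trmx A) T' -> #|T| + #|Tx| <= #|T'| &
          forall S', matchable A S' -> #|S| <= #|S'|],
      #|S| = #|T| &
      exists f : 'I_n -> 'I_n, {in ~: S &, injective f} /\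
        forall x, x \notin S -> A x (f x) /\ f x \notin T].
Proof.
set s0 := hinit A; pose s1 := hrun n (core true) s0; pose s1' := hrun n swap s1.
move=> s; have sE : s = hrun n (core false) s1' by [].
have inputE (i j : 'I_n) : hm s0 (i * n + j) = A i j.
  rewrite /=; congr nat_of_bool; apply/existsP/idP => [[i' /existsP [j' /andP [/eqP e]]]|Aij].
    have /andP [/eqP ii /eqP jj] : (i == i' :> nat) && (j == j' :> nat).
      by rewrite -(rowmajor_inj _ _ (ltn_ord j) (ltn_ord j')) e.
    by rewrite (val_inj ii : i = i') (val_inj jj : j = j').
  by exists i; apply/existsP; exists j; rewrite eqxx.
have [|//|[E1 F1 _] M1 [O1 P1] [_ Z1] out1] := @core_spec n A true s0.
  by [].
rewrite -/s1 in E1 F1 M1 O1 P1 Z1 out1.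
have [R' C'] := swap_spec n s1; rewrite -/s1' in R' C'.
have SM : state_matching (trmx A) (ha s1' 2) (ha s1' 3).
  exact: matching_swap E1 M1 Z1 R' C'.
have input2 (i c : 'I_n) : hm s1' (c * n + i) = (trmx A) i c.
  by rewrite /s1' hm_frame // /s1 hm_core inputE mxE.
have [[E2 F2 Rc] M2 [O2 P2] [cov2 _] out2] := @core_spec n (trmx A) false s1' input2 SM.
rewrite -sE in E2 F2 Rc M2 O2 P2 cov2 out2.
have keep b : b \in [:: 8; 9] -> ha s b = ha s1 b.
  by rewrite !inE => /orP [] /eqP ->; rewrite sE ha_frame // /s1' ha_frame.
clear sE; clearbody s s1' s1.
exists (unmatched_rows n (ha s1 3)), (unmatched_sources A (ha s1 2)).
exists (unmatched_rows n (ha s 3)), (unmatched_sources (trmx A) (ha s 2)).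
have min1 S' : matchable A S' -> #|unmatched_rows n (ha s1 3)| <= #|S'|.
  exact: unmatched_rows_min E1 M1 O1 S'.
have edgeT (x : 'I_n) i : ha s 2 x = i.+1 -> exists y : 'I_n, [/\ i = y, A x y & ha s 3 y = x.+1].
  move=> mcx; have x2 : x < 2 * n by have := ltn_ord x; lia.
  have [iN Exi mri] := M2.1 x i x2 mcx; exists (Ordinal iN); split => //.
  by have := E2 (Ordinal iN) x; rewrite /= Exi mxE => <-.
have covS (x : 'I_n) : x \notin unmatched_rows n (ha s1 3) -> ha s 2 x != 0.
  rewrite inE negb_or -leqNgt => /andP [mr0 mrn]; apply: cov2.
  by rewrite C' ltn_ord ltnNge mrn.
pose S2 := [set x : 'I_n | ha s 2 x == 0].
have cardS2 : #|S2| = #|unmatched_rows n (ha s 3)|.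
  have := card_matched_states E2 M2; rewrite -[X in _ = X -> _]card_ord -(cardsC S2) addnC => /eqP.
  have -> : #|[set c : 'I_(2 * n) | (c < n) && (ha s 2 c != 0)]| = #|~: S2|.
    have nn : n <= 2 * n by lia.
    have wi : injective (widen_ord nn) by move=> x y /(congr1 val) /= /val_inj.
    rewrite -(card_imset _ wi); apply: eq_card => c.
    rewrite inE; apply/andP/imsetP => [[cn mc]|[x + ->]].
      by exists (Ordinal cn); [rewrite !inE|apply: val_inj].
    by rewrite !inE => mcx; split=> //=.
  by rewrite eqn_add2r eq_sym => /eqP.
pose f (x : 'I_n) := odflt x (insub (ha s 2 x).-1).
have fP x : x \notin S2 -> A x (f x) /\ ha s 3 (f x) = x.+1.
  rewrite inE; case mcx: (ha s 2 x) => [|i] // _; have [y [iy Axy mry]] := edgeT x i mcx.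
  by rewrite /f mcx /= iy valK.
have injf : {in ~: S2 &, injective f}.
  move=> x y; rewrite !in_setC => /fP [_ fx] /fP [_ fy] fxy.
  by move: fx; rewrite fxy fy => -[] /val_inj.
have mS2 : matchable A S2 by exists f => // x /fP [].
have cardST : #|unmatched_rows n (ha s1 3)| = #|unmatched_rows n (ha s 3)|.
  apply/eqP; rewrite eqn_leq -{1}cardS2 min1 //= -cardS2.
  apply/subset_leq_card/subsetP => x; rewrite inE => /eqP mcx; apply: contraT => /covS.
  by rewrite mcx.
have S2E : S2 = unmatched_rows n (ha s1 3).
  apply/eqP; rewrite eqEcard cardST cardS2 leqnn andbT; apply/subsetP => x.
  by rewrite inE => /eqP mcx; apply: contraT => /covS; rewrite mcx.
split.
- move=> i; have [o1 o2] := out1 i; have [o3 o4] := out2 i.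
  by split=> //; rewrite keep.
- split => //; first exact: unmatched_reaching F1 M1.
  exact: unmatched_reaching F2 M2.
- split => //.
  + exact: unmatched_total_min E1 F1 M1 P1.
  + exact: unmatched_total_min E2 F2 M2 P2.
- by [].
- rewrite -S2E; exists f; split=> // x /fP [Axf mrf].
  by split=> //; rewrite inE mrf /= -leqNgt ltn_ord.
Qed.

End CorePrograms.

(** * Pairing inputs with outputs *)

Section Pairing.
Local Open Scope nat_scope.

Section PairingInvariant.
Variables (n : nat) (G : 'M[bool]_n).
Implicit Types (P Q : {set 'I_n}) (K : 'I_n -> 'I_n -> bool) (h : 'I_n) (kappa : 'I_n -> 'I_n).

(* The links of [K] realize the bijection [kappa] except for its pair [(h, h')], which is
   only closed at the end. *)
Definition paired P Q K h h' kappa :=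
  [/\ h \in P, kappa h = h', {in P &, injective kappa}, Q = kappa @: P &
      forall v w, K v w = [&& v \in P, v != h & w == kappa v]].

(** The first half says that the hub input reaches all chained states through edges and links, the
    second that all of them reach the hub output. *)
Definition chained P Q K h h' :=
  (forall W : {set 'I_n}, (forall i j, i \in W -> G j i -> j \in W) ->
     (forall v w, K v w -> w \in W -> v \in W) -> h \in W -> P \subset W /\ Q \subset W) /\
  (forall W : {set 'I_n}, (forall i j, i \in W -> G i j -> j \in W) ->
     (forall v w, K v w -> v \in W -> w \in W) -> h' \in W -> P \subset W /\ Q \subset W).

Lemma conn_closed_rev (W : {set 'I_n}) x y :
  (forall i j, i \in W -> G i j -> j \in W) -> conn G x y -> y \in W -> x \in W.
Proof.
move=> clW /connectP [p + ->]; elim: p x => //= z p IH x /andP [Gzx pz] /(IH z pz) zW.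
exact: clW zW Gzx.
Qed.

Lemma paired_start K v w : (forall x y, K x y = false) ->
  paired [set v] [set w] K v w (fun=> w).
Proof.
move=> K0; split; rewrite ?inE ?eqxx ?imset_set1 //.
  by move=> x y; rewrite !inE => /eqP -> /eqP ->.
by move=> x y; rewrite K0 inE; case: eqP.
Qed.

Lemma chained_start K v w : conn G v w -> chained [set v] [set w] K v w.
Proof.
move=> vw; split=> W clW _ hW; rewrite !sub1set hW; split => //.
  exact: conn_closed clW vw hW.
exact: conn_closed_rev clW vw hW.
Qed.

(** The old hub output is linked to the new input [v], and [w] becomes the hub output. The hub pair
    thus always joins the first input with the last output, so the bijection changes at [v] and at
    [h]. *)
Lemma paired_link P Q K h h' kappa v w K' : paired P Q K h h' kappa -> v \notin P -> w \notin Q ->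
  (forall x y, K' x y = (x == v) && (y == h') || K x y) ->
  paired (v |: P) (w |: Q) K' h w (fun x => if x == v then h' else if x == h then w else kappa x).
Proof.
move=> [hP kh injk QE KE] vP wQ K'E; set kappa' := fun x => _.
have hv : (h == v) = false by apply: contraNF vP => /eqP <-.
have neqv x : x \in P -> (x == v) = false by move=> xP; apply: contraNF vP => /eqP <-.
have kV x : x \in P -> x != h -> kappa' x = kappa x.
  by move=> xP xh; rewrite /kappa' (negbTE xh) neqv.
have kQ x : x \in P -> kappa x \in Q by move=> xP; rewrite QE imset_f.
split.
- by rewrite !inE hP orbT.
- by rewrite /kappa' hv eqxx.
- have key x : x \in v |: P -> [\/ x = v /\ kappa' x = kappa h, x = h /\ kappa' x = w |
      [/\ x \in P, x != h & kappa' x = kappa x]].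
    rewrite !inE => /orP [/eqP ->|xP]; first by constructor 1; rewrite /kappa' eqxx kh.
    have [->|xh] := eqVneq x h; first by constructor 2; rewrite /kappa' hv eqxx.
    by constructor 3; rewrite kV.
  move=> x y /key [[-> ->]|[-> ->]|[xP xh ->]] /key [[-> ->]|[-> ->]|[yP yh ->]] // e.
  + by move: wQ; rewrite -e kQ.
  + by rewrite -(injk _ _ hP yP e) eqxx in yh.
  + by move: wQ; rewrite e kQ.
  + by move: wQ; rewrite e kQ.
  + by rewrite (injk _ _ xP hP e) eqxx in xh.
  + by move: wQ; rewrite -e kQ.
  + exact: injk.
- apply/setP => y; rewrite imsetU imset_set1 /kappa' eqxx !inE QE.
  apply/orP/orP => [[/eqP ->|/imsetP [x xP ->]]|[/eqP ->|/imsetP [x xP ->]]].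
  + by right; apply/imsetP; exists h; rewrite // hv eqxx.
  + have [->|xh] := eqVneq x h; first by left; rewrite kh.
    by right; apply/imsetP; exists x => //; rewrite (neqv x xP) (negbTE xh).
  + by right; rewrite -kh imset_f.
  + have [xh|xh] := eqVneq x h; first by left; rewrite xh hv.
    by right; rewrite (neqv x xP) imset_f.
- move=> x y; rewrite K'E KE !inE; have [->|xv] := eqVneq x v.
    by rewrite (negbTE vP) /= orbF (eq_sym v h) hv /= /kappa' eqxx.
  rewrite /=; case xP: (x \in P) => //=; case xh: (x == h) => //=.
  by rewrite kV // xh.
Qed.

Lemma chained_link P Q K h h' kappa v w K' : paired P Q K h h' kappa -> chained P Q K h h' ->
  conn G v w -> (forall x y, K' x y = (x == v) && (y == h') || K x y) ->
  chained (v |: P) (w |: Q) K' h w.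
Proof.
move=> [hP kh injk QE KE] [fwd bwd] vw K'E.
have h'Q : h' \in Q by rewrite QE -kh imset_f.
have K'v : K' v h' by rewrite K'E !eqxx.
have K'K x y : K x y -> K' x y by rewrite K'E => ->; rewrite orbT.
split=> W clW clK hW.
  have [PW QW] := fwd W clW (fun x y Kxy => clK x y (K'K x y Kxy)) hW.
  have vW : v \in W by apply: clK K'v _; exact: (subsetP QW).
  have wW := conn_closed clW vw vW.
  by rewrite !subUset !sub1set vW wW.
have vW := conn_closed_rev clW vw hW.
have [PW QW] := bwd W clW (fun x y Kxy => clK x y (K'K x y Kxy)) (clK _ _ K'v vW).
by rewrite !subUset !sub1set vW hW.
Qed.

Lemma paired_add P Q K h h' kappa v w K' : paired P Q K h h' kappa -> v \notin P -> w \notin Q ->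
  (forall x y, K' x y = (x == v) && (y == w) || K x y) ->
  paired (v |: P) (w |: Q) K' h h' (fun x => if x == v then w else kappa x).
Proof.
move=> [hP kh injk QE KE] vP wQ K'E; set kappa' := fun x => _.
have hv : (h == v) = false by apply: contraNF vP => /eqP <-.
have kV x : x \in P -> kappa' x = kappa x.
  by move=> xP; rewrite /kappa' ifN //; apply: contraNneq vP => <-.
have kQ x : x \in P -> kappa x \in Q by move=> xP; rewrite QE imset_f.
split.
- by rewrite !inE hP orbT.
- by rewrite kV.
- move=> x y; rewrite !inE => /orP [/eqP ->|xP] /orP [/eqP ->|yP] //; rewrite ?(kV x) ?(kV y) //.
  + by rewrite /kappa' eqxx => e; move: wQ; rewrite e kQ.
  + by rewrite /kappa' eqxx => e; move: wQ; rewrite -e kQ.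
  + exact: injk.
- have kP : kappa' @: P = kappa @: P by apply: eq_in_imset => x xP; rewrite kV.
  by rewrite imsetU imset_set1 kP QE /kappa' eqxx.
- move=> x y; rewrite K'E KE !inE; have [->|xv] := eqVneq x v.
    by rewrite (negbTE vP) /= orbF (eq_sym v h) hv /= /kappa' eqxx.
  by rewrite /= /kappa' (negbTE xv).
Qed.

End PairingInvariant.

(* Arrays: 12 feedback pattern, 13 and 14 paired inputs and outputs.
   Registers: 9 flag for a chosen hub, 10 and 11 hub input and output. *)
Definition pair_loop cond step :=
  HFor 0 1 (HFor 1 1 (HWhen (HA 8 (HV 0)) (HWhen (HA 10 (HV 1))
    (HUnless (HA 13 (HV 0)) (HUnless (HA 14 (HV 1))
      (HWhen cond (HSeq (HPut 13 (HV 0) (HC 1)) (HSeq (HPut 14 (HV 1) (HC 1)) step)))))))).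

Definition chain_step :=
  HSeq (HIf (HV 9) (put2 12 (HV 0) (HV 11) (HC 1)) (HSeq (HSet 9 (HC 1)) (HSet 10 (HV 0)))) (HSet 11 (HV 1)).
Definition add_step :=
  HIf (HV 9) (put2 12 (HV 0) (HV 1) (HC 1)) (HSeq (HSet 9 (HC 1)) (HSeq (HSet 10 (HV 0)) (HSet 11 (HV 1)))).

Definition pairing :=
  HSeq (pair_loop (at2 1 (HV 1) (HV 0)) chain_step)
  (HSeq (pair_loop (HC 1) add_step) (put2 12 (HV 10) (HV 11) (HC 1))).

Definition mark i j s := set_a (set_a s 13 i 1) 14 j 1.

(** Marks are never removed, so one greedy pass is maximal: a pair passed over had a marked member
    already. *)
Lemma pair_loop_ind n cond step s (C : nat -> nat -> bool) (Inv : hstate -> Prop) :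
  ~~ assigns 0 step -> ~~ assigns 1 step -> (forall b, b \in [:: 1; 8; 10; 13; 14] -> ~~ puts b step) ->
  (forall s' i j, i < n -> j < n -> hr s' 0 = i -> hr s' 1 = j -> ha s' 1 = ha s 1 ->
     (heval n s' cond != 0) = C i j) ->
  (forall s' r v, r < 2 -> Inv s' -> Inv (set_r s' r v)) -> Inv s ->
  (forall s' i j, i < n -> j < n -> hr s' 0 = i -> hr s' 1 = j -> ha s 8 i != 0 -> ha s 10 j != 0 ->
     ha s' 13 i = 0 -> ha s' 14 j = 0 -> C i j -> Inv s' -> Inv (hrun n step (mark i j s'))) ->
  let s1 := hrun n (pair_loop cond step) s in
  Inv s1 /\ forall i j, i < n -> j < n -> ha s 8 i != 0 -> ha s 10 j != 0 -> C i j ->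
    (ha s1 13 i != 0) || (ha s1 14 j != 0).
Proof.
move=> st0 st1 stb condE Invr Inv0 InvS s1; rewrite /s1 {s1} /pair_loop.
set c := HWhen (HA 8 _) _; set c1 := HFor 1 1 c.
have c0 : ~~ assigns 0 c by rewrite /c /= !orbF.
have c1' : ~~ assigns 1 c by rewrite /c /= !orbF.
have cb b : b \in [:: 1; 8; 10] -> ~~ puts b c.
  move=> bb; rewrite /c /= !orbF !negb_or stb ?andbT; last first.
    by move: bb; rewrite !inE => /or3P [] /eqP ->.
  by move: bb; rewrite !inE => /or3P [] /eqP ->.
pose D s' i j := [&& ha s 8 i != 0, ha s 10 j != 0 & C i j] ->
  (ha s' 13 i != 0) || (ha s' 14 j != 0).
pose P i j s' := [/\ ha s' 1 = ha s 1 /\ ha s' 8 = ha s 8, ha s' 10 = ha s 10, Inv s' &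
  forall i' j', i' < n -> j' < n -> (i' < i) || (i' == i) && (j' < j) -> D s' i' j'].
suff [_ _ H1 H2] : P n 0 (hrun n (HFor 0 1 c1) s).
  split => // i j iN jN si sj Cij; apply: (H2 i j iN jN); first by rewrite iN.
  by rewrite si sj.
have := @hfor_inv n 0 1 c1 s (fun i s' => P i 0 s'); rewrite mul1n; apply.
- by rewrite /c1 /=; exact: c0.
- by move=> i s' v [Q1 Q2 Q3 Q4]; split => //; exact: Invr.
- by split => // i' j' _ _; rewrite ltn0 andbF.
move=> i s' iN ri _ HP.
suff [Q1 Q2 Q3 Q4] : P i n (hrun n c1 s').
  split => // i' j' iN' jN'; rewrite ltn0 andbF orbF => ii; apply: Q4 => //.
  by rewrite jN' andbT orbC -leq_eqVlt.
have := @hfor_inv n 1 1 c s' (fun j s2 => hr s2 0 = i /\ P i j s2); rewrite mul1n => H.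
have [] // : hr (hrun n c1 s') 0 = i /\ P i n (hrun n c1 s').
apply: H => //.
- by move=> j s2 v [Hr [Q1 Q2 Q3 Q4]]; split => //; split => //; exact: Invr.
move=> j s2 jN rj _ [ri2 [[Q1 Q8] Q10 Q3 Q4]].
have E : hrun n c s2 = if [&& ha s 8 i != 0, ha s 10 j != 0, ha s2 13 i == 0, ha s2 14 j == 0 & C i j]
    then hrun n step (mark i j s2) else s2.
  have B : hrun n (HSeq (HPut 13 (HV 0) (HC 1)) (HSeq (HPut 14 (HV 1) (HC 1)) step)) s2 =
    hrun n step (mark i j s2) by rewrite /= ri2 rj.
  move: B; rewrite /c /HWhen /HUnless; set body := HSeq (HPut 13 _ _) _; clearbody body => B.
  rewrite /= ri2 rj Q8 Q10 (condE s2 i j) //.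
  case: (ha s 8 i != 0) => //=; case: (ha s 10 j != 0) => //=.
  case: (ha s2 13 i == 0) => //=; case: (ha s2 14 j == 0) => //=.
  by case: (C i j).
split; first by rewrite hr_frame.
split.
- by rewrite !ha_frame // cb.
- by rewrite ha_frame // cb.
- rewrite E; case: ifP => // /and5P [si sj p13 p14 Cij]; apply: InvS => //; exact/eqP.
move=> i' j' iN' jN' lt.
have mono b x : b \in [:: 13; 14] -> ha s2 b x != 0 -> ha (hrun n c s2) b x != 0.
  rewrite E => bb h0; case: ifP => [_|//]; rewrite ha_frame; last first.
    by apply: stb; move: bb; rewrite !inE => /orP [] /eqP ->.
  by move: bb h0; rewrite !inE => /orP [] /eqP -> h0; rewrite /= /upd; case: ifP.
have old : (i' < i) || (i' == i) && (j' < j) -> D (hrun n c s2) i' j'.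
  by move=> lt' /(Q4 i' j' iN' jN' lt') /orP [/(mono 13 _ isT) ->|/(mono 14 _ isT) ->]; rewrite ?orbT.
have [/andP [/eqP -> /eqP ->]|neq] := boolP ((i' == i) && (j' == j)); last by apply: old; lia.
move=> /and3P [si sj Cij].
have [p13|p13] := eqVneq (ha s2 13 i) 0; last by rewrite (mono 13 i isT p13).
have [p14|p14] := eqVneq (ha s2 14 j) 0; last by rewrite (mono 14 j isT p14) orbT.
by rewrite E si sj p13 p14 Cij /= ha_frame ?stb //= /upd eqxx.
Qed.


Section PairingState.
Variables (n : nat) (A : 'M[bool]_n) (S T : {set 'I_n}).
Implicit Types (P Q : {set 'I_n}) (h : 'I_n) (kappa : 'I_n -> 'I_n) (s : hstate).

Definition marked b s : {set 'I_n} := [set v : 'I_n | ha s b v != 0].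
Definition linked s (v w : 'I_n) := ha s 12 (v * n + w) != 0.

Lemma marked_upd b s s' (v : 'I_n) : ha s' b = upd (ha s b) v 1 -> marked b s' = v |: marked b s.
Proof.
move=> E; apply/setP => x; rewrite !inE E /upd; have [->|xv] := eqVneq x v; first by rewrite eqxx.
by rewrite ifN.
Qed.

Lemma linked_upd s s' (v w : 'I_n) : ha s' 12 = upd (ha s 12) (v * n + w) 1 ->
  forall x y, linked s' x y = (x == v) && (y == w) || linked s x y.
Proof.
move=> E x y; rewrite /linked E /upd rowmajor_inj //.
by rewrite !(inj_eq val_inj); case: (_ && _).
Qed.

(** Only the values of [kappa] on [P] enter, so this survives the later pairs that extend
    [kappa]. *)
Definition hub_chain P kappa h h' :=
  [/\ h \in P,
      forall W : {set 'I_n}, (forall i j, i \in W -> A j i -> j \in W) ->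
        (forall i, i \in P -> i != h -> kappa i \in W -> i \in W) -> h \in W -> P \subset W &
      forall W : {set 'I_n}, (forall i j, i \in W -> A i j -> j \in W) ->
        (forall i, i \in P -> i != h -> i \in W -> kappa i \in W) -> h' \in W -> kappa @: P \subset W].

Lemma hub_chain_paired P Q K h h' kappa :
  paired P Q K h h' kappa -> chained A P Q K h h' -> hub_chain P kappa h h'.
Proof.
move=> [hP _ _ QE KE] [fwd bwd]; split => // W clW clK hW.
  have [] // := fwd W clW _ hW => v w; rewrite KE => /and3P [vP vh /eqP ->]; exact: clK.
have [] // := bwd W clW _ hW; last by rewrite QE.
move=> v w; rewrite KE => /and3P [vP vh /eqP ->]; exact: clK.
Qed.

Lemma hub_chain_eq P kappa kappa' h h' : {in P, kappa' =1 kappa} ->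
  hub_chain P kappa h h' -> hub_chain P kappa' h h'.
Proof.
move=> E [hP fwd bwd]; split => // W clW clK hW.
  by apply: fwd => // i iP ih; rewrite -E //; exact: clK.
by rewrite (eq_in_imset E); apply: bwd => // i iP ih; rewrite -E //; exact: clK.
Qed.

(** Until a hub is chosen, registers 10 and 11 contain 0; vertex 0 therefore becomes the hub when
    [S] is empty. *)
Definition pair_inv D0 (D : {set 'I_n} -> {set 'I_n} -> ('I_n -> 'I_n -> bool) -> 'I_n -> 'I_n ->
    ('I_n -> 'I_n) -> Prop) s :=
  [/\ marked 13 s \subset S, marked 14 s \subset T &
    if hr s 9 == 0 then
      [/\ marked 13 s = set0 /\ marked 14 s = set0, forall v w, linked s v w = false,
          hr s 10 = 0 /\ hr s 11 = 0 & D0]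
    else exists h h' kappa, [/\ hr s 10 = h, hr s 11 = h',
      paired (marked 13 s) (marked 14 s) (linked s) h h' kappa &
      D (marked 13 s) (marked 14 s) (linked s) h h' kappa]].

Definition chain_inv := pair_inv True (fun P Q K h h' _ => chained A P Q K h h').
Definition add_inv P1 Q1 := pair_inv (P1 = set0 /\ Q1 = set0) (fun P Q K h h' kappa =>
  [/\ P1 \subset P, Q1 = kappa @: P1 & P1 != set0 -> hub_chain P1 kappa h h']).

Lemma chain_step_inv s (v w : 'I_n) : hr s 0 = v -> hr s 1 = w -> v \in S -> w \in T ->
  ha s 13 v = 0 -> ha s 14 w = 0 -> conn A v w -> chain_inv s ->
  chain_inv (hrun n chain_step (mark v w s)).
Proof.
move=> r0 r1 vS wT v0 w0 vw [PS QT I]; set s1 := hrun _ _ _.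
have m13 : marked 13 s1 = v |: marked 13 s by apply: marked_upd; rewrite /s1 ha_frame.
have m14 : marked 14 s1 = w |: marked 14 s by apply: marked_upd; rewrite /s1 ha_frame.
have vP : v \notin marked 13 s by rewrite inE v0.
have wQ : w \notin marked 14 s by rewrite inE w0.
split; rewrite ?m13 ?m14 ?subUset ?sub1set ?vS ?wT //.
move: I; case: (eqVneq (hr s 9) 0) => [r9 [[-> ->] K0 _ _]|r9 [h [h' [kappa [r10 r11 pr ch]]]]].
  have E12 : ha s1 12 = ha s 12 by rewrite /s1 /= r9.
  have K1 x y : linked s1 x y = false by rewrite /linked E12; exact: K0.
  have [-> -> ->] : [/\ hr s1 9 = 1, hr s1 10 = v & hr s1 11 = w].
    by rewrite /s1 /= r9 /= /upd /= r0 r1.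
  exists v, w, (fun=> w); rewrite !setU0; split => //; [exact: paired_start|exact: chained_start].
have E12 : ha s1 12 = upd (ha s 12) (v * n + h') 1.
  by rewrite /s1 /= r9 /= r0 r11 lt2n.
have K1 := linked_upd E12.
have [-> -> ->] : [/\ hr s1 9 = hr s 9, hr s1 10 = h & hr s1 11 = w].
  by rewrite /s1 /= r9 /= /upd /= r1 r10.
rewrite (negbTE r9); exists h, w; eexists; split => //.
  exact: paired_link pr vP wQ K1.
exact: chained_link pr ch vw K1.
Qed.

Lemma add_step_inv P1 Q1 s (v w : 'I_n) : hr s 0 = v -> hr s 1 = w -> v \in S -> w \in T ->
  ha s 13 v = 0 -> ha s 14 w = 0 -> add_inv P1 Q1 s -> add_inv P1 Q1 (hrun n add_step (mark v w s)).
Proof.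
move=> r0 r1 vS wT v0 w0 [PS QT I]; set s1 := hrun _ _ _.
have m13 : marked 13 s1 = v |: marked 13 s by apply: marked_upd; rewrite /s1 ha_frame.
have m14 : marked 14 s1 = w |: marked 14 s by apply: marked_upd; rewrite /s1 ha_frame.
have vP : v \notin marked 13 s by rewrite inE v0.
have wQ : w \notin marked 14 s by rewrite inE w0.
split; rewrite ?m13 ?m14 ?subUset ?sub1set ?vS ?wT //.
move: I; case: (eqVneq (hr s 9) 0) => [r9 [[-> ->] K0 _ [P0 Q0]]|r9 [h [h' [kappa [r10 r11 pr]]]]].
  have E12 : ha s1 12 = ha s 12 by rewrite /s1 /= r9.
  have K1 x y : linked s1 x y = false by rewrite /linked E12; exact: K0.
  have [-> -> ->] : [/\ hr s1 9 = 1, hr s1 10 = v & hr s1 11 = w].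
    by rewrite /s1 /= r9 /= /upd /= r0 r1.
  exists v, w, (fun=> w); rewrite !setU0; split => //; first exact: paired_start.
  by rewrite P0 Q0 sub0set imset0 eqxx.
move=> [sub QE ch].
have E12 : ha s1 12 = upd (ha s 12) (v * n + w) 1.
  by rewrite /s1 /= r9 /= r0 r1 lt2n.
have K1 := linked_upd E12.
have [-> -> ->] : [/\ hr s1 9 = hr s 9, hr s1 10 = h & hr s1 11 = h'].
  by rewrite /s1 /= r9 /= r10 r11.
rewrite (negbTE r9); exists h, h', (fun x => if x == v then w else kappa x); split => //.
  exact: paired_add pr vP wQ K1.
have E : {in P1, (fun x => if x == v then w else kappa x) =1 kappa}.
  by move=> x xP; rewrite ifN //; apply: contraNneq vP => <-; exact: (subsetP sub).
split; first exact: subset_trans sub (subsetUr _ _).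
  by rewrite (eq_in_imset E).
by move=> /ch; exact: hub_chain_eq.
Qed.

End PairingState.

Lemma conn_trmx n (A : 'M[bool]_n) x y : conn (trmx A) x y = conn A y x.
Proof.
have imp (B : 'M[bool]_n) u v : conn (trmx B) u v -> conn B v u.
  case/connectP => p + ->; elim: p u => [|z p IH] u /=; first by move=> _; exact: connect0.
  case/andP => + /IH Bzu; rewrite mxE => Buz; apply: connect_trans Bzu _; exact: connect1.
by apply/idP/idP => [/imp //|]; rewrite -{1}[A]trmxK => /imp.
Qed.

Lemma pair_inv_set_r n (S T : {set 'I_n}) D0 D s r v : r < 2 ->
  pair_inv S T D0 D s -> pair_inv S T D0 D (set_r s r v).
Proof. by case: r => [|[|]]. Qed.

Theorem pairing_spec n (A : 'M[bool]_n) (S T : {set 'I_n}) s : 0 < n ->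
  (forall i : 'I_n, (ha s 8 i != 0) = (i \in S)) -> (forall i : 'I_n, (ha s 10 i != 0) = (i \in T)) ->
  (forall i j : 'I_n, (ha s 1 (i * n + j) != 0) = conn (trmx A) i j) -> #|S| = #|T| ->
  (forall b a, b \in [:: 12; 13; 14] -> ha s b a = 0) -> (forall q, q \in [:: 9; 10; 11] -> hr s q = 0) ->
  let s1 := hrun n pairing s in
  exists (P : {set 'I_n}) (h h' : 'I_n) (kappa : 'I_n -> 'I_n),
  [/\ forall v w : 'I_n, (ha s1 12 (v * n + w) != 0) = (v \in S) && (w == kappa v) || (v == h) && (w == h'),
      hr s1 10 = h /\ hr s1 11 = h',
      {in S &, injective kappa} /\ kappa @: S = T,
      S != set0 -> h \in S /\ kappa h = h' &
      [/\ P \subset S,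
          forall v w, v \in S -> w \in S -> v \notin P -> w \notin P -> conn A v (kappa w) -> False &
          P != set0 -> hub_chain A P kappa h h']].
Proof.
move=> n0 aS aT aR cardST az rz s1.
pose sa := hrun n (pair_loop (at2 1 (HV 1) (HV 0)) chain_step) s.
pose sb := hrun n (pair_loop (HC 1) add_step) sa.
have inS i : i < n -> ha s 8 i != 0 -> exists2 v : 'I_n, v = i :> nat & v \in S.
  by move=> iN ai; exists (Ordinal iN); rewrite -?aS.
have inT i : i < n -> ha s 10 i != 0 -> exists2 v : 'I_n, v = i :> nat & v \in T.
  by move=> iN ai; exists (Ordinal iN); rewrite -?aT.
have z0 b : b \in [:: 13; 14] -> marked n b s = set0.
  by move=> bb; apply/setP => x; rewrite !inE az // inE bb orbT.
have Inv0 : chain_inv A S T s.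
  split; rewrite ?z0 ?sub0set //= rz //; split; rewrite ?rz // => v w.
  by rewrite /linked az.
have [|||||||I1 M1] := @pair_loop_ind n (at2 1 (HV 1) (HV 0)) chain_step s
    (fun i j => ha s 1 (j * n + i) != 0) (chain_inv A S T).
- by [].
- by [].
- by move=> b; rewrite !inE => /or4P [| | |/orP []] /eqP ->.
- by move=> s' i j iN jN r0 r1 e1; rewrite /= r0 r1 e1 lt2n.
- by move=> s' r v r2; exact: pair_inv_set_r.
- exact: Inv0.
- move=> s' i j iN jN r0 r1 /(inS i iN) [v vi vS] /(inT j jN) [w wj wT] p13 p14.
  rewrite -vi -wj aR conn_trmx => vw; apply: chain_step_inv => //; rewrite ?vi ?wj //.
rewrite -/sa in I1 M1.
set P1 := marked n 13 sa; set Q1 := marked n 14 sa.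
have far v w : v \in S -> w \in T -> conn A v w -> (v \in P1) || (w \in Q1).
  by move=> vS wT vw; have := M1 v w (ltn_ord v) (ltn_ord w); rewrite aS aT aR conn_trmx !inE; apply.
have Inv1 : add_inv A S T P1 Q1 sa.
  case: I1 => PS QT I; split => //; move: I; case: ifP => _; first by case=> P0 K0 r _; split.
  move=> [h [h' [kappa [r10 r11 pr ch]]]]; exists h, h', kappa; split => //.
  split; [by []|by case: pr|move=> _].
  exact: hub_chain_paired pr ch.
have k8 b : b \in [:: 8; 10] -> ha sa b = ha s b.
  by rewrite !inE => /orP [] /eqP ->; rewrite /sa ha_frame.
have [|||||||I2 M2] := @pair_loop_ind n (HC 1) add_step sa (fun i j => true) (add_inv A S T P1 Q1).
- by [].
- by [].
- by move=> b; rewrite !inE => /or4P [| | |/orP []] /eqP ->.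
- by [].
- by move=> s' r v r2; exact: pair_inv_set_r.
- exact: Inv1.
- move=> s' i j iN jN r0 r1; rewrite !k8 // => /(inS i iN) [v vi vS] /(inT j jN) [w wj wT] p13 p14 _.
  by rewrite -vi -wj; apply: add_step_inv => //; rewrite ?vi ?wj.
rewrite -/sb in I2 M2; rewrite !k8 // in M2.
have [PS QT I] := I2.
have cover v w : v \in S -> w \in T -> (v \in marked n 13 sb) || (w \in marked n 14 sb).
  by move=> vS wT; have := M2 v w (ltn_ord v) (ltn_ord w); rewrite aS aT !inE; apply.
(* The second pass admits every pair, so it exhausts one side, and by equal cardinalities both. *)
have full : #|marked n 13 sb| = #|marked n 14 sb| -> marked n 13 sb = S /\ marked n 14 sb = T.
  move=> cPQ; have PE : marked n 13 sb = S.
    apply/eqP; rewrite eqEsubset PS; apply/subsetP => v vS; apply: contraT => vP.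
    have TQ : T \subset marked n 14 sb.
      by apply/subsetP => w wT; have := cover v w vS wT; rewrite (negbTE vP).
    have : #|S| <= #|marked n 13 sb| by rewrite cPQ cardST subset_leq_card.
    by move=> le; have /eqP E : marked n 13 sb == S; [rewrite eqEcard PS le|rewrite E vS in vP].
  by split => //; apply/eqP; rewrite eqEcard QT -cPQ PE cardST leqnn.
have s1E : s1 = hrun n (put2 12 (HV 10) (HV 11) (HC 1)) sb by [].
have r10E : hr s1 10 = hr sb 10 by [].
have r11E : hr s1 11 = hr sb 11 by [].
clearbody s1 sb.
have K1 (h h' : 'I_n) : hr sb 10 = h -> hr sb 11 = h' -> forall v w : 'I_n,
    (ha s1 12 (v * n + w) != 0) = (v == h) && (w == h') || linked sb v w.
  move=> r10 r11; apply: linked_upd; rewrite s1E /= r10 r11 lt2n //.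
rewrite r10E r11E; move: I; case: ifP => _.
  case=> [[P0 Q0]] K0 [r10 r11] [P10 Q10]; pose o := Ordinal n0.
  have [|SE TE] := full; first by rewrite P0 Q0.
  rewrite P0 in SE; rewrite Q0 in TE.
  exists set0, o, o, id; rewrite -SE -TE; split => //.
  - by move=> v w; rewrite (K1 o o) // K0 orbF !inE.
  - by split; [move=> x y; rewrite inE|rewrite imset0].
  - by rewrite eqxx.
  - by split; [|move=> v w; rewrite inE|rewrite eqxx].
move=> [h [h' [kappa [r10 r11 [hP kh injk QE KE] [sub Q1E ch]]]]].
have [|SE TE] := full; first by rewrite QE card_in_imset.
rewrite SE in hP injk QE KE sub; rewrite TE in QE.
exists P1, h, h', kappa; split => //.
- move=> v w; rewrite (K1 h h') // KE; case: (eqVneq v h) => [->|vh] /=; last by rewrite orbF.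
  by rewrite hP kh orbF orbb.
- split => // v w vS wS vP wP vw.
  have kT : kappa w \in T by rewrite QE imset_f.
  (* An output marked in the first pass is the image of a chained input, which by injectivity is
     [w]. *)
  have := far v (kappa w) vS kT vw; rewrite (negbTE vP) Q1E /= => /imsetP [x xP e].
  by rewrite (injk w x wS (subsetP sub x xP) e) xP in wP.
Qed.

End Pairing.

(** * Optimality of the computed patterns *)

Section Optimality.
Local Open Scope nat_scope.
Variables (R : realType) (n : nat).
Implicit Types (A M : 'M[bool]_n) (S T U : {set 'I_n}) (s : {perm 'I_n}).

Definition diag_pattern U : 'M[bool]_n := \matrix_(i, j) ((i == j) && (i \in U)).

Lemma trmx_diag_pattern U : trmx (diag_pattern U) = diag_pattern U.
Proof. by apply/matrixP => i j; rewrite !mxE; case: eqVneq => // ->. Qed.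

Lemma nnz_trmx M : nnz (trmx M) = nnz M.
Proof.
pose f (ij : 'I_n * 'I_n) := (ij.2, ij.1).
have injf : injective f by move=> [a b] [c d] [-> ->].
rewrite /nnz -[RHS](card_imset _ injf); apply: eq_card => [[i j]].
rewrite !inE /= mxE; apply/idP/imsetP => [Mji|[[a b] + [-> ->]]]; last by rewrite inE.
by exists (j, i); rewrite ?inE.
Qed.

Lemma nnz_diag_pattern U : nnz (diag_pattern U) <= #|U|.
Proof.
apply: leq_trans (leq_imset_card (fun i => (i, i)) _); apply/subset_leq_card/subsetP => [[i j]].
by rewrite inE mxE /= => /andP [/eqP <- iU]; rewrite imset_f.
Qed.

Lemma matched_complement S T (f : 'I_n -> 'I_n) s : {in ~: S &, injective f} ->
  (forall x, x \notin S -> f x \notin T) -> #|S| = #|T| -> {in ~: S, s =1 f} ->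
  forall x, (s x \in T) = (x \in S).
Proof.
move=> injf fT cST sf.
have sub : [set s x | x in ~: S] \subset ~: T.
  by apply/subsetP => _ /imsetP [x xS ->]; rewrite inE sf // fT // -in_setC.
have E : [set s x | x in ~: S] = ~: T.
  apply/eqP; rewrite eqEcard sub card_imset; last exact: perm_inj.
  by rewrite [#|~: T|]cardsCs [#|~: S|]cardsCs !setCK cST leqnn.
move=> x; apply: negb_inj; rewrite -!in_setC -E mem_imset //; exact: perm_inj.
Qed.

Lemma matchable_perm A S s : (forall x, x \notin S -> A x (s x)) -> matchable A S.
Proof. by move=> As; exists s => // x y _ _; exact: perm_inj. Qed.

Lemma matchable_perm_inv A S T s : (forall x, x \notin S -> A x (s x)) ->
  (forall x, (s x \in T) = (x \in S)) -> matchable (trmx A) T.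
Proof.
move=> As sT; apply: (@matchable_perm _ _ (s^-1)%g) => x.
by rewrite mxE -{1 3}[x](permKV s) sT; exact: As.
Qed.

Lemma minimal_dedicated_inputs A S Sx : matchable A S -> reaching A (S :|: Sx) ->
  (forall S', matchable A S' -> reaching A S' -> #|S| + #|Sx| <= #|S'|) ->
  structurally_controllable R A (diag_pattern (S :|: Sx)) /\
  forall B' : 'M[bool]_n, structurally_controllable R A B' -> nnz (diag_pattern (S :|: Sx)) <= nnz B'.
Proof.
move=> mS reach min; split.
  by apply: graph_structurally_controllable => //; apply: matchableS mS; exact: subsetUl.
move=> B' /structurally_controllable_graph [mB rB].
apply: leq_trans (nnz_diag_pattern _) _; apply: leq_trans (leq_card_setU _ _) _.
exact: leq_trans (min _ mB rB) (card_row_support B').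
Qed.

Lemma minimal_P1 A S Sx T Tx s : (forall x, x \notin S -> A x (s x)) ->
  (forall x, (s x \in T) = (x \in S)) ->
  reaching A (S :|: Sx) -> reaching (trmx A) (T :|: Tx) ->
  (forall S', matchable A S' -> reaching A S' -> #|S| + #|Sx| <= #|S'|) ->
  (forall T', matchable (trmx A) T' -> reaching (trmx A) T' -> #|T| + #|Tx| <= #|T'|) ->
  solves_P1 R A (diag_pattern (S :|: Sx)) (diag_pattern (T :|: Tx)).
Proof.
move=> As sT reachS reachT minS minT.
have [c1 c2] := minimal_dedicated_inputs (matchable_perm As) reachS minS.
have [o1 o2] := minimal_dedicated_inputs (matchable_perm_inv As sT) reachT minT.
split => //; first by rewrite /structurally_observable trmx_diag_pattern.
by move=> C' /o2; rewrite nnz_trmx.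
Qed.

Lemma P1_dedicated A U V : solves_P1 R A (diag_pattern U) (diag_pattern V) ->
  solves_P1d R A (diag_pattern U) (diag_pattern V).
Proof.
case=> c1 c2 o1 o2; split; try by move=> M /c2.
- split => // j; rewrite -(cards1 j); apply/subset_leq_card/subsetP => i.
  by rewrite !inE mxE => /andP [].
- split => // i; rewrite -(cards1 i); apply/subset_leq_card/subsetP => j.
  by rewrite !inE mxE eq_sym => /andP [].
- by move=> M /o2.
Qed.

Lemma nnz_hub_inputs S Sx (h : 'I_n) : nnz (hub_inputs S Sx h) <= #|S| + #|Sx|.
Proof.
pose f (i : 'I_n) := (i, i); pose g (i : 'I_n) := (i, h).
apply: (@leq_trans #|f @: S :|: g @: Sx|).
  apply/subset_leq_card/subsetP => [[i j]]; rewrite !inE mxE /=.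
  case/orP => /andP []; first by move/eqP <- => iS; rewrite (imset_f f iS).
  by move=> iS /eqP ->; rewrite (imset_f g iS) orbT.
by apply: leq_trans (leq_card_setU _ _) _; apply: leq_add; exact: leq_imset_card.
Qed.

Lemma nnz_hub_feedback S s (h h' : 'I_n) : (S != set0 -> h \in S /\ s h = h') ->
  nnz (hub_feedback S s h h') <= maxn #|S| 1.
Proof.
pose f (i : 'I_n) := (i, s i); have [-> _|S0 /(_ isT) [hS <-]] := eqVneq S set0.
  apply: leq_trans (leq_maxr _ _); rewrite -(cards1 (h, h')).
  apply/subset_leq_card/subsetP => [[i j]]; rewrite !inE mxE /= inE.
  by case/andP => /eqP -> /eqP ->.
apply: leq_trans (leq_maxl _ _); apply: leq_trans (leq_imset_card f _).
apply/subset_leq_card/subsetP => [[i j]]; rewrite !inE mxE /=.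
case/orP => /andP [iS /eqP ->]; first by rewrite (imset_f f iS).
by rewrite (eqP iS) (imset_f f hS).
Qed.

(** Each of the three patterns meets its own bound from [no_fixed_modes_graph], so the sum is
    minimal although they are chosen together. *)
Lemma minimal_P2 A S Sx T Tx (P : {set 'I_n}) (h h' : 'I_n) s :
  (forall x, x \notin S -> A x (s x)) -> (forall x, (s x \in T) = (x \in S)) ->
  reaching A (S :|: Sx) -> reaching (trmx A) (T :|: Tx) ->
  (forall S', matchable A S' -> reaching A S' -> #|S| + #|Sx| <= #|S'|) ->
  (forall T', matchable (trmx A) T' -> reaching (trmx A) T' -> #|T| + #|Tx| <= #|T'|) ->
  (forall S', matchable A S' -> #|S| <= #|S'|) ->
  (S != set0 -> h \in S /\ s h = h') -> P \subset S ->
  (forall v w, v \in S -> w \in S -> v \notin P -> w \notin P -> conn A v (s w) -> False) ->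
  (P != set0 -> hub_chain A P s h h') ->
  solves_P2 R A (hub_inputs S Sx h) (hub_feedback S s h h') (trmx (hub_inputs T Tx h')).
Proof.
move=> As sT reachS reachT minS minT minK hubS PS far chain.
have hP : P != set0 -> h \in P by case/chain.
have Pn0 x : x \in P -> P != set0 by move=> xP; apply/set0Pn; exists x.
have reach1 : hub_reaching A S Sx s h.
  apply: (hub_reaching_of_pairing reachS far) => // W clW clK /Pn0 /chain [_ fwd _].
  exact: fwd.
(* The transposed system is the same construction for the inverse permutation, with the chained
   outputs as chained inputs. *)
have reach2 : hub_reaching (trmx A) T Tx (s^-1)%g h'.
  apply: (@hub_reaching_of_pairing _ _ _ _ (s @: P)) => //.
  - move=> v w; rewrite -{1 2 3}[v](permKV s) -{1 2}[w](permKV s) !sT.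
    rewrite !mem_imset ?conn_trmx; try exact: perm_inj.
    by move=> vS wS vP wP; exact: far.
  - case/set0Pn => _ /imsetP [x xP _]; have [|_ <-] := hubS.
      by apply/set0Pn; exists x; exact: (subsetP PS).
    by rewrite imset_f // hP // (Pn0 x).
  - by apply/subsetP => _ /imsetP [x xP ->]; rewrite sT (subsetP PS).
  - move=> W clW clK /imsetP [x /Pn0 Pne _] hW; have [hP' _ bwd] := chain Pne.
    have [|_ sh] := hubS; first by apply/set0Pn; exists h; exact: (subsetP PS).
    apply: bwd => // [i j iW Aij|i iP ih iW]; first by apply: clW iW _; rewrite mxE.
    apply: clK; rewrite ?imset_f // ?permK //.
    by rewrite -sh (inj_eq perm_inj).
split; first exact: hub_no_fixed_modes As sT reach1 reach2.
move=> B' K' C' /no_fixed_modes_graph [[S1 [m1 r1 c1]] [T1 [m2 r2 c2]] [S2 m3 c3] K0].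
rewrite nnz_trmx; apply: leq_add; [apply: leq_add|].
- exact: leq_trans (nnz_hub_inputs _ _ _) (leq_trans (minS _ m1 r1) c1).
- exact: leq_trans (nnz_hub_inputs _ _ _) (leq_trans (minT _ m2 r2) c2).
apply: leq_trans (nnz_hub_feedback hubS) _; rewrite geq_max (leq_trans (minK _ m3) c3).
by apply: K0; exact: leq_ltn_trans (ltn_ord h).
Qed.

End Optimality.

(** No vertex can serve as hub here, but the empty matrix has no eigenvalue. *)
Lemma solves_P2_dim0 (R : realType) (A B K C : 'M[bool]_0) : solves_P2 R A B K C.
Proof.
split; last by move=> B' K' C'; rewrite !(thinmx0 B, thinmx0 K, thinmx0 C, thinmx0 B', thinmx0 K', thinmx0 C').
move=> sfm; have z M : structural_class M (0 : 'M[R]_0)%R by move=> i; case: i.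
have [x /(_ _ (z K))] := sfm _ _ _ (z A) (z B) (z C).
by rewrite /spectrum /= /eigenvalue /eigenspace (thinmx0 (kermx _)) eqxx.
Qed.

(** * Writing the output matrices *)

Section Output.
Local Open Scope nat_scope.

(* A test is a branching command that awaits its two outcomes: conditional writes replace
   Boolean values, which the machine's arithmetic cannot combine. *)
Definition test := hcmd -> hcmd -> hcmd.
Definition tif e : test := fun c1 c0 => HIf e c1 c0.
Definition teq e1 e2 : test := fun c1 c0 => HIf (HAdd (HSub e1 e2) (HSub e2 e1)) c0 c1.
Definition tand (t1 t2 : test) : test := fun c1 c0 => t1 (t2 c1 c0) c0.
Definition tor (t1 t2 : test) : test := fun c1 c0 => t1 c1 (t2 c1 c0).

Definition decides n (t : test) s (b : bool) :=
  forall c1 c0, hrun n (t c1 c0) s = hrun n (if b then c1 else c0) s.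

Lemma decides_if n e s : decides n (tif e) s (heval n s e != 0).
Proof. by move=> c1 c0; rewrite /tif /=; case: ifP. Qed.

Lemma decides_eq n e1 e2 s : decides n (teq e1 e2) s (heval n s e1 == heval n s e2).
Proof.
move=> c1 c0; rewrite /teq /= addn_eq0 !subn_eq0 -eqn_leq.
by case: eqP.
Qed.

Lemma decides_and n t1 t2 s b1 b2 : decides n t1 s b1 -> decides n t2 s b2 ->
  decides n (tand t1 t2) s (b1 && b2).
Proof. by move=> D1 D2 c1 c0; rewrite /tand D1; case: (b1). Qed.

Lemma decides_or n t1 t2 s b1 b2 : decides n t1 s b1 -> decides n t2 s b2 ->
  decides n (tor t1 t2) s (b1 || b2).
Proof. by move=> D1 D2 c1 c0; rewrite /tor D1; case: (b1). Qed.

Definition emit_entry off (t : test) :=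
  t (HWrite (HAdd off (HAdd (HRow (HV 0)) (HV 1))) (HC 1))
    (HWrite (HAdd off (HAdd (HRow (HV 0)) (HV 1))) (HC 0)).

Definition emit off t := HFor 0 1 (HFor 1 1 (emit_entry off t)).

Definition indexed (s s' : hstate) i j :=
  [/\ forall b, ha s' b = ha s b, forall q, q \notin [:: 0; 1] -> hr s' q = hr s q,
      hr s' 0 = i & hr s' 1 = j].

Lemma emit_spec n off o t (F : nat -> nat -> bool) s :
  (forall s', heval n s' off = o) -> o + n * n <= 3 * (n * n) ->
  (forall q, ~~ assigns q (emit_entry off t)) -> (forall b, ~~ puts b (emit_entry off t)) ->
  (forall s' i j, i < n -> j < n -> indexed s s' i j -> decides n t s' (F i j)) ->
  let s1 := hrun n (emit off t) s in
  [/\ forall i j, i < n -> j < n -> hm s1 (o + (i * n + j)) = F i j,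
      forall a, a < o \/ o + n * n <= a -> hm s1 a = hm s a &
      forall b, ha s1 b = ha s b] /\ forall q, q \notin [:: 0; 1] -> hr s1 q = hr s q.
Proof.
move=> offE bound areg aput D s1; rewrite /s1 /emit {s1}.
have [||||H1 H2] := @fill2 n 0 1 (emit_entry off t) s hm o (fun i j => F i j) reg_free_hm.
- exact: areg.
- exact: areg.
- by [].
- move=> i j s' iN jN r0 r1 [ka kr _] _ a.
  rewrite /emit_entry (D s' i j) //; last by split => // [b|q q01]; [exact: ka|exact: kr].
  have lt : o + (i * n + j) < 3 * (n * n).
    by apply: leq_trans bound; rewrite -addnS leq_add2l; nia.
  by case: (F i j); rewrite /= offE r0 r1 lt2n // lt /= /upd.
split; first split => //.
- by move=> a aout; apply: H2; apply/orP.
- by move=> b; rewrite ha_frame //=.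
- by move=> q; rewrite !inE negb_or => /andP [q0 q1]; rewrite hr_frame //= !negb_or !(eq_sym _ q) q0 q1 areg.
Qed.

Definition tmember b r := tif (HA b (HV r)).
Definition tdiag t := tand (teq (HV 0) (HV 1)) t.

(** [HRow HN] is [n * n]: the offset table contains index [n] if [n > 0], and for [n = 0] the
    default 0 is right. The output overwrites the input, which has been copied into an array by
    then. *)
Definition program_P1 := HSeq both_sides
  (HSeq (emit (HC 0) (tdiag (tor (tmember 8 0) (tmember 9 0))))
        (emit (HRow HN) (tdiag (tor (tmember 10 0) (tmember 11 0))))).

Definition program_P2 := HSeq both_sides (HSeq pairing
  (HSeq (emit (HC 0) (tor (tdiag (tmember 8 0)) (tand (tmember 9 0) (teq (HV 1) (HV 10)))))
  (HSeq (emit (HRow HN) (tif (at2 12 (HV 0) (HV 1))))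
        (emit (HAdd (HRow HN) (HRow HN))
           (tor (tdiag (tmember 10 1)) (tand (tmember 11 1) (teq (HV 0) (HV 11)))))))).

Lemma program_P1E n s : hrun n program_P1 s =
  hrun n (emit (HRow HN) (tdiag (tor (tmember 10 0) (tmember 11 0))))
    (hrun n (emit (HC 0) (tdiag (tor (tmember 8 0) (tmember 9 0)))) (hrun n both_sides s)).
Proof. by []. Qed.

Lemma program_P2E n s : hrun n program_P2 s =
  hrun n (emit (HAdd (HRow HN) (HRow HN))
      (tor (tdiag (tmember 10 1)) (tand (tmember 11 1) (teq (HV 0) (HV 11)))))
    (hrun n (emit (HRow HN) (tif (at2 12 (HV 0) (HV 1))))
    (hrun n (emit (HC 0) (tor (tdiag (tmember 8 0)) (tand (tmember 9 0) (teq (HV 1) (HV 10)))))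
    (hrun n pairing (hrun n both_sides s)))).
Proof. by []. Qed.

Lemma program_P1_wf : wfc program_P1 /\ depth program_P1 <= 3.
Proof. by []. Qed.

Lemma program_P2_wf : wfc program_P2 /\ depth program_P2 <= 3.
Proof. by []. Qed.

Lemma decides_member n b r s : decides n (tmember b r) s (ha s b (hr s r) != 0).
Proof. exact: decides_if. Qed.

Lemma decides_diag n t s b : decides n t s b -> decides n (tdiag t) s ((hr s 0 == hr s 1) && b).
Proof. by apply: decides_and; exact: decides_eq. Qed.

Lemma state_perm n (A : 'M[bool]_n) (S T : {set 'I_n}) (f : 'I_n -> 'I_n) : {in ~: S &, injective f} ->
  (forall x, x \notin S -> A x (f x) /\ f x \notin T) -> #|S| = #|T| ->
  exists s : {perm 'I_n}, (forall x, x \notin S -> A x (s x)) /\ forall x, (s x \in T) = (x \in S).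
Proof.
move=> injf Af cST; have [s sf] := perm_extension injf; exists s; split.
  by move=> x xS; rewrite sf ?inE //; case: (Af x xS).
by apply: matched_complement injf _ cST sf => x /Af [].
Qed.

Lemma program_P1_spec (R : realType) n (A : 'M[bool]_n) :
  let s := hrun n program_P1 (hinit A) in
  exists U V : {set 'I_n}, solves_P1 R A (diag_pattern U) (diag_pattern V) /\
    forall i j : 'I_n, hm s (i * n + j) = diag_pattern U i j /\
      hm s (n * n + (i * n + j)) = diag_pattern V i j.
Proof.
have [S [Sx [T [Tx [arr [reachS reachT _] [minS minT _] cST [f [injf fT]]]]]]] := both_sides_spec A.
have [s [As sT]] := state_perm injf fT cST.
move=> sf; rewrite {}/sf program_P1E.
move: (hrun n both_sides (hinit A)) arr => s0 arr.
set t2 := tdiag _; set t1 := tdiag _.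
have [|||||[B1 _ a1] _] := @emit_spec n (HC 0) 0 t1
  (fun i j => (i == j) && ((ha s0 8 i != 0) || (ha s0 9 i != 0))) s0.
- by [].
- by lia.
- by [].
- by [].
- move=> s' i j _ _ [ka _ r0 r1]; have := decides_diag (decides_or
    (@decides_member n 8 0 s') (@decides_member n 9 0 s')).
  by rewrite r0 r1 !ka.
set s1 := hrun n _ s0 in B1 a1 *; clearbody s1.
have [|||||[C1 C2 _] _] := @emit_spec n (HRow HN) (n * n) t2
  (fun i j => (i == j) && ((ha s1 10 i != 0) || (ha s1 11 i != 0))) s1.
- by move=> s' /=; case: ltnP => //; lia.
- by lia.
- by [].
- by [].
- move=> s' i j _ _ [ka _ r0 r1]; have := decides_diag (decides_or
    (@decides_member n 10 0 s') (@decides_member n 11 0 s')).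
  by rewrite r0 r1 !ka.
exists (S :|: Sx), (T :|: Tx); split; first exact: minimal_P1 As sT reachS reachT minS minT.
move=> i j; have [a8 a9 a10 a11] := arr i.
rewrite C1 // C2; last by left; have := ltn_ord i; have := ltn_ord j; nia.
by rewrite -[i * n + j]add0n B1 // !mxE !a1 a8 a9 a10 a11 !in_setU (inj_eq val_inj).
Qed.

Lemma program_P2_spec (R : realType) n (A : 'M[bool]_n) :
  let s := hrun n program_P2 (hinit A) in
  exists B K C : 'M[bool]_n, solves_P2 R A B K C /\
    forall i j : 'I_n, [/\ hm s (i * n + j) = B i j, hm s (n * n + (i * n + j)) = K i j &
      hm s (n * n + n * n + (i * n + j)) = C i j].
Proof.
case: n A => [|m] A; first by exists 0%R, 0%R, 0%R; split; [exact: solves_P2_dim0|case].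
move: m.+1 (ltn0Sn m) A => n n0 A {m}.
have [S [Sx [T [Tx [arr [reachS reachT conn1] [minS minT minK] cST [f [injf fT]]]]]]] := both_sides_spec A.
have az b a : b \in [:: 12; 13; 14] -> ha (hrun n both_sides (hinit A)) b a = 0.
  by rewrite !inE => /or3P [] /eqP ->; rewrite ha_frame.
have rz q : q \in [:: 9; 10; 11] -> hr (hrun n both_sides (hinit A)) q = 0.
  by rewrite !inE => /or3P [] /eqP ->; rewrite hr_frame.
move=> sf; rewrite {}/sf program_P2E.
move: (hrun n both_sides (hinit A)) arr conn1 az rz => s arr conn1 az rz.
have [i|i|P [h [h' [kappa [K12 [r10 r11] [injk kT] hubS [PS far chain]]]]]] :=
  @pairing_spec n A S T s n0 _ _ conn1 cST az rz.
- by case: (arr i).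
- by case: (arr i).
have k8 b : b \in [:: 8; 9; 10; 11] -> ha (hrun n pairing s) b = ha s b.
  by rewrite !inE => /or4P [] /eqP ->; rewrite ha_frame.
move: (hrun n pairing s) K12 r10 r11 k8 => s0 K12 r10 r11 k8.
have arr0 (i : 'I_n) : [/\ (ha s0 8 i != 0) = (i \in S), (ha s0 9 i != 0) = (i \in Sx),
    (ha s0 10 i != 0) = (i \in T) & (ha s0 11 i != 0) = (i \in Tx)].
  by rewrite !k8.
clear s arr conn1 az rz k8.
have [s [As sT sk]] : exists s : {perm 'I_n}, [/\ forall x, x \notin S -> A x (s x),
    forall x, (s x \in T) = (x \in S) & {in S, s =1 kappa}].
  (* [kappa] maps [S] onto [T] and [f] matches the complements; together they form one
     permutation. *)
  pose g x := if x \in S then kappa x else f x.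
  have gT x : (g x \in T) = (x \in S).
    rewrite /g; case: ifP => xS; first by rewrite -kT imset_f.
    by have [_ /negbTE] := fT x (negbT xS).
  have injg : injective g.
    move=> x y gxy; have := gT x; rewrite gxy gT; move: gxy; rewrite /g.
    case: ifP => xS; case: ifP => yS // gxy _; first exact: injk.
    by apply: injf => //; rewrite inE ?xS ?yS.
  exists (perm injg); split=> x; rewrite permE //; rewrite /g.
    by move=> xS; rewrite (negbTE xS); case: (fT x xS).
  by move=> ->.
set t3 := tor _ _; set t2 := tif _; set t1 := tor _ _.
have [|||||[B1 _ a1] k1] := @emit_spec n (HC 0) 0 t1
  (fun i j => (i == j) && (ha s0 8 i != 0) || (ha s0 9 i != 0) && (j == h)) s0.
- by [].
- by lia.
- by [].
- by [].
- move=> s' i j _ _ [ka kr r0 r1]; have := decides_or (decides_diag (@decides_member n 8 0 s'))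
    (decides_and (@decides_member n 9 0 s') (@decides_eq n (HV 1) (HV 10) s')).
  by rewrite /= r0 r1 (kr 10 isT) r10 !ka.
set s1 := hrun n _ s0 in B1 a1 k1 *; clearbody s1.
have [|||||[K1 K2 a2] k2] := @emit_spec n (HRow HN) (n * n) t2
  (fun i j => ha s1 12 (i * n + j) != 0) s1.
- by move=> s' /=; case: ltnP => //; lia.
- by lia.
- by [].
- by [].
- move=> s' i j iN _ [ka _ r0 r1]; have := @decides_if n (at2 12 (HV 0) (HV 1)) s'.
  by rewrite /= r0 r1 lt2n // !ka.
set s2 := hrun n _ s1 in K1 K2 a2 k2 *; clearbody s2.
have [|||||[C1 C2 _] _] := @emit_spec n (HAdd (HRow HN) (HRow HN)) (n * n + n * n) t3
  (fun i j => (i == j) && (ha s2 10 j != 0) || (ha s2 11 j != 0) && (i == h')) s2.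
- by move=> s' /=; case: ltnP => //; lia.
- by lia.
- by [].
- by [].
- move=> s' i j _ _ [ka kr r0 r1]; have := decides_or (decides_diag (@decides_member n 10 1 s'))
    (decides_and (@decides_member n 11 1 s') (@decides_eq n (HV 0) (HV 11) s')).
  by rewrite /= r0 r1 (kr 11 isT) (k2 11 isT) (k1 11 isT) r11 !ka.
exists (hub_inputs S Sx h), (hub_feedback S s h h'), (trmx (hub_inputs T Tx h')); split.
  apply: (@minimal_P2 _ _ _ _ _ _ _ P) => //.
  - by move=> /hubS [hS <-]; split => //; exact: sk.
  - by move=> v w vS wS vP wP; rewrite sk //; exact: far.
  - by move=> /chain; apply: hub_chain_eq => x xP; rewrite sk // (subsetP PS).
move=> i j; have [a8 a9 _ _] := arr0 i; have [_ _ a10 a11] := arr0 j.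
have lt : i * n + j < n * n by have := ltn_ord i; have := ltn_ord j; nia.
split.
- rewrite C2; last by left; lia.
  rewrite K2; last by left.
  by rewrite -[i * n + j]add0n B1 // mxE a8 a9 !(inj_eq val_inj).
- rewrite C2; last by left; lia.
  by rewrite K1 // a1 K12 mxE; case iS: (i \in S); rewrite //= sk.
- by rewrite C1 // !a2 !a1 a10 a11 !mxE !(inj_eq val_inj) (eq_sym j i).
Qed.

End Output.

Theorem corollary3 (R : realType) :
  (exists p : cmd, computes_in_cubic_time p (@outputs_P1d R)) /\
  (exists p : cmd, computes_in_cubic_time p (@outputs_P1 R)) /\
  (exists p : cmd, computes_in_cubic_time p (@outputs_P2 R)).
Proof.
have [wf1 d1] := program_P1_wf; have [wf2 d2] := program_P2_wf.
have lt1 n (i j : 'I_n) : (i * n + j < n * n)%N by have := ltn_ord i; have := ltn_ord j; nia.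
split; [|split].
- exists (Seq prologue (comp program_P1)); apply: compile_cubic => // n A s sE.
  have [U [V [P1 out]]] := program_P1_spec R A.
  exists (diag_pattern U), (diag_pattern V).
  split; last (exact: P1_dedicated); move=> i j; have := lt1 n i j; have [o1 o2] := out i j => lt;
    by rewrite sE ?add0n; [|lia].
- exists (Seq prologue (comp program_P1)); apply: compile_cubic => // n A s sE.
  have [U [V [P1 out]]] := program_P1_spec R A.
  exists (diag_pattern U), (diag_pattern V).
  split => // i j; have := lt1 n i j; have [o1 o2] := out i j => lt;
    by rewrite sE ?add0n; [|lia].
- exists (Seq prologue (comp program_P2)); apply: compile_cubic => // n A s sE.
  have [B [K [C [P2 out]]]] := program_P2_spec R A.
  exists B, K, C.
  split => // i j; have := lt1 n i j; have [o1 o2 o3] := out i j => lt;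
    by rewrite sE ?add0n; [|lia].
Qed.
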